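(* Let $\mathcal H$ be the Hermitian polar space of a non-degenerate $\sigma$-Hermitian form $h$ of finite Witt index $n\ge 2$ and anisotropic defect $d$ (finite or infinite) on a vector space $V$ over a field $\mathbb F$, and suppose $\mathbb F\neq\mathbb F_4$. Then for every $k=1,2,\dots,n-1$ the generating rank of the $k$-Grassmannian satisfies $\mathrm{gr}(\mathcal H_k)=\binom{2n+d}{k}$ if $d$ is finite, and $\mathrm{gr}(\mathcal H_k)=d$ if $d$ is infinite.
   Context: Let $\mathbb F$ be a field with a non-identity involutory automorphism $\sigma$, $V$ an $\mathbb F$-vector space of (possibly infinite) dimension, and $h:V\times V\to\mathbb F$ a non-degenerate $\sigma$-Hermitian form of finite Witt index $n\ge2$. Then $V=V_1\oplus\cdots\oplus V_n\oplus V_0$ with $V_1,\dots,V_n$ pairwise orthogonal hyperbolic planes and $V_0$ anisotropic and orthogonal to each $V_i$; the anisotropic defect is $d=\dim V_0$ (so $\dim V=2n+d$). The polar space $\mathcal H$ has as points the 1-dimensional totally isotropic subspaces of $V$; a $k$-subspace of $\mathcal H$ is a totally isotropic subspace of $V$ of vector dimension $k$, and $S_k(\mathcal H)$ denotes their set. For $1\le k<n$ the $k$-Grassmannian $\mathcal H_k$ is the point-line geometry with point set $S_k(\mathcal H)$ and lines the sets $\{Z\in S_k(\mathcal H): X\subset Z\subset Y\}$ for $X\in S_{k-1}(\mathcal H)$, $Y\in S_{k+1}(\mathcal H)$, $X\subset Y$ (with $S_0=\{0\}$). For a point-line geometry $\Gamma$, a subspace is a set of points containing every line meeting it in at least two points;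 the span $\langle S\rangle_\Gamma$ of a set $S$ of points is the smallest subspace containing $S$; $S$ generates $\Gamma$ if $\langle S\rangle_\Gamma$ is the whole point set; the generating rank $\mathrm{gr}(\Gamma)$ is the minimum cardinality of a generating set. *)

(* Defs.v *)
From HB Require Import structures.
From mathcomp Require Import all_boot all_order all_algebra.
Set Implicit Arguments. Unset Strict Implicit. Unset Printing Implicit Defensive.
Import GRing.Theory.
Local Open Scope ring_scope.

Section Hermitian.
Variables (F : fieldType) (V : lmodType F).

Definition vsubset (X Y : V -> Prop) : Prop := forall v, X v -> Y v.

Definition fspan (m : nat) (u : 'I_m -> V) : V -> Prop :=
  fun v => exists c : 'I_m -> F, v = \sum_(i < m) c i *: u i.

Definition lin_indep (m : nat) (u : 'I_m -> V) : Prop :=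
  forall c : 'I_m -> F, \sum_(i < m) c i *: u i = 0 -> forall i, c i = 0.

Definition has_dim (X : V -> Prop) (k : nat) : Prop :=
  exists u : 'I_k -> V, lin_indep u /\ (forall v, X v <-> fspan u v).

Definition basis_fam (W : V -> Prop) (B : Type) (b : B -> V) : Prop :=
  (forall x, W (b x)) /\
  (forall (m : nat) (t : 'I_m -> B) (c : 'I_m -> F),
      injective t -> \sum_(i < m) c i *: b (t i) = 0 -> forall i, c i = 0) /\
  (forall v, W v -> exists (m : nat) (t : 'I_m -> B) (c : 'I_m -> F),
      v = \sum_(i < m) c i *: b (t i)).

Variable h : V -> V -> F.

Definition is_sigma_hermitian (sigma : {rmorphism F -> F}) : Prop :=
  (forall a u w v, h (a *: u + w) v = a * h u v + h w v) /\
  (forall u v, h u v = sigma (h v u)).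

Definition nondeg_form : Prop := forall u, (forall v, h u v = 0) -> u = 0.

Definition tot_iso (X : V -> Prop) : Prop := forall u v, X u -> X v -> h u v = 0.

Definition ksub (k : nat) (X : V -> Prop) : Prop := has_dim X k /\ tot_iso X.

(* Z lies on the line of H_k determined by X in S_{k-1}, Y in S_{k+1} *)
Definition on_line (k : nat) (X Y Z : V -> Prop) : Prop :=
  ksub k Z /\ vsubset X Z /\ vsubset Z Y.

Definition geom_subspace (k : nat) (P : (V -> Prop) -> Prop) : Prop :=
  (forall Z, P Z -> ksub k Z) /\
  forall X Y, ksub k.-1 X -> ksub k.+1 Y -> vsubset X Y ->
    forall Z1 Z2, on_line k X Y Z1 -> on_line k X Y Z2 -> Z1 <> Z2 ->
      P Z1 -> P Z2 -> forall Z, on_line k X Y Z -> P Z.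

Definition geom_span (k : nat) (S : (V -> Prop) -> Prop) (Z : V -> Prop) : Prop :=
  forall P, geom_subspace k P -> (forall W, S W -> P W) -> P Z.

Definition generates (k : nat) (S : (V -> Prop) -> Prop) : Prop :=
  (forall Z, S Z -> ksub k Z) /\ (forall Z, ksub k Z -> geom_span k S Z).

Definition gr_is_nat (k N : nat) : Prop :=
  (exists g : 'I_N -> (V -> Prop),
      injective g /\ generates k (fun Z => exists i, Z = g i)) /\
  (forall S, generates k S ->
      exists g : 'I_N -> (V -> Prop), injective g /\ forall i, S (g i)).

Definition gr_is_card (k : nat) (B : Type) : Prop :=
  (exists g : B -> (V -> Prop),
      injective g /\ generates k (fun Z => exists x, Z = g x)) /\
  (forall S, generates k S ->
      exists g : B -> (V -> Prop), injective g /\ forall x, S (g x)).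

End Hermitian.

Definition infinite_type (B : Type) : Prop :=
  ~ exists (m : nat) (t : 'I_m -> B), forall x, exists i, t i = x.

(* Main.v *)
Require Import Defs.
From HB Require Import structures.
From mathcomp Require Import all_boot all_order all_algebra.
From mathcomp Require Import ring zify.
From mathcomp Require boolp classical_sets functions.
Import GRing.Theory.
Local Open Scope ring_scope.
Set Implicit Arguments. Unset Strict Implicit. Unset Printing Implicit Defensive.

(* Lower bound. The Grassmann map [X |-> x_1 /\ .. /\ x_k] sends the lines of the geometry to lines
   of the k-th exterior power of V, so the image of a generating set spans the same subspace as the
   image of all totally isotropic k-subspaces. Since k < n this is the whole exterior power, and an
   exchange argument, valid in infinite dimension, compares cardinalities. For infinite d the
   linearly independent vectors b /\ e_1 /\ .. /\ e_(k-1), b in a basis of V_0, suffice.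

   Upper bound. Let d be finite, N = 2n + d, and split V as <p, q> + U with (p, q) hyperbolic and U
   orthogonal to p and q. By induction, C(N-2, k-1) generators produce all k-subspaces through p, and
   as many those through q. If P is a subspace of the geometry containing these, then the k-subspaces
   of U in P are closed under hyperbolic lines of residues, because the Hermitian quadrangle in
   dimension 4 is generated by two orthogonal hyperbolic pairs; for this closure C(N-2, k) generators
   are enough. The subspaces meeting U in codimension at most one are then in P, and C(N-2, k-2)
   further generators, one above each generator for the (k-2)-subspaces of U, yield everything, by
   passing twice from a non-degenerate hyperplane to the whole space. The count is Pascal's rule.
   That hyperbolic lines generate S_k with C(N, k) elements is an induction over the hyperplanes
   orthogonal to anisotropic vectors; it rests on the connectedness of {w | h(w, w) = m} under
   translations by isotropic vectors, which needs more than two elements in the fixed field of sigma,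
   that is, F <> F_4. For infinite d every k-subspace lies in a subspace spanned by the hyperbolic
   pairs and finitely many basis vectors of V_0, and the finite generating sets are put together. *)

(** * Fields with an involution and sesquilinear forms *)

(** The induction from U to W meets an obstacle inside U. The case k + 1 = n, with n the Witt index
    of U and n + 1 that of W, must be covered; there the (k+1)-subspaces of U are maximal, U carries
    no line of the (k+1)-Grassmannian, and an induction on ordinary lines says nothing about them.
    Hyperbolic lines still exist in this case, [hyperbolic_generation] puts no bound on k, and the
    plane <p, q> is what makes the hyperbolic lines of U available to a subspace of the geometry of
    W. The characteristic may be 2, so nothing is ever halved. The substitute is that x + sg x takes
    every value of the fixed field: this corrects the norm of a vector along an isotropic one, and
    with the dual basis for the trace form it solves two trace equations at once. The upper bounds
    only state that a list of length at most C(N, k) generates. That its members are distinct and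
    that the length is exact is deduced from the lower bound. *)

Section Field.
Variables (F : fieldType) (sg : {rmorphism F -> F}).
Hypothesis sgK : forall x, sg (sg x) = x.

(** [(1, b)] is a basis of F over the fixed field, and [(x, y)] is its dual basis for the trace form
    u * sg v + sg u * v. *)
Lemma dual_basis b : sg b != b ->
  exists x y, [/\ x + sg x = 1, x * sg b + sg x * b = 0,
    y + sg y = 0 & y * sg b + sg y * b = 1].
Proof.
move=> nb; have d1 : b - sg b != 0 by rewrite subr_eq0 eq_sym.
have d2 : sg b - b != 0 by rewrite subr_eq0.
exists (b / (b - sg b)), (- (b - sg b)^-1).
rewrite !(rmorphN, rmorphM, fmorphV, rmorphB) /= !sgK.
by split; field; rewrite ?d1 ?d2.
Qed.

Lemma trace_pair b c1 c2 : sg b != b -> sg c1 = c1 -> sg c2 = c2 ->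
  exists x, x + sg x = c1 /\ x * sg b + sg x * b = c2.
Proof.
move=> /dual_basis [x [y [x1 x2 y1 y2]]] s1 s2.
exists (c1 * x + c2 * y); rewrite rmorphD !rmorphM /= s1 s2; split.
  by rewrite -[RHS]addr0 -[in RHS](mulr0 c2) -y1 -[c1 in RHS]mulr1 -x1; ring.
by rewrite -[RHS]addr0 -[in RHS](mulr0 c1) -x2 -[c2 in RHS]mulr1 -y2; ring.
Qed.

Hypothesis sg_neq : exists x, sg x <> x.

Lemma sg_moved : exists b, sg b != b.
Proof. by case: sg_neq => b /eqP; exists b. Qed.

Lemma trace_surj c : sg c = c -> exists x, x + sg x = c.
Proof.
move=> sc; have [b nb] := sg_moved.
by have [x [xc _]] := trace_pair nb sc (rmorph0 sg); exists x.
Qed.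

Lemma skew_neq0 : exists s, s != 0 /\ sg s = - s.
Proof.
have [b nb] := sg_moved; exists (sg b - b); rewrite subr_eq0 nb; split=> //.
by rewrite rmorphB /= sgK opprB.
Qed.

(** Additive Hilbert 90: [z] is [c] times an element of trace 1. *)
Lemma skew_diff c : c + sg c = 0 -> exists z, z - sg z = c.
Proof.
move=> /eqP; rewrite addr_eq0 => /eqP cE.
have sc : sg c = - c by rewrite [in RHS]cE opprK.
have [x x1] := trace_surj (rmorph1 sg).
by exists (c * x); rewrite rmorphM /= sc -[RHS]mulr1 -x1; ring.
Qed.

(** If the fixed field were {0, 1}, then F, with basis [(1, b)] over it, would consist of 0, 1, b
    and 1 + b. *)
Lemma fixed_elem : (~ exists t : 'I_4 -> F, bijective t) ->
  exists c, [/\ sg c = c, c != 0 & c != 1].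
Proof.
move=> n4; have [b nb] := sg_moved.
case: (boolp.pselect (exists c, [/\ sg c = c, c != 0 & c != 1])) => // H; case: n4.
have F0 c : sg c = c -> (c == 0) || (c == 1).
  move=> sc; apply/negPn/negP; rewrite negb_or => /andP[c0 c1].
  by apply: H; exists c.
have b0 : b != 0 by apply: contraNneq nb => ->; rewrite rmorph0.
have b1 : b != 1 by apply: contraNneq nb => ->; rewrite rmorph1.
pose s := [:: 0; 1; b; 1 + b] : seq F.
have us : uniq s.
  have e1 : 0 != 1 + b.
    by apply: contraNneq nb => e; rewrite -[b](addKr 1) -e addr0 rmorphN rmorph1.
  have e2 : 1 != 1 + b by rewrite -subr_eq0 opprD addNKr oppr_eq0.
  have e3 : b != 1 + b by rewrite -subr_eq0 opprD addrCA subrr addr0 oppr_eq0 oner_neq0.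
  by rewrite /= !inE !negb_or e1 e2 e3 ![_ == b]eq_sym b0 b1 eq_sym oner_neq0.
have alls y : y \in s.
  have d : b - sg b != 0 by rewrite subr_eq0 eq_sym.
  have d' : sg b - b != 0 by rewrite subr_eq0.
  (* The coordinates of [y] in the basis [(1, b)] are [y - c * b] and [c]. *)
  pose c := (y - sg y) / (b - sg b).
  have sc : sg c = c.
    by rewrite /c rmorphM fmorphV !rmorphB /= !sgK; field; rewrite d d'.
  have sa : sg (y - c * b) = y - c * b.
    by rewrite rmorphB rmorphM /= sc /c; field.
  rewrite -[y](subrK (c * b)); rewrite !inE.
  by case/orP: (F0 _ sa) => /eqP ->; case/orP: (F0 _ sc) => /eqP ->;
    rewrite ?mul0r ?mul1r ?addr0 ?add0r eqxx ?orbT.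
exists (fun i : 'I_4 => s`_i); apply: (@Bijective _ _ _ (fun y => inord (index y s))).
  by move=> i; rewrite index_uniq // inord_val.
by move=> y; rewrite inordK ?nth_index // -[4%N]/(size s) index_mem.
Qed.

End Field.

(** * Rules of computation for hermitian forms *)

Section Form.
Variables (F : fieldType) (sg : {rmorphism F -> F}) (V : lmodType F) (h : V -> V -> F).
Hypothesis hH : is_sigma_hermitian h sg.

Lemma form_sym u v : h u v = sg (h v u).
Proof. exact: hH.2. Qed.
Lemma form_Dl u v w : h (u + v) w = h u w + h v w.
Proof. by rewrite -[u]scale1r hH.1 mul1r scale1r. Qed.
Lemma form_0l w : h 0 w = 0.
Proof. by apply: (addrI (h 0 w)); rewrite -form_Dl !addr0. Qed.
Lemma form_Zl a v w : h (a *: v) w = a * h v w.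
Proof. by rewrite -[a *: v]addr0 hH.1 form_0l addr0. Qed.
Lemma form_Nl v w : h (- v) w = - h v w.
Proof. by rewrite -scaleN1r form_Zl mulN1r. Qed.
Lemma form_Dr u v w : h w (u + v) = h w u + h w v.
Proof. by rewrite form_sym form_Dl rmorphD /= -!form_sym. Qed.
Lemma form_0r w : h w 0 = 0.
Proof. by rewrite form_sym form_0l rmorph0. Qed.
Lemma form_Zr a v w : h w (a *: v) = sg a * h w v.
Proof. by rewrite form_sym form_Zl rmorphM /= -form_sym. Qed.
Lemma form_Nr v w : h w (- v) = - h w v.
Proof. by rewrite form_sym form_Nl rmorphN /= -form_sym. Qed.
Lemma form_Bl u v w : h (u - v) w = h u w - h v w.
Proof. by rewrite form_Dl form_Nl. Qed.
Lemma form_Br u v w : h w (u - v) = h w u - h w v.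
Proof. by rewrite form_Dr form_Nr. Qed.
Definition formE := (form_Bl, form_Br, form_Dl, form_Dr, form_Zl, form_Zr,
  form_Nl, form_Nr, form_0l, form_0r).
Lemma form_orth u v : h u v = 0 -> h v u = 0.
Proof. by move=> e; rewrite form_sym e rmorph0. Qed.
Lemma form_fixed u : sg (h u u) = h u u.
Proof. by rewrite -form_sym. Qed.
Lemma form_suml I (r : seq I) P (x : I -> V) w :
  h (\sum_(i <- r | P i) x i) w = \sum_(i <- r | P i) h (x i) w.
Proof. by apply: (big_morph (h^~ w)); [move=> ? ?; exact: form_Dl | exact: form_0l]. Qed.
End Form.

(** * Orthogonality, Witt index and hyperbolic pairs *)

Section Perp.
Variables (F : fieldType) (sg : {rmorphism F -> F}) (vT : vectType F) (h : vT -> vT -> F).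
Hypothesis hH : is_sigma_hermitian h sg.
Implicit Types (x y z v : vT) (A X Y Z W M : {vspace vT}).
Local Notation hE := (formE hH).

Definition form_left y : vT -> F^o := fun x => h x y.
Lemma form_left_linear y : linear (form_left y).
Proof. by move=> a u v; rewrite /form_left !hE. Qed.
HB.instance Definition _ y :=
  GRing.isLinear.Build F vT F^o *:%R (form_left y) (form_left_linear y).

Fixpoint perps (s : seq vT) : {vspace vT} :=
  if s is y :: s' then (lker (linfun (form_left y)) :&: perps s')%VS else fullv.
Definition perp X := perps (vbasis X).
Definition tot_isov X := (X <= perp X)%VS.

Lemma mem_perps s x : reflect (forall y, y \in s -> h x y = 0) (x \in perps s).
Proof.
elim: s => [|y s IH] /=; first by rewrite memvf; constructor.
rewrite memv_cap memv_ker lfunE /=; apply: (iffP andP).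
  by case=> /eqP hy /IH hs z; rewrite inE => /orP[/eqP->//|/hs].
move=> H; split; first by apply/eqP; apply: H; rewrite mem_head.
by apply/IH => z zs; apply: H; rewrite inE zs orbT.
Qed.

Lemma mem_perp X x : reflect (forall y, y \in X -> h x y = 0) (x \in perp X).
Proof.
apply: (iffP (mem_perps _ _)) => H y yX; last by apply/H/vbasis_mem.
rewrite (coord_vbasis yX) (form_sym hH) (form_suml hH) big1 ?rmorph0 // => i _.
by rewrite (formE hH) (form_orth hH) ?mulr0 //; apply/H/memt_nth.
Qed.

Lemma perp_sym X Y : (X <= perp Y)%VS = (Y <= perp X)%VS.
Proof.
by apply/subvP/subvP => H x xX; apply/mem_perp => y /H/mem_perp/(_ _ xX)/(form_orth hH).
Qed.

Lemma perpS X Y : (X <= Y)%VS -> (perp Y <= perp X)%VS.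
Proof. by move=> /subvP s; apply/subvP => x /mem_perp H; apply/mem_perp => y /s/H. Qed.

Lemma perpD X Y : perp (X + Y)%VS = (perp X :&: perp Y)%VS.
Proof.
apply/eqP; rewrite eqEsubv subv_cap !perpS ?addvSl ?addvSr //=.
apply/subvP => x /memv_capP[/mem_perp Hx /mem_perp Hy]; apply/mem_perp => z.
by move=> /memv_addP[a aX [b bY ->]]; rewrite hE Hx ?Hy ?addr0.
Qed.

Lemma mem_perp1 x v : (x \in perp <[v]>%VS) = (h x v == 0).
Proof.
apply/mem_perp/eqP => [H|H y /vlineP[k ->]]; first exact/H/memv_line.
by rewrite hE H mulr0.
Qed.

Lemma tot_isoP X : reflect {in X &, forall x y, h x y = 0} (tot_isov X).
Proof.
apply: (iffP subvP) => H; first by move=> x y /H/mem_perp xX /xX.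
by move=> x xX; apply/mem_perp => y; apply: H.
Qed.

Lemma tot_isoS X Y : (X <= Y)%VS -> tot_isov Y -> tot_isov X.
Proof. by move=> /subvP s /tot_isoP tY; apply/tot_isoP => x y /s xY /s; apply: tY. Qed.

Lemma tot_isoD X Y : tot_isov (X + Y) = [&& tot_isov X, tot_isov Y & (X <= perp Y)%VS].
Proof.
rewrite /tot_isov perpD subv_cap !subv_add.
rewrite [(Y <= perp X)%VS]perp_sym; do 3 case: (_ <= _)%VS => //.
Qed.

Lemma tot_iso1 x : tot_isov <[x]>%VS = (h x x == 0).
Proof. by rewrite /tot_isov -memvE mem_perp1. Qed.

Lemma tot_iso_add1 X x : tot_isov (X + <[x]>)%VS = [&& tot_isov X, h x x == 0 & x \in perp X].
Proof. by rewrite tot_isoD tot_iso1 perp_sym memvE. Qed.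

Lemma tot_iso0 : tot_isov 0%VS.
Proof. exact: sub0v. Qed.

Lemma dim_perps W s : (\dim W <= \dim (W :&: perps s) + size s)%N.
Proof.
elim: s => [|y s IH] /=; first by rewrite capvf addn0.
apply: (leq_trans IH); rewrite addnS -addSn leq_add2r.
rewrite [(lker _ :&: _)%VS]capvC capvA.
rewrite -(limg_ker_dim (linfun (form_left y)) (W :&: perps s)) -addn1 leq_add2l.
by rewrite (leq_trans (dimvS (subvf _))) // dimvf.
Qed.

Lemma dim_perp_ge W X : (\dim W <= \dim (W :&: perp X) + \dim X)%N.
Proof. by rewrite -(size_tuple (vbasis X)) dim_perps. Qed.

Lemma dim_add1 X x : \dim (X + <[x]>) = (\dim X + (x \notin X))%N.
Proof.
case: (boolP (x \in X)) => xX.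
  by rewrite addn0 (addv_idPl _) // -memvE.
have x0 : x != 0 by apply: contraNneq xX => ->; rewrite mem0v.
rewrite dimv_disjoint_sum ?dim_vline ?x0 //; apply/eqP; rewrite -subv0.
apply/subvP => z /memv_capP[zX /vlineP[k zE]]; move: zX; rewrite zE rpredZeq (negbTE xX) orbF.
by move=> /eqP->; rewrite scale0r mem0v.
Qed.

Lemma sub_add1 X Y x : (X + <[x]> <= Y)%VS = (X <= Y)%VS && (x \in Y).
Proof. by rewrite subv_add memvE. Qed.

Lemma mem_add1 X x : x \in (X + <[x]>)%VS.
Proof. by rewrite memvE addvSr. Qed.

Lemma mem_add1P X x z : reflect (exists2 y, y \in X & exists a, z = y + a *: x) (z \in (X + <[x]>)%VS).
Proof.
apply: (iffP memv_addP) => [[y yX [w /vlineP[a ->] ->]]|[y yX [a ->]]].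
  by exists y => //; exists a.
by exists y => //; exists (a *: x); rewrite // memvZ ?memv_line.
Qed.

Lemma eq_add1 X Y x : (X <= Y)%VS -> x \in Y -> x \notin X -> \dim Y = (\dim X).+1 ->
  Y = (X + <[x]>)%VS.
Proof.
move=> XY xY xX dY; apply/eqP; rewrite eq_sym eqEdim sub_add1 XY xY dim_add1 xX dY.
by rewrite addn1 leqnn.
Qed.

Lemma split_add1 X Y : (X <= Y)%VS -> \dim Y = (\dim X).+1 ->
  exists x, [/\ x \in Y, x \notin X & Y = (X + <[x]>)%VS].
Proof.
move=> XY dY; have /subvPn[x xY xX] : ~~ (Y <= X)%VS.
  by apply/negP => /dimvS; rewrite dY ltnn.
by exists x; split=> //; apply: eq_add1.
Qed.

Lemma dim_between k X Y : (X <= Y)%VS -> (\dim X <= k <= \dim Y)%N ->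
  exists Z, [/\ (X <= Z)%VS, (Z <= Y)%VS & \dim Z = k].
Proof.
move=> XY /andP[/subnK <-]; elim: (k - \dim X)%N => [|m IH] kY; first by exists X.
rewrite addSn in kY *; have [Z [XZ ZY dZ]] := IH (ltnW kY).
have /subvPn[x xY xZ] : ~~ (Y <= Z)%VS by apply/negP => /dimvS; rewrite dZ leqNgt kY.
exists (Z + <[x]>)%VS; rewrite sub_add1 ZY xY dim_add1 xZ dZ addn1; split=> //.
by rewrite (subv_trans XZ) ?addvSl.
Qed.

Definition nondegv W := (W :&: perp W == 0)%VS.

(** One inequality is [dim_perp_ge]. For the other, it is applied to a complement of X in W: what is
    orthogonal to X and to the complement lies in the radical of W, hence is 0. *)
Lemma dim_perp W X : nondegv W -> (X <= W)%VS -> (\dim (W :&: perp X) + \dim X)%N = \dim W.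
Proof.
move=> /eqP ndW XW; apply/eqP; rewrite eqn_leq dim_perp_ge andbT.
have := dim_perp_ge (W :&: perp X) (W :\: X).
have -> : (W :&: perp X :&: perp (W :\: X))%VS = 0%VS.
  apply/eqP; rewrite -subv0 -ndW subv_cap (subv_trans (capvSl _ _)) ?capvSl //=.
  have WE : (W = W :\: X + X)%VS by rewrite addv_diff (addv_idPl XW).
  by rewrite [in perp W]WE perpD subv_cap capvSr (subv_trans (capvSl _ _)) ?capvSr.
rewrite dimv0 add0n -(leq_add2r (\dim X)) => /leq_trans -> //.
by rewrite -[in X in (_ <= X)%N](dimv_cap_compl W X) (capv_idPr XW) addnC.
Qed.

Lemma perpK W X : nondegv W -> (X <= W)%VS -> (W :&: perp (W :&: perp X))%VS = X.
Proof.
move=> nd XW; apply/esym/eqP; rewrite eqEdim subv_cap XW perp_sym capvSr /=.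
rewrite -(leq_add2r (\dim (W :&: perp X))) (dim_perp nd) ?capvSl //.
by rewrite addnC (dim_perp nd XW).
Qed.

Lemma nondeg_perp W T : nondegv W -> nondegv T -> (T <= W)%VS -> nondegv (W :&: perp T).
Proof.
move=> nd /eqP ndT TW; rewrite /nondegv -subv0 -ndT; apply/subvP => x.
move=> /memv_capP[/memv_capP[xW xT] xE].
have xT' : x \in T by rewrite -(perpK nd TW) memv_cap xW.
by rewrite memv_cap xT'.
Qed.

Lemma nondeg_ex W X x : nondegv W -> (X <= W)%VS -> x \in W -> x \notin X ->
  exists c, [/\ c \in W, c \in perp X & h x c != 0].
Proof.
move=> nd XW xW; rewrite -[in x \notin _](perpK nd XW) memv_cap xW /= memvE perp_sym.
move=> /subvPn[c /memv_capP[cW cX]]; rewrite mem_perp1 => hc; exists c; split=> //.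
by apply: contra hc => /eqP/(form_orth hH)->.
Qed.

Lemma nondeg1 v : h v v != 0 -> nondegv <[v]>%VS.
Proof.
move=> hv; rewrite /nondegv -subv0; apply/subvP => x /memv_capP[/vlineP[a ->]].
by rewrite mem_perp1 hE mulf_eq0 (negbTE hv) orbF => /eqP->; rewrite scale0r mem0v.
Qed.

Lemma nondeg2 p q : h p p = 0 -> h q q = 0 -> h p q = 1 -> nondegv (<[p]> + <[q]>)%VS.
Proof.
move=> pp qq pq; have qp : h q p = 1 by rewrite (form_sym hH) pq rmorph1.
rewrite /nondegv -subv0; apply/subvP => x /memv_capP[].
move=> /memv_addP[_ /vlineP[a ->] [_ /vlineP[b ->] ->]].
rewrite perpD memv_cap !mem_perp1 !hE pp qq pq qp !mulr0 !mulr1 add0r addr0.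
by move=> /andP[/eqP-> /eqP->]; rewrite !scale0r addr0 mem0v.
Qed.

Lemma dim_hyperplane W v : nondegv W -> v \in W -> h v v != 0 ->
  \dim W = (\dim (W :&: perp <[v]>)).+1.
Proof.
move=> nd vW hv; rewrite -(dim_perp nd (_ : <[v]> <= W)%VS) ?dim_vline -?memvE //.
suff -> : v != 0 by rewrite addn1.
by apply: contraNneq hv => ->; rewrite hE.
Qed.

Lemma hyperplane_proj W v x : v \in W -> h v v != 0 -> x \in W ->
  exists2 y, y \in (W :&: perp <[v]>)%VS & exists a, x = y + a *: v.
Proof.
move=> vW hv xW; exists (x - (h x v / h v v) *: v); last first.
  by exists (h x v / h v v); rewrite subrK.
by rewrite memv_cap mem_perp1 !hE divfK // subrr eqxx rpredB ?rpredZ.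
Qed.

Lemma plane_proj W p q x : h p p = 0 -> h q q = 0 -> h p q = 1 -> p \in W -> q \in W -> x \in W ->
  exists2 y, y \in (W :&: perp (<[p]> + <[q]>))%VS & exists a b, x = y + (a *: p + b *: q).
Proof.
move=> pp qq pq pW qW xW; have qp : h q p = 1 by rewrite (form_sym hH) pq rmorph1.
exists (x - (h x q *: p + h x p *: q)); last by exists (h x q), (h x p); rewrite subrK.
rewrite memv_cap perpD memv_cap !mem_perp1 !hE pp qq pq qp !mulr0 !mulr1 add0r addr0.
by rewrite !subrr eqxx rpredB // rpredD ?rpredZ.
Qed.

(* Counting dimensions, [M :&: perp X] is too large to be contained in [X]. *)
Lemma tot_iso_extend M X : tot_isov M -> tot_isov X -> (\dim X < \dim M)%N ->
  exists b, [/\ b \in M, b \in perp X & b \notin X].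
Proof.
move=> tM tX lt; have sub : (M :&: perp (X :\: M) <= perp X)%VS.
  rewrite -[in perp X](addv_diff_cap X M) perpD subv_cap capvSr /=.
  rewrite (subv_trans (capvSl _ _)) // (subv_trans tM) // perpS ?capvSr //.
have /subvPn[b /memv_capP[bM bX] nb] : ~~ (M :&: perp (X :\: M) <= X)%VS.
  apply/negP => sX; have := dim_perp_ge M (X :\: M).
  have := dimvS (_ : M :&: perp (X :\: M) <= X :&: M)%VS.
  rewrite subv_cap sX capvSl => /(_ isT) d1 d2.
  have := dimv_cap_compl X M; move: lt d1 d2; lia.
by exists b; split=> //; apply: (subvP sub); rewrite memv_cap bM.
Qed.

Definition max_iso W M :=
  [/\ (M <= W)%VS, tot_isov M & forall x, x \in W -> x \in perp M -> h x x = 0 -> x \in M].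

(** A vector of X orthogonal to a complement of X in M is orthogonal to all of M, hence in M by
    maximality. This costs at most dim M - dim (M :&: X) dimensions of X. *)
Lemma max_iso_dim W M X : max_iso W M -> (X <= W)%VS -> tot_isov X -> (\dim X <= \dim M)%N.
Proof.
move=> [MW tM mM] XW tX.
have s : (X :&: perp (M :\: X) <= X :&: M)%VS.
  apply/subvP => x /memv_capP[xX xM]; rewrite memv_cap xX; apply: mM.
  - exact: (subvP XW).
  - rewrite -(addv_diff_cap M X) perpD memv_cap xM /=.
    by apply: (subvP (perpS (capvSr _ _))); apply: (subvP tX).
  by apply: (tot_isoP _ tX).
have := dimvS s; have := dim_perp_ge X (M :\: X); have := dimv_cap_compl M X.
by rewrite [(M :&: X)%VS]capvC; lia.
Qed.

Hypothesis sgK : forall a, sg (sg a) = a.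
Hypothesis sg_neq : exists a, sg a <> a.

(** The norm of [l *: b + g] is [h g g] plus the trace of [l * h b g], which can be given any fixed
    value. *)
Lemma iso_correct (E : {vspace vT}) b g : b \in E -> g \in E -> h b b = 0 -> h b g != 0 ->
  exists l, l *: b + g \in E /\ h (l *: b + g) (l *: b + g) = 0.
Proof.
move=> bE gE bb bg; have sN : sg (- h g g) = - h g g by rewrite rmorphN /= (form_fixed hH).
have [x xE] := trace_surj sgK sg_neq sN.
exists (x / h b g); rewrite rpredD ?rpredZ //; split=> //.
rewrite !hE bb !mulr0 add0r [h g b](form_sym hH) -rmorphM /= divfK // addrA xE.
by rewrite addNr.
Qed.

(** If [b] is orthogonal to [u], some [g'] is orthogonal to neither of them, since two proper
    subspaces do not cover E. Correcting [g'] along [b] makes it isotropic without changing its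
    product with [u]. *)
Lemma iso_escape (E : {vspace vT}) b c g u : b \in E -> c \in E -> g \in E -> h b b = 0 ->
  h b c != 0 -> h g u != 0 -> exists z, [/\ z \in E, h z z = 0 & h z u != 0].
Proof.
move=> bE cE gE bb bc gu; have [bu|bu] := eqVneq (h b u) 0; last by exists b.
have [g' [g'E bg' gu']] : exists g', [/\ g' \in E, h b g' != 0 & h g' u != 0].
  have [cu|cu] := eqVneq (h c u) 0; last by exists c.
  have [bg|bg] := eqVneq (h b g) 0; last by exists g.
  by exists (c + g); rewrite !hE bg cu addr0 add0r rpredD.
have [l [lE ll]] := iso_correct bE g'E bb bg'.
by exists (l *: b + g'); rewrite lE ll !hE bu mulr0 add0r.
Qed.

Lemma iso_pair (E : {vspace vT}) b c : b \in E -> c \in E -> h b b = 0 -> h b c != 0 ->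
  exists f, [/\ f \in E, h f f = 0 & h b f = 1].
Proof.
move=> bE cE bb bc; pose c' := sg (h b c)^-1 *: c.
have bc' : h b c' = 1 by rewrite hE sgK mulVf.
have c'E : c' \in E by rewrite rpredZ.
clearbody c'; have nz : h b c' != 0 by rewrite bc' oner_neq0.
have [l [lE ll]] := iso_correct bE c'E bb nz.
by exists (l *: b + c'); rewrite lE ll !hE bb bc' mulr0 add0r.
Qed.

(** In a hyperbolic pair [(b, f)] the norm of [x *: b + f] is the trace of [x], which can be 1. *)
Lemma nonisotropic_ex W : nondegv W -> W != 0%VS -> exists2 v, v \in W & h v v != 0.
Proof.
move=> nd W0; have x0 : vpick W != 0 by rewrite vpick0.
have [||c [cW _ hc]] := @nondeg_ex W 0 (vpick W) nd (sub0v _).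
- exact: memv_pick.
- by rewrite memv0.
have [e|?] := eqVneq (h (vpick W) (vpick W)) 0; last by exists (vpick W); rewrite ?memv_pick.
have [f [fW ff bf]] := iso_pair (memv_pick W) cW e hc.
have [x xE] := trace_surj sgK sg_neq (rmorph1 sg).
exists (x *: vpick W + f); first by rewrite rpredD ?rpredZ ?memv_pick.
rewrite !hE e ff [h f _](form_sym hH) bf rmorph1 !mulr0 !mulr1 add0r addr0 xE.
exact: oner_neq0.
Qed.

End Perp.

(** * Connectedness of hermitian quadrics under translations by isotropic vectors *)

Section Connect.
Variables (F : fieldType) (sg : {rmorphism F -> F}) (vT : vectType F) (h : vT -> vT -> F).
Hypothesis hH : is_sigma_hermitian h sg.
Hypothesis sgK : forall a, sg (sg a) = a.
Hypothesis sg_neq : exists a, sg a <> a.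
Hypothesis F0_elem : exists c, [/\ sg c = c, c != 0 & c != 1].
Local Notation hE := (formE hH).

Variables (E : {vspace vT}) (e f : vT).
Hypotheses (eE : e \in E) (fE : f \in E) (ee : h e e = 0) (ff : h f f = 0) (ef : h e f = 1).
Variables (m : F) (G : vT -> Prop).
Hypotheses (m0 : m != 0) (sm : sg m = m).
Hypothesis G_move : forall w y, w \in E -> y \in E -> h w w = m -> h y y = 0 -> h w y != 0 ->
  h (w + y) (w + y) = m -> G w -> G (w + y).

Let fe : h f e = 1. Proof. by rewrite (form_sym hH) ef rmorph1. Qed.

(** The condition on the sum says that [w' - w] is isotropic, and [h w w' != m] that it is not
    orthogonal to [w]. Both are symmetric in [w] and [w'], so the move can be reversed. *)
Lemma move_iff w w' : w \in E -> w' \in E -> h w w = m -> h w' w' = m ->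
  h w w' + h w' w = m + m -> h w w' != m -> G w <-> G w'.
Proof.
have half u u' : u \in E -> u' \in E -> h u u = m -> h u' u' = m ->
    h u u' + h u' u = m + m -> h u u' != m -> G u -> G u'.
  move=> uE u'E uu u'u' t nm Gu.
  have yy : h (u' - u) (u' - u) = 0.
    rewrite !hE uu u'u'; apply: (addIr (h u u' + h u' u)); rewrite [in RHS]t; ring.
  have -> : u' = u + (u' - u) by rewrite addrC subrK.
  apply: G_move; rewrite ?rpredB //; last by rewrite [u + _]addrC subrK.
  by rewrite !hE uu subr_eq0.
move=> wE w'E ww w'w' t nm; split; first exact: half.
apply: half => //; first by rewrite addrC.
by apply: contra nm => /eqP e'; move: t; rewrite e' => /addIr/eqP.
Qed.

Definition hvec a b g := a *: e + b *: f + g.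

Definition orth_plane g := [/\ g \in E, h e g = 0 & h f g = 0].

Lemma hvec_form a b g a' b' g' : orth_plane g -> orth_plane g' ->
  h (hvec a b g) (hvec a' b' g') = a * sg b' + b * sg a' + h g g'.
Proof.
move=> [_ eg fg] [_ eg' fg'].
rewrite /hvec !hE ee ff ef fe eg' fg' (form_orth hH eg) (form_orth hH fg); ring.
Qed.

Lemma hvecE a b g : orth_plane g -> hvec a b g \in E.
Proof. by case=> gE _ _; rewrite !rpredD ?rpredZ. Qed.

Lemma hvec_decomp x : x \in E -> exists a b g, orth_plane g /\ x = hvec a b g.
Proof.
move=> xE; exists (h x f), (h x e), (x - (h x f *: e + h x e *: f)).
split; last by rewrite /hvec addrC subrK.
split; first by rewrite rpredB ?rpredD ?rpredZ.
  by rewrite !hE ee ef -!(form_sym hH); ring.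
by rewrite !hE ff fe -!(form_sym hH); ring.
Qed.

(** The difference is a multiple of [e]. Since [h g g != m] forces [b != 0], it is not orthogonal to
    the vectors. *)
Lemma move_e a a' b g : orth_plane g -> h (hvec a b g) (hvec a b g) = m ->
  h (hvec a' b g) (hvec a' b g) = m -> h g g != m ->
  G (hvec a b g) <-> G (hvec a' b g).
Proof.
move=> og n1 n2 gm; have [->//|aa] := eqVneq a a'.
move: (n1) (n2); rewrite !hvec_form // => t1 t2.
have b0 : b != 0.
  by apply: contraNneq gm => b0; rewrite -t1 b0 rmorph0 mulr0 mul0r !add0r.
apply: move_iff; rewrite ?hvecE // !hvec_form //.
  rewrite -{1}t1 -t2; ring.
rewrite -t1 -subr_eq0.
have -> : a * sg b + b * sg a' + h g g - (a * sg b + b * sg a + h g g) = b * sg (a' - a).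
  by rewrite rmorphB /=; ring.
by rewrite mulf_neq0 // fmorph_eq0 subr_eq0 eq_sym.
Qed.

Lemma move_f a b b' g : orth_plane g -> h (hvec a b g) (hvec a b g) = m ->
  h (hvec a b' g) (hvec a b' g) = m -> h g g != m ->
  G (hvec a b g) <-> G (hvec a b' g).
Proof.
move=> og n1 n2 gm; have [->//|bb] := eqVneq b b'.
move: (n1) (n2); rewrite !hvec_form // => t1 t2.
have a0 : a != 0.
  by apply: contraNneq gm => a0; rewrite -t1 a0 rmorph0 mulr0 mul0r !add0r.
apply: move_iff; rewrite ?hvecE // !hvec_form //.
  rewrite -{1}t1 -t2; ring.
rewrite -t1 -subr_eq0.
have -> : a * sg b' + b * sg a + h g g - (a * sg b + b * sg a + h g g) = a * sg (b' - b).
  by rewrite rmorphB /=; ring.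
by rewrite mulf_neq0 // fmorph_eq0 subr_eq0 eq_sym.
Qed.

Let form_sg u : sg (h u u) = h u u. Proof. by rewrite -(form_sym hH). Qed.

(** If [b' / b] is not fixed by [sg], the two trace equations for a first coordinate compatible with
    both [b] and [b'] have a common solution, and [move_e], [move_f], [move_e] lead across. If it is
    fixed, [b * d] with [d] moved by [sg] is an intermediate stop. *)
Lemma move_plane a b a' b' g : orth_plane g -> h (hvec a b g) (hvec a b g) = m ->
  h (hvec a' b' g) (hvec a' b' g) = m -> h g g != m ->
  G (hvec a b g) <-> G (hvec a' b' g).
Proof.
move=> og n1 n2 gm.
have nz c d : h (hvec c d g) (hvec c d g) = m -> d != 0.
  rewrite hvec_form // => t; apply: contraNneq gm => b0.
  by rewrite -t b0 rmorph0 mulr0 mul0r !add0r.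
have gen c d c' d' : h (hvec c d g) (hvec c d g) = m -> h (hvec c' d' g) (hvec c' d' g) = m ->
    sg (d' / d) != d' / d -> G (hvec c d g) <-> G (hvec c' d' g).
  move=> n n' nd; have d0 := nz _ _ n; have d'0 := nz _ _ n'.
  have sf : sg (m - h g g) = m - h g g by rewrite rmorphB /= sm form_sg.
  have [x [x1 x2]] := trace_pair sgK nd sf sf.
  pose c1 := x / sg d; have sd0 : sg d != 0 by rewrite fmorph_eq0.
  have e1 : h (hvec c1 d g) (hvec c1 d g) = m.
    rewrite hvec_form // /c1 rmorphM fmorphV /= sgK divfK // mulrCA divff // mulr1.
    by rewrite x1 subrK.
  have e2 : h (hvec c1 d' g) (hvec c1 d' g) = m.
    rewrite hvec_form // -[RHS](subrK (h g g)) -x2 /c1 !rmorphM !fmorphV /= sgK.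
    by field; rewrite d0 sd0.
  rewrite (move_e og n e1 gm) (move_f og e1 e2 gm); exact: move_e.
have [bb|] := eqVneq (sg (b' / b)) (b' / b); last exact: gen.
have [d nd] := sg_moved sg_neq; have b0 := nz _ _ n1; have b'0 := nz _ _ n2.
have d0 : d != 0 by apply: contraNneq nd => ->; rewrite rmorph0.
have sf : sg (m - h g g) = m - h g g by rewrite rmorphB /= sm form_sg.
have [x xE] := trace_surj sgK sg_neq sf.
have sbd : sg (b * d) != 0 by rewrite fmorph_eq0 mulf_neq0.
have e1 : h (hvec (x / sg (b * d)) (b * d) g) (hvec (x / sg (b * d)) (b * d) g) = m.
  rewrite hvec_form // rmorphM fmorphV /= sgK divfK // mulrCA divff ?mulf_neq0 // mulr1.
  by rewrite xE subrK.
rewrite (gen _ _ _ _ n1 e1); last by rewrite mulrAC divff // mul1r.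
apply: gen => //; rewrite invfM mulrA rmorphM fmorphV /= bb.
have q0 : b' / b != 0 by rewrite mulf_neq0 ?invr_eq0.
by rewrite (inj_eq (mulfI q0)) (inj_eq invr_inj).
Qed.

(* The condition [h w w' = m] to be avoided is a quadratic equation in [t] for [d := d0 + t];
   hence a fixed field with more than two elements is needed. *)
Lemma move_bridge g g' : orth_plane g -> orth_plane g' -> h g g != m ->
  exists a b a' b', [/\ h (hvec a b g) (hvec a b g) = m, h (hvec a' b' g') (hvec a' b' g') = m &
    G (hvec a b g) <-> G (hvec a' b' g')].
Proof.
move=> og og' gm; have [d0 nd0] := sg_moved sg_neq; have [c [sc c0 c1]] := F0_elem.
pose r := m - h g g'; pose k1 := m - h g g; pose k2 := m - h g' g'.
have k10 : k1 != 0 by rewrite subr_eq0 eq_sym.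
pose psi d := - k1 * d * sg d + sg r * sg d + r * d - k2.
have [d nd pd] : exists2 d, sg d != d & psi d != 0.
  have [p0|] := eqVneq (psi d0) 0; last by exists d0.
  have nadd t : sg t = t -> sg (d0 + t) != d0 + t.
    by move=> st; rewrite rmorphD /= st (inj_eq (addIr t)).
  have padd t : sg t = t -> psi (d0 + t) = psi d0 + t * (r + sg r - k1 * (d0 + sg d0) - k1 * t).
    by move=> st; rewrite /psi rmorphD /= st; ring.
  have [p1|p1] := eqVneq (psi (d0 + 1)) 0; last first.
    by exists (d0 + 1) => //; apply/nadd/rmorph1.
  (* Since [psi] vanishes at [d0] and [d0 + 1], its value at [d0 + c] is [c * k1 * (1 - c)]. *)
  exists (d0 + c); first exact: nadd.
  move: p1; rewrite !padd ?rmorph1 // p0 !add0r mul1r mulr1 => /eqP; rewrite subr_eq0 => /eqP ->.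
  by rewrite mulf_neq0 // -{1}[k1]mulr1 -mulrBr mulf_neq0 // subr_eq0 eq_sym.
have sk1 : sg k1 = k1 by rewrite rmorphB /= sm form_sg.
have sk2 : sg k2 = k2 by rewrite rmorphB /= sm form_sg.
have sr : sg (r + sg r) = r + sg r by rewrite rmorphD /= sgK addrC.
have [a [a1 a2]] := trace_pair sgK nd sk1 sr.
have [a' [a'1 a'2]] := trace_pair sgK nd (rmorph0 sg) sk2.
have n1 : h (hvec a 1 g) (hvec a 1 g) = m.
  by rewrite hvec_form // rmorph1 mulr1 mul1r a1 subrK.
have n2 : h (hvec a' d g') (hvec a' d g') = m.
  by rewrite hvec_form // [d * _]mulrC a'2 subrK.
have sgr : sg r = m - h g' g by rewrite /r rmorphB /= sm -(form_sym hH).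
exists a, 1, a', d; split=> //; apply: move_iff; rewrite ?hvecE // !hvec_form // ?rmorph1.
  rewrite !mul1r !mulr1 (_ : h g g' = m - r); last by rewrite /r; ring.
  rewrite (_ : h g' g = m - sg r); last by rewrite sgr; ring.
  have -> : d * sg a = r + sg r - a * sg d by rewrite -a2; ring.
  rewrite (_ : sg a' = - a'); first by ring.
  by apply/eqP; rewrite -addr_eq0 addrC a'1.
rewrite mul1r -subr_eq0;  apply: contraNneq pd => q0. 
have q1 : a * sg d + sg a' - r = 0 by rewrite -[RHS]q0 /r; ring.
have q2 : sg a = k1 - a by rewrite -a1; ring.
have q3 : sg a' = - a' by apply/eqP; rewrite -addr_eq0 addrC a'1.
have rE : r = a * sg d - a' by apply/eqP; rewrite -subr_eq0 -oppr_eq0 -q3 opprB q1.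
have srE : sg r = a * sg d + (k1 - a) * d - r by rewrite -q2 a2; ring.
by apply/eqP; rewrite /psi -[k2]a'2 srE q3 rE; ring.
Qed.

(** For [h g g = m] the moves inside the plane may be blocked. Scaling [g] by [1 + t] with [t] skew
    changes its norm to (1 - t^2) m; the coordinates [a], [b] are then shifted by [a'], [b'] so that
    the total norm stays [m] and the difference is isotropic. *)
Lemma move_bad a b g : orth_plane g -> h (hvec a b g) (hvec a b g) = m -> h g g = m ->
  exists a' b' g', [/\ orth_plane g', h (hvec a' b' g') (hvec a' b' g') = m, h g' g' != m &
    G (hvec a b g) <-> G (hvec a' b' g')].
Proof.
move=> og n1 gm; have [gE eg fg] := og; have [s [s0 ss]] := skew_neq0 sgK sg_neq.
have [c [sc c0 c1]] := F0_elem.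
(* The shift will satisfy [a * sg b' + b * sg a' = s] unless [a = b = 0], and [move_iff] excludes
   the value [t * m] for this expression; hence [t * m != s]. *)
have [t [t0 st tm]] : exists t, [/\ t != 0, sg t = - t & t * m != s].
  have [m1|m1] := eqVneq m 1.
    exists (c * s); rewrite mulf_neq0 // rmorphM /= sc ss mulrN m1 mulr1; split=> //.
    by rewrite -{2}[s]mul1r (inj_eq (mulIf s0)).
  by exists s; split=> //; rewrite -{2}[s]mulr1 (inj_eq (mulfI s0)).
have og' : orth_plane ((1 + t) *: g) by split; rewrite ?rpredZ // !hE ?eg ?fg mulr0.
have n' : h ((1 + t) *: g) ((1 + t) *: g) = m - t * t * m.
  by rewrite !hE gm rmorphD rmorph1 /= st; ring.
have np : m - t * t * m != m.
  by rewrite -subr_eq0 addrAC subrr sub0r oppr_eq0 !mulf_neq0.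
have n0 : a * sg b + b * sg a = 0.
  by apply: (addIr m); rewrite add0r -{2}n1 hvec_form // gm.
have key u v : u * sg v + v * sg u = 0 -> v != 0 ->
    exists u' v', [/\ u' * sg v' + v' * sg u' = t * t * m,
      u * sg v' + v * sg u' = s & v' * sg u + u' * sg v = - s].
  move=> uv v0; have sr : sg (t * t * m) = t * t * m by rewrite !rmorphM /= sm st mulrNN.
  have [r rE] := trace_surj sgK sg_neq sr.
  have sv0 : sg v != 0 by rewrite fmorph_eq0.
  have ss0 : sg s != 0 by rewrite fmorph_eq0.
  pose x := sg (s / v); pose y := - sg (r / s).
  have sx : sg x = s / v by rewrite sgK.
  have xv : x * sg v = - s by rewrite /x rmorphM fmorphV /= divfK.
  have sy : sg y = - (r / s) by rewrite rmorphN /= sgK.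
  clearbody x y; have e1 : u * sg (y * v) + v * sg (x + y * u) = s.
    rewrite rmorphD !rmorphM /= sx.
    transitivity (sg y * (u * sg v + v * sg u) + v * (s / v)); first by ring.
    by rewrite uv mulr0 add0r mulrCA divff // mulr1.
  have e2 : y * v * sg u + (x + y * u) * sg v = - s.
    transitivity (y * (u * sg v + v * sg u) + x * sg v); first by ring.
    by rewrite uv mulr0 add0r.
  exists (x + y * u), (y * v); split=> //.
  rewrite rmorphD !rmorphM /= sx.
  transitivity (x * sg v * sg y + sg (x * sg v * sg y) + y * sg y * (u * sg v + v * sg u)).
    by rewrite !rmorphM /= !sgK sx; ring.
  rewrite uv xv sy mulr0 addr0 mulrNN.
  by rewrite (_ : s * (r / s) = r) ?rE // mulrCA divff ?mulr1.
have [a' [b' [z1 z2 z3]]] : exists a' b', [/\ a' * sg b' + b' * sg a' = t * t * m,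
    a * sg b' + b * sg a' + (b' * sg a + a' * sg b) = 0 &
    a * sg b' + b * sg a' - t * m != 0].
  have [b0|b0] := eqVneq b 0; last first.
    have [a' [b' [z1 z2 z3]]] := key _ _ n0 b0.
    by exists a', b'; rewrite z2 z3 subrr subr_eq0 eq_sym.
  have [a0|a0] := eqVneq a 0; last first.
    have [b' [a' [z1 z2 z3]]] := key b a (etrans (addrC _ _) n0) a0.
    exists a', b'; rewrite [a * _ + _]addrC z2 [b' * _ + _]addrC z3 subrr subr_eq0 eq_sym.
    by rewrite addrC z1.
  have sr : sg (t * t * m) = t * t * m by rewrite !rmorphM /= sm st mulrNN.
  have [r rE] := trace_surj sgK sg_neq sr.
  exists r, 1; rewrite a0 b0 !rmorph1 rmorph0 !mulr1 !mul1r !mul0r !mulr0 !addr0 rE sub0r.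
  by rewrite oppr_eq0 mulf_neq0.
have n2 : h (hvec (a + a') (b + b') ((1 + t) *: g)) (hvec (a + a') (b + b') ((1 + t) *: g)) = m.
  rewrite hvec_form // n' !rmorphD /=.
  transitivity (a * sg b + b * sg a + (a * sg b' + b * sg a' + (b' * sg a + a' * sg b))
    + (a' * sg b' + b' * sg a') + (m - t * t * m)); first by ring.
  by rewrite n0 z2 z1; ring.
exists (a + a'), (b + b'), ((1 + t) *: g); split; rewrite ?n' //.
apply: move_iff; rewrite ?hvecE // !hvec_form // !hE gm !rmorphD rmorph1 /= st.
  transitivity (a * sg b + b * sg a + (a * sg b + b * sg a)
     + (a * sg b' + b * sg a' + (b' * sg a + a' * sg b)) + (m + m)); first by ring.
  by rewrite n0 z2 !add0r.
rewrite -subr_eq0 (_ : _ - m = a * sg b + b * sg a + (a * sg b' + b * sg a' - t * m)); last by ring.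
by rewrite n0 add0r.
Qed.

Lemma all_connected w w' : w \in E -> w' \in E -> h w w = m -> h w' w' = m -> G w -> G w'.
Proof.
suff key u u' : u \in E -> u' \in E -> h u u = m -> h u' u' = m -> G u <-> G u'.
  by move=> wE w'E ww w'w'; have [] := key _ _ wE w'E ww w'w'.
have good x : x \in E -> h x x = m -> exists a b g, [/\ orth_plane g,
    h (hvec a b g) (hvec a b g) = m, h g g != m & G x <-> G (hvec a b g)].
  move=> xE xx; have [a [b [g [og xe]]]] := hvec_decomp xE; rewrite xe in xx *.
  have [gm|gm] := eqVneq (h g g) m; first exact: move_bad.
  by exists a, b, g.
move=> uE u'E uu u'u'; have [a [b [g [og n gm ->]]]] := good _ uE uu.
have [a' [b' [g' [og' n' gm' ->]]]] := good _ u'E u'u'.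
have [c [d [c' [d' [e1 e2 e3]]]]] := move_bridge og og' gm.
by rewrite (move_plane og n e1 gm) e3; apply: move_plane.
Qed.
End Connect.

(** * Generation by hyperbolic lines *)

Section HyperbolicGeneration.
Variables (F : fieldType) (sg : {rmorphism F -> F}) (vT : vectType F) (h : vT -> vT -> F).
Hypothesis hH : is_sigma_hermitian h sg.
Hypothesis sgK : forall a, sg (sg a) = a.
Hypothesis sg_neq : exists a, sg a <> a.
Implicit Types (x y z v : vT) (A X Y Z W M : {vspace vT}).
Local Notation hE := (formE hH).
Local Notation perp := (perp h).

Definition ksubv W k X := [&& (X <= W)%VS, tot_isov h X & \dim X == k].

(* For [o = true] the lines of the [k]-Grassmannian; for [o = false] the sets of isotropic
   points on the hyperbolic lines of the residues of its [k.-1]-subspaces. *)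
Definition closed_under (o : bool) W k (P : {vspace vT} -> Prop) :=
  forall A x y a c, (\dim A).+1 = k ->
    ksubv W k (A + <[x]>) -> ksubv W k (A + <[y]>) -> (h x y == 0) = o ->
    ksubv W k (A + <[a *: x + c *: y]>) ->
    P (A + <[x]>)%VS -> P (A + <[y]>)%VS -> P (A + <[a *: x + c *: y]>)%VS.

Definition generatesv o W k (L : seq {vspace vT}) :=
  forall P, closed_under o W k P -> {in L, forall Z, P Z} -> forall Z, ksubv W k Z -> P Z.

Lemma ksubvS W W' k X : (W <= W')%VS -> ksubv W k X -> ksubv W' k X.
Proof. by move=> s /and3P[XW tX dX]; rewrite /ksubv (subv_trans XW s) tX dX. Qed.

Lemma ksubv_add1 W k A x : ksubv W k A ->
  ksubv W k.+1 (A + <[x]>) = [&& x \in W, h x x == 0, x \in perp A & x \notin A].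
Proof.
move=> /and3P[AW tA /eqP dA]; rewrite /ksubv sub_add1 AW (tot_iso_add1 hH) tA dim_add1 dA /=.
by case: (x \in A); rewrite /= ?andbF ?addn0 ?addn1 ?eqxx ?andbT ?andbA // eqn_leq ltnn andbF !andbF.
Qed.

Lemma ksubv_sub W k k' A X : (A <= X)%VS -> \dim A = k' -> ksubv W k X -> ksubv W k' A.
Proof.
move=> AX dA /and3P[XW tX _].
by rewrite /ksubv (subv_trans AX XW) (tot_isoS hH AX tX) dA eqxx.
Qed.

Lemma ksubv0 W Z : ksubv W 0 Z = (Z == 0%VS).
Proof.
rewrite /ksubv dimv_eq0; case: eqP => [->|_]; last by rewrite !andbF.
by rewrite sub0v tot_iso0.
Qed.

Lemma generates0 o W : generatesv o W 0 [:: 0%VS].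
Proof. by move=> P _ P0 Z; rewrite ksubv0 => /eqP->; apply: P0; rewrite mem_head. Qed.

Lemma closed_under_sub o W W' k P : (W' <= W)%VS -> closed_under o W k P ->
  closed_under o W' k (fun Z => P Z).
Proof.
by move=> s cP A x y a c dA Ax Ay hxy Az; apply: cP => //; apply: ksubvS s _.
Qed.

(** Let X contain A + <y> with y = a y1 + c y2 and a, c nonzero. The hyperplane B of X orthogonal to
    [y1] contains A but not y; it is orthogonal to y and [y1], hence to [y2]. So X = B + <y> is on
    the hyperbolic line of B + <y1> and B + <y2>, which contain A + <y1> and A + <y2>. *)
Lemma hyperbolic_good W W' k P : (W' <= W)%VS -> closed_under false W k.+1 P ->
  closed_under false W' k (fun Y => forall X, ksubv W k.+1 X -> (Y <= X)%VS -> P X).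
Proof.
move=> sW cP A y1 y2 a c dA Y1 Y2 h12 Yk good1 good2 X Xk YX.
have [c0|c0] := eqVneq c 0.
  have a0 : a != 0.
    apply: contraTneq Yk => ->; rewrite c0 !scale0r addr0 /ksubv dim_add1 mem0v addn0.
    by rewrite -dA eqn_leq ltnn !andbF.
  apply: good1 => //; apply: subv_trans YX; rewrite c0 scale0r addr0 sub_add1 addvSl /=.
  by have := mem_add1 A (a *: y1); rewrite rpredZeq (negbTE a0).
have [a0|a0] := eqVneq a 0.
  apply: good2 => //; apply: subv_trans YX; rewrite a0 scale0r add0r sub_add1 addvSl /=.
  by have := mem_add1 A (c *: y2); rewrite rpredZeq (negbTE c0).
have kA : ksubv W' k.-1 A by apply: ksubv_sub Y1; rewrite ?addvSl // -dA.
have kE : k = k.-1.+1 by rewrite -dA.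
move: Y1 Y2 Yk; rewrite kE !ksubv_add1 //.
move=> /and4P[y1W y11 y1A ny1] /and4P[y2W y22 y2A ny2] /and4P[yW yy yA ny].
move: YX; rewrite sub_add1 => /andP[AX yX].
have [XW tX /eqP dX] := and3P Xk.
set y := a *: y1 + c *: y2 in yX yW yy yA ny *.
have hyy1 : h y y1 != 0.
  rewrite /y !hE (eqP y11) mulr0 add0r mulf_neq0 //.
  by apply: contraFneq h12 => /(form_orth hH) ->.
pose B := (X :&: perp <[y1]>)%VS.
have nyB : y \notin B by rewrite memv_cap (mem_perp1 hH) (negbTE hyy1) andbF.
have AB : (A <= B)%VS by rewrite subv_cap AX (perp_sym hH) -memvE.
have dB : \dim B = k.
  apply/eqP; rewrite eqn_leq -ltnS -dX; apply/andP; split; last first.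
    have := dim_perp_ge h X <[y1]>; rewrite dX dim_vline.
    by rewrite (_ : y1 != 0) ?addn1 ?ltnS //; apply: contraNneq ny1 => ->; rewrite mem0v.
  rewrite ltn_neqAle dimvS ?capvSl // andbT; apply: contra nyB => dBX.
  by have /eqP -> : B == X by rewrite -(dimv_leqif_eq (capvSl X (perp <[y1]>))).2.
have [b [bB nbA BE]] := split_add1 AB (etrans dB (esym dA)).
have /memv_capP[bX] := bB; rewrite (mem_perp1 hH) => /eqP by1.
have XE : X = (A + <[b]> + <[y]>)%VS by rewrite -BE; apply: eq_add1; rewrite ?capvSl ?dB.
have hby : h b y = 0 by apply: (tot_isoP hH _ tX).
have hby2 : h b y2 = 0.
  apply/eqP; move/eqP: hby; rewrite /y !hE by1 mulr0 add0r mulf_eq0 fmorph_eq0.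
  by rewrite (negbTE c0).
have kB : ksubv W k B by apply: ksubv_sub Xk; rewrite ?capvSl.
have ext z : z \in W' -> h z z == 0 -> z \in perp A -> h b z = 0 -> h y z != 0 ->
    ksubv W k.+1 (B + <[z]>)%VS.
  move=> zW zz zA bz yz; rewrite ksubv_add1 // (subvP sW _ zW) zz /= BE (perpD hH) memv_cap zA.
  rewrite (mem_perp1 hH) (form_orth hH bz) eqxx /= -BE.
  by apply: contra yz => /memv_capP[zX _]; apply/eqP/(tot_isoP hH _ tX).
have hyy2 : h y y2 != 0.
  by rewrite /y !hE (eqP y22) mulr0 addr0 mulf_neq0 // h12.
have e1 := ext _ y1W y11 y1A by1 hyy1; have e2 := ext _ y2W y22 y2A hby2 hyy2.
rewrite XE -BE; apply: cP; rewrite ?dB //.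
- by rewrite BE -XE.
- by apply: good1 => //; rewrite subv_add (subv_trans AB) ?addvSl ?addvSr.
- by apply: good2 => //; rewrite subv_add (subv_trans AB) ?addvSl ?addvSr.
Qed.

Hypothesis F0_elem : exists c, [/\ sg c = c, c != 0 & c != 1].

(** A (k+1)-subspace through Y and off the hyperplane W' is Y + <w + v> with w in W' orthogonal to Y
    and of norm - h v v. If y is isotropic and not orthogonal to w, then Y + <w + y + v> is on the
    hyperbolic line of Y + <w + v> and Y + <y>, the latter inside W'. Thus [all_connected] applies;
    [b] provides its hyperbolic pair. *)
Lemma hyperbolic_residue W v k Y b P X0 : nondegv h W -> v \in W -> h v v != 0 ->
  ksubv (W :&: perp <[v]>) k Y ->
  b \in (W :&: perp <[v]>)%VS -> b \in perp Y -> b \notin Y -> h b b = 0 ->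
  closed_under false W k.+1 P -> (forall X, ksubv (W :&: perp <[v]>) k.+1 X -> P X) ->
  ksubv W k.+1 X0 -> (Y <= X0)%VS -> ~~ (X0 <= W :&: perp <[v]>)%VS -> P X0 ->
  forall X, ksubv W k.+1 X -> (Y <= X)%VS -> P X.
Proof.
set W' := (W :&: perp <[v]>)%VS => ndW vW vv kY bW' bY nbY bb cP PW' kX0 YX0 nX0 PX0 X kX YX.
have [XW'|nX] := boolP (X <= W')%VS.
  by apply: PW'; case/and3P: kX => _ tX dX; rewrite /ksubv XW' tX dX.
have ndW' : nondegv h W' by apply: (nondeg_perp hH) => //; exact: (nondeg1 hH).
have /and3P[YW' tY /eqP dY] := kY.
have W'W : (W' <= W)%VS := capvSl _ _.
have vY : v \in perp Y by rewrite memvE (perp_sym hH) (subv_trans YW') ?capvSr.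
have [c [cW' cY hbc]] := nondeg_ex hH ndW' YW' bW' nbY.
pose E := (W' :&: perp Y)%VS.
have bE : b \in E by rewrite memv_cap bW'.
have cE : c \in E by rewrite memv_cap cW'.
have [f [fE ff bf]] := iso_pair hH sgK sg_neq bE cE bb hbc.
have kYW : ksubv W k Y by apply: ksubvS kY.
have rep Z : ksubv W k.+1 Z -> (Y <= Z)%VS -> ~~ (Z <= W')%VS ->
    exists w, [/\ w \in E, h w w = - h v v & Z = (Y + <[w + v]>)%VS].
  move=> kZ YZ nZ; have /and3P[ZW tZ /eqP dZ] := kZ.
  have /subvPn[x xZ xW'] := nZ.
  have [w wW' [a xE]] := hyperplane_proj hH vW vv (subvP ZW _ xZ).
  have a0 : a != 0 by apply: contraNneq xW' => a0; rewrite xE a0 scale0r addr0.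
  have {}xE : a^-1 *: x = a^-1 *: w + v by rewrite xE scalerDr scalerK.
  have xZ' : a^-1 *: w + v \in Z by rewrite -xE memvZ.
  have xY : a^-1 *: w + v \in perp Y by apply: (subvP (subv_trans tZ (perpS hH YZ))).
  have nxY : a^-1 *: w + v \notin Y.
    apply: contra xW' => /(subvP YW'); rewrite -xE => /(memvZ a).
    by rewrite scalerA mulfV // scale1r.
  exists (a^-1 *: w); split.
  - by rewrite memv_cap memvZ //= -[_ *: w](addrK v) rpredB.
  - have /eqP : h (a^-1 *: w + v) (a^-1 *: w + v) = 0 by apply: (tot_isoP hH _ tZ).
    have wv : h (a^-1 *: w) v = 0.
      by move: wW'; rewrite memv_cap (mem_perp1 hH) => /andP[_ /eqP e]; rewrite hE e mulr0.
    by rewrite !(form_Dl hH) !(form_Dr hH) wv (form_orth hH wv) add0r addr0 addr_eq0 => /eqP.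
  - by apply: eq_add1 => //; rewrite dZ dY.
have [w0 [w0E w0w0 X0E]] := rep _ kX0 YX0 nX0.
have [w [wE ww ->]] := rep _ kX YX nX.
have orth_v z : z \in E -> h z v = 0.
  by move=> /memv_capP[/memv_capP[_]]; rewrite (mem_perp1 hH) => /eqP.
have sum_form z z' : z \in E -> z' \in E -> h (z + v) (z' + v) = h z z' + h v v.
  move=> zE z'E; rewrite (form_Dl hH) !(form_Dr hH) (orth_v z) //.
  by rewrite (form_orth hH (orth_v z' _)) // add0r addr0.
have kz z : z \in E -> h z z = - h v v -> ksubv W k.+1 (Y + <[z + v]>).
  move=> zE zz; have /memv_capP[zW' zY] := zE.
  rewrite ksubv_add1 // (rpredD (subvP W'W _ zW') vW) (rpredD zY vY) sum_form // zz addNr eqxx /=.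
  apply: contra vv => /(subvP YW'); rewrite (rpredDl _ zW') memv_cap (mem_perp1 hH).
  by case/andP.
have nv0 : - h v v != 0 by rewrite oppr_eq0.
have snv : sg (- h v v) = - h v v by rewrite rmorphN /= (form_fixed hH).
have := @all_connected _ _ _ _ hH sgK sg_neq F0_elem E b f bE fE bb ff bf (- h v v)
  (fun z => P (Y + <[z + v]>)%VS) nv0 snv _ w0 w w0E wE w0w0 ww; apply.
  move=> z y zE yE zz yy zy zyn Pz.
  have -> : z + y + v = 1 *: (z + v) + 1 *: y by rewrite !scale1r addrAC.
  have hzy : h (z + v) y != 0 by rewrite (form_Dl hH) (form_orth hH (orth_v y yE)) addr0.
  have /memv_capP[yW' yY] := yE.
  have ky : ksubv W' k.+1 (Y + <[y]>).
    rewrite ksubv_add1 // yW' yy eqxx yY /=; apply: contra zy => yYm.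
    by case/memv_capP: zE => _ /(mem_perp hH)->.
  apply: cP; rewrite ?dY ?(negbTE hzy) //.
  - exact: kz.
  - exact: ksubvS ky.
  - by rewrite !scale1r addrAC; apply: kz => //; rewrite rpredD.
  - exact: PW'.
by rewrite -X0E.
Qed.

(* [W] is non-degenerate of Witt index [n] and anisotropic defect [d]. *)
Definition utype W n d :=
  [/\ nondegv h W, \dim W = (2 * n + d)%N & exists2 M, max_iso h W M & \dim M = n].

(** For positive defect, perp M is larger than M in W. A vector [v] of it outside M is anisotropic
    by maximality of M, and M survives in the hyperplane orthogonal to [v]. *)
Lemma utype_peel_aniso W n d : utype W n d.+1 ->
  exists v, [/\ v \in W, h v v != 0 & utype (W :&: perp <[v]>) n d].
Proof.
move=> [nd dW [M mM dM]]; have [MW tM maxM] := mM.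
have /subvPn[v /memv_capP[vW vM] nvM] : ~~ (W :&: perp M <= M)%VS.
  apply/negP => /dimvS; have := dim_perp hH nd MW; rewrite dW dM; clear; lia.
have vv : h v v != 0 by apply: contra nvM => /eqP/maxM->.
exists v; split=> //; have := dim_hyperplane hH nd vW vv; rewrite dW => dW'.
split; [|by move: dW'; clear; lia|].
  by apply: (nondeg_perp hH) => //; exact: (nondeg1 hH).
exists M => //; split=> //; first by rewrite subv_cap MW (perp_sym hH) -memvE.
by move=> x /memv_capP[xW _]; apply: maxM.
Qed.

(** For defect 0 any anisotropic [v] serves, but M shrinks to [M']. A dimension count shows that the
    orthogonal of [M'] in W is M + <v>, and an isotropic vector of M + <v> orthogonal to [v] lies in
    M: hence [M'] is maximal in the hyperplane. *)
Lemma utype_peel_iso W n : utype W n.+1 0 ->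
  exists v, [/\ v \in W, h v v != 0 & utype (W :&: perp <[v]>) n 1].
Proof.
move=> [nd dW [M mM dM]]; have [MW tM maxM] := mM.
have W0 : W != 0%VS by rewrite -dimv_eq0 dW.
have [v vW vv] := nonisotropic_ex hH sgK sg_neq nd W0.
exists v; split=> //; have := dim_hyperplane hH nd vW vv; rewrite dW => dW'.
have ndW' : nondegv h (W :&: perp <[v]>).
  by apply: (nondeg_perp hH) => //; exact: (nondeg1 hH).
have nvM : v \notin M by apply: contra vv => vM; apply/eqP/(tot_isoP hH _ tM).
pose M' := (M :&: perp <[v]>)%VS.
have M'W' : (M' <= W :&: perp <[v]>)%VS by rewrite capvS.
have tM' : tot_isov h M' by apply: (tot_isoS hH _ tM); rewrite ?capvSl.
have dM' : \dim M' = n.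
  have := dim_perp_ge h M <[v]>; rewrite dim_vline dM -/M'.
  have := dim_perp hH ndW' M'W'.
  have : (\dim M' <= \dim (W :&: perp <[v]> :&: perp M'))%N by rewrite dimvS // subv_cap M'W'.
  by case: (v != 0); move: dW'; clear; lia.
split=> //; first by move: dW'; clear; lia.
exists M' => //; split=> // x /memv_capP[xW xv] xM' xx.
have dE : \dim (W :&: perp M') = \dim (M + <[v]>).
  have := dim_perp hH nd (subv_trans M'W' (capvSl _ _)).
  by rewrite dW dM' dim_add1 nvM dM; clear; lia.
have sE : (M + <[v]> <= W :&: perp M')%VS.
  rewrite sub_add1 !subv_cap MW memv_cap vW /= memvE [(<[v]> <= _)%VS](perp_sym hH) capvSr andbT.
  by rewrite (subv_trans tM) // (perpS hH) ?capvSl.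
have : x \in (M + <[v]>)%VS.
  have /eqP -> : (M + <[v]> == W :&: perp M')%VS by rewrite eqEdim sE dE /=.
  by rewrite memv_cap xW.
case/(mem_add1P) => y yM [a xE]; rewrite memv_cap xv andbT.
have a0 : a = 0; last by rewrite xE a0 scale0r addr0.
move: xv; rewrite (mem_perp1 hH) => /eqP xv; apply/eqP.
have yx : h y x = 0.
  have : h x x = h y x + a * h v x by rewrite {1}xE !hE.
  by rewrite xx (form_orth hH xv) mulr0 addr0.
have sav : sg a * h y v = 0.
  by move: yx; rewrite xE !hE (tot_isoP hH _ tM) // add0r.
move/eqP: sav; rewrite mulf_eq0 fmorph_eq0 => /orP[//|/eqP yv].
by move/eqP: xv; rewrite xE !hE yv add0r mulf_eq0 (negbTE vv) orbF.
Qed.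

Lemma utype_iso_dim W n d X : utype W n d -> (X <= W)%VS -> tot_isov h X -> (\dim X <= n)%N.
Proof. by move=> [_ _ [M mM <-]]; apply: (max_iso_dim hH mM). Qed.

(** Every (k+1)-subspace of W contains a k-subspace Y of W'. Adding [m] subspaces over each Y of
    [L2] makes these Y good, and goodness passes to all Y. With [m = 1] the count is Pascal's
    rule. *)
Lemma hyperplane_step o W W' k m L1 L2 : (W' <= W)%VS -> \dim W = (\dim W').+1 ->
  all (ksubv W' k.+1) L1 -> generatesv o W' k.+1 L1 ->
  all (ksubv W' k) L2 -> generatesv o W' k L2 ->
  (forall P, closed_under o W k.+1 P -> (forall X, ksubv W' k.+1 X -> P X) ->
     closed_under o W' k (fun Y => forall X, ksubv W k.+1 X -> (Y <= X)%VS -> P X)) ->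
  (forall Y, ksubv W' k Y -> exists E, [/\ (size E <= m)%N, all (ksubv W k.+1) E &
     forall P, closed_under o W k.+1 P -> (forall X, ksubv W' k.+1 X -> P X) ->
       {in E, forall Z, P Z} -> forall X, ksubv W k.+1 X -> (Y <= X)%VS -> P X]) ->
  exists L, [/\ all (ksubv W k.+1) L, (size L <= size L1 + m * size L2)%N & generatesv o W k.+1 L].
Proof.
move=> sW dW kL1 gL1 kL2 gL2 good ext.
have [E EP] : exists E : {vspace vT} -> seq {vspace vT}, forall Y, ksubv W' k Y ->
    [/\ (size (E Y) <= m)%N, all (ksubv W k.+1) (E Y) &
     forall P, closed_under o W k.+1 P -> (forall X, ksubv W' k.+1 X -> P X) ->
       {in E Y, forall Z, P Z} -> forall X, ksubv W k.+1 X -> (Y <= X)%VS -> P X].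
  have [|E EP] := @boolp.choice _ _ (fun Y E => ksubv W' k Y ->
    [/\ (size E <= m)%N, all (ksubv W k.+1) E &
     forall P, closed_under o W k.+1 P -> (forall X, ksubv W' k.+1 X -> P X) ->
       {in E, forall Z, P Z} -> forall X, ksubv W k.+1 X -> (Y <= X)%VS -> P X]).
    move=> Y; have [/ext[E EP]|/negP nk] := boolP (ksubv W' k Y); first by exists E.
    by exists [::] => kY; case: nk.
  by exists E.
exists (L1 ++ flatten (map E L2)); split.
- rewrite all_cat; apply/andP; split.
    by apply/allP => Z /(allP kL1); apply: ksubvS.
  by apply/allP => Z /flattenP[_ /mapP[Y /(allP kL2)/EP[_ /allP kE _] ->]]; apply: kE.
- rewrite size_cat leq_add2l size_flatten /shape -map_comp.
  elim: L2 kL2 {gL2} => [|Y L2 IH] //= /andP[/EP[sE _ _] /IH IH'].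
  by rewrite mulnS leq_add.
move=> P cP PL Z kZ.
have PW' X : ksubv W' k.+1 X -> P X.
  apply: gL1; first exact: closed_under_sub cP.
  by move=> Y YL; apply: PL; rewrite mem_cat YL.
have PY Y : ksubv W' k Y -> forall X, ksubv W k.+1 X -> (Y <= X)%VS -> P X.
  apply: (gL2 (fun Y => forall X, ksubv W k.+1 X -> (Y <= X)%VS -> P X)); first exact: good.
  move=> {}Y YL; have [_ _] := EP Y (allP kL2 _ YL); apply=> //.
  move=> X XE; apply: PL; rewrite mem_cat; apply/orP; right; apply/flattenP.
  by exists (E Y) => //; apply: map_f.
have [ZW tZ /eqP dZ] := and3P kZ.
have [|Y [_ YZ dY]] := @dim_between _ _ k 0%VS (Z :&: W')%VS (sub0v _).
  have := dimv_sum_cap Z W'; have : (\dim (Z + W') <= \dim W)%N by rewrite dimvS // subv_add ZW.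
  by rewrite dimv0 dW dZ; clear; lia.
have [YZ' YW'] : (Y <= Z)%VS /\ (Y <= W')%VS by move: YZ; rewrite subv_cap => /andP.
by apply: (PY Y) => //; rewrite /ksubv YW' (tot_isoS hH YZ') // dY eqxx.
Qed.

Lemma one_extension W v k n Y : nondegv h W -> v \in W -> h v v != 0 ->
  (exists2 M, max_iso h (W :&: perp <[v]>) M & \dim M = n) -> (k < n)%N ->
  ksubv (W :&: perp <[v]>) k Y -> exists E, [/\ (size E <= 1)%N, all (ksubv W k.+1) E &
     forall P, closed_under false W k.+1 P -> (forall X, ksubv (W :&: perp <[v]>) k.+1 X -> P X) ->
       {in E, forall Z, P Z} -> forall X, ksubv W k.+1 X -> (Y <= X)%VS -> P X].
Proof.
move=> nd vW vv [M [MW' tM _] dM] kn kY.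
have [[X0 [kX0 YX0 nX0]]|nX] := boolp.pselect (exists X0, [/\ ksubv W k.+1 X0, (Y <= X0)%VS &
    ~~ (X0 <= W :&: perp <[v]>)%VS]); last first.
  exists [::]; split=> // P cP PW' _ X kX YX; apply: PW'.
  have XW' : (X <= W :&: perp <[v]>)%VS by apply/negPn/negP => ?; apply: nX; exists X.
  by case/and3P: kX => _ tX dX; rewrite /ksubv XW' tX.
exists [:: X0]; split=> //=; first by rewrite kX0.
move=> P cP PW' PX0; have [_ tY /eqP dY] := and3P kY.
have [|b [bM bY nbY]] := tot_iso_extend hH tM tY; first by rewrite dY dM.
apply: (@hyperbolic_residue W v k Y b P X0) => //.
- exact: (subvP MW').
- exact: (tot_isoP hH _ tM).
- by apply: PX0; rewrite mem_head.
Qed.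

(** Here the orthogonal of Y modulo Y is 2-dimensional, so its isotropic points form a single
    hyperbolic line when there are two of them, and two of them generate it. *)
Lemma two_extensions W k W' Y : utype W k.+1 0 -> ksubv W' k Y -> (W' <= W)%VS ->
  exists E, [/\ (size E <= 2)%N, all (ksubv W k.+1) E &
     forall P, closed_under false W k.+1 P -> (forall X, ksubv W' k.+1 X -> P X) ->
       {in E, forall Z, P Z} -> forall X, ksubv W k.+1 X -> (Y <= X)%VS -> P X].
Proof.
move=> tW kY' sW; have kY := ksubvS sW kY'; have [YW tY /eqP dY] := and3P kY.
have [[X1 [kX1 YX1]]|nX] := boolp.pselect (exists X1, ksubv W k.+1 X1 /\ (Y <= X1)%VS); last first.
  by exists [::]; split=> // P _ _ _ X kX YX; case: nX; exists X.
have [[X2 [kX2 YX2 X12]]|nX] := boolp.pselect (exists X2, [/\ ksubv W k.+1 X2, (Y <= X2)%VS & X2 != X1]); last first.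
  exists [:: X1]; split=> //=; first by rewrite kX1.
  move=> P _ _ PX1 X kX YX; have -> : X = X1; last by apply: PX1; rewrite mem_head.
  by apply/eqP/negPn/negP => ?; apply: nX; exists X.
exists [:: X1; X2]; split=> //=; first by rewrite kX1 kX2.
move=> P cP _ PX X kX YX.
have rep Z : ksubv W k.+1 Z -> (Y <= Z)%VS -> exists x, Z = (Y + <[x]>)%VS.
  move=> /and3P[_ _ /eqP dZ] /split_add1; rewrite dZ dY => /(_ erefl)[x [_ _ ->]].
  by exists x.
have [x1 e1] := rep _ kX1 YX1; have [x2 e2] := rep _ kX2 YX2; have [x ex] := rep _ kX YX.
have k1 := kX1; have k2 := kX2; have kx := kX; rewrite e1 in k1; rewrite e2 in k2; rewrite ex in kx.
move: (k1) (k2) (kx); rewrite !ksubv_add1 //.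
move=> /and4P[x1W x11 x1Y nx1] /and4P[x2W x22 x2Y nx2] /and4P[xW xx xY nx].
have nx21 : x2 \notin (Y + <[x1]>)%VS.
  have [_ _ /eqP d1] := and3P kX1; have [_ _ /eqP d2] := and3P kX2.
  apply: contra X12 => x2m; rewrite eqEdim d1 d2 leqnn andbT.
  by rewrite e2 sub_add1 e1 addvSl.
have h12 : h x1 x2 != 0.
  apply/negP => /eqP h12; have := @utype_iso_dim W _ _ (Y + <[x1]> + <[x2]>) tW.
  rewrite !sub_add1 YW x1W x2W !(tot_iso_add1 hH) tY x11 x22 x1Y /= (perpD hH) memv_cap x2Y.
  rewrite (mem_perp1 hH) (form_orth hH h12) eqxx !dim_add1 nx21 nx1 dY.
  by rewrite !addn1 ltnn => /(_ isT isT).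
have [ndW dW _] := tW.
have dE : \dim (W :&: perp Y) = \dim (Y + <[x1]> + <[x2]>).
  by have := dim_perp hH ndW YW; rewrite !dim_add1 nx21 nx1 dY dW /=; clear; lia.
have sE : (Y + <[x1]> + <[x2]> <= W :&: perp Y)%VS.
  by rewrite !sub_add1 !memv_cap x1W x2W x1Y x2Y subv_cap YW !andbT; exact: tY.
have : x \in (Y + <[x1]> + <[x2]>)%VS.
  have /eqP -> : (Y + <[x1]> + <[x2]> == W :&: perp Y)%VS by rewrite eqEdim sE dE /=.
  by rewrite memv_cap xW.
case/mem_add1P => u /mem_add1P[y yY [a ->]] [c xE].
have XE : X = (Y + <[a *: x1 + c *: x2]>)%VS.
  rewrite ex; apply/eqP; rewrite eqEsubv !sub_add1 !addvSl /=; apply/andP; split.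
    by rewrite xE -addrA memv_add // ?memv_line.
  have -> : a *: x1 + c *: x2 = x - y by rewrite xE -(addrA y) [RHS]addrC addKr.
  by rewrite rpredB ?mem_add1 // (subvP (addvSl _ _)).
rewrite XE; apply: cP => //; rewrite ?dY ?(negbTE h12) // -?XE -?e1 -?e2 //.
- by apply: PX; rewrite mem_head.
- by apply: PX; rewrite !inE eqxx orbT.
Qed.

Lemma hyperbolic_generation W n d k : utype W n d ->
  exists L, [/\ all (ksubv W k) L, (size L <= 'C(2 * n + d, k))%N & generatesv false W k L].
Proof.
have [N] := ubnP (2 * n + d)%N; elim: N n d W k => // N IH n d W [|k] lN tW.
  exists [:: 0%VS]; rewrite bin0 /= ksubv0 eqxx; split=> //; exact: generates0.
have [kn|nk] := leqP k.+1 n; last first.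
  exists [::]; split=> // P _ _ Z /and3P[ZW tZ /eqP dZ].
  by have := utype_iso_dim tW ZW tZ; rewrite dZ leqNgt nk.
have [ndW dW _] := tW.
have gen n' d' v : v \in W -> h v v != 0 -> (2 * n + d = (2 * n' + d').+1)%N -> (k < n')%N ->
    utype (W :&: perp <[v]>) n' d' ->
    exists L, [/\ all (ksubv W k.+1) L, (size L <= 'C(2 * n + d, k.+1))%N & generatesv false W k.+1 L].
  move=> vW vv eN kn' tW'; have [_ _ MW'] := tW'.
  have lN' : (2 * n' + d' < N)%N by rewrite -ltnS -eN.
  have [L1 [kL1 sL1 gL1]] := IH n' d' _ k.+1 lN' tW'.
  have [L2 [kL2 sL2 gL2]] := IH n' d' _ k lN' tW'.
  have [||Y|L [kL sL gL]] := @hyperplane_step false W _ k 1 L1 L2 (capvSl W (perp <[v]>)) _ kL1 gL1 kL2 gL2.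
  - exact: (dim_hyperplane hH).
  - by move=> P cP _; apply: hyperbolic_good => //; apply: capvSl.
  - exact: (one_extension ndW vW vv MW' kn').
  exists L; split=> //; apply: leq_trans sL _.
  by rewrite eN binS mul1n leq_add.
case: d => [|d] in tW dW lN gen *; last first.
  have [v [vW vv tW']] := utype_peel_aniso tW.
  by apply: (gen n d v) => //; rewrite addnS.
case: n => [|n] // in tW dW lN gen kn *.
have [v [vW vv tW']] := utype_peel_iso tW.
have [kn'|nk] := ltnP k n; first by apply: (gen n 1 v) => //; clear; lia.
have ekn : k = n by apply/eqP; rewrite eqn_leq nk andbT -ltnS.
rewrite ekn in kn *.
have lN' : (2 * n + 1 < N)%N by move: lN; clear; lia.
have [L2 [kL2 sL2 gL2]] := IH n 1%N _ n lN' tW'.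
(* The hyperplane has Witt index n, hence no (n+1)-subspaces: the first list is empty, but two
   extensions over each Y are spent. The count is 2 C(2n+1, n) = C(2n+2, n+1). *)
have [|||Y kY|L [kL sL gL]] := @hyperplane_step false W _ n 2 [::] L2 (capvSl W (perp <[v]>)) _ isT _ kL2 gL2.
- exact: (dim_hyperplane hH).
- move=> P _ _ Z /and3P[ZW tZ /eqP dZ].
  by have := utype_iso_dim tW' ZW tZ; rewrite dZ ltnn.
- by move=> P cP _; apply: hyperbolic_good => //; apply: capvSl.
- by apply: two_extensions kY _ => //; apply: capvSl.
exists L; split=> //; apply: leq_trans sL _.
have -> : (2 * n.+1 + 0 = (2 * n + 1).+1)%N by clear; lia.
rewrite binS -(bin_sub (_ : n.+1 <= 2 * n + 1)%N); last by clear; lia.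
have -> : (2 * n + 1 - n.+1 = n)%N by clear; lia.
by rewrite /= add0n mul2n -addnn leq_add.
Qed.

End HyperbolicGeneration.

(** * The generalized quadrangle of a pair of orthogonal hyperbolic lines *)

Section Grid.
Variables (F : fieldType) (sg : {rmorphism F -> F}) (vT : vectType F) (h : vT -> vT -> F).
Hypothesis hH : is_sigma_hermitian h sg.
Hypothesis sgK : forall a, sg (sg a) = a.
Hypothesis sg_neq : exists a, sg a <> a.
Local Notation hE := (formE hH).

Variables (e1 f1 e2 f2 : vT) (Q : vT -> Prop).
Hypotheses (ee1 : h e1 e1 = 0) (ff1 : h f1 f1 = 0) (ef1 : h e1 f1 = 1).
Hypotheses (ee2 : h e2 e2 = 0) (ff2 : h f2 f2 = 0) (ef2 : h e2 f2 = 1).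
Hypotheses (e12 : h e1 e2 = 0) (ef12 : h e1 f2 = 0) (fe12 : h f1 e2 = 0) (f12 : h f1 f2 = 0).

Definition vec4 a b c d := a *: e1 + b *: f1 + c *: e2 + d *: f2.

Hypothesis Q_line : forall a b c d a' b' c' d' s t,
  let x := vec4 a b c d in let y := vec4 a' b' c' d' in
  h x x = 0 -> h y y = 0 -> h x y = 0 -> s *: x + t *: y != 0 -> Q x -> Q y -> Q (s *: x + t *: y).
Hypotheses (Qe1 : Q e1) (Qf1 : Q f1) (Qe2 : Q e2) (Qf2 : Q f2).

Lemma vec4_form a b c d a' b' c' d' : h (vec4 a b c d) (vec4 a' b' c' d') =
  a * sg b' + b * sg a' + (c * sg d' + d * sg c').
Proof.
have [fe1 fe2 e21] : [/\ h f1 e1 = 1, h f2 e2 = 1 & h e2 e1 = 0].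
  by split; rewrite (form_sym hH) ?ef1 ?ef2 ?e12 ?rmorph1 ?rmorph0.
rewrite /vec4 !hE ee1 ff1 ef1 ee2 ff2 ef2 e12 ef12 fe12 f12 fe1 fe2 e21.
by rewrite (form_orth hH ef12) (form_orth hH fe12) (form_orth hH f12); ring.
Qed.

Lemma vec4_lin s t a b c d a' b' c' d' : s *: vec4 a b c d + t *: vec4 a' b' c' d' =
  vec4 (s * a + t * a') (s * b + t * b') (s * c + t * c') (s * d + t * d').
Proof.
by rewrite /vec4 !scalerDr !scalerA !scalerDl [LHS]addrACA [X in X + _ = _]addrACA
  [X in X + _ + _ = _]addrACA.
Qed.

Lemma Q_sum a b c d a' b' c' d' s t : let x := vec4 a b c d in let y := vec4 a' b' c' d' in
  h x x = 0 -> h y y = 0 -> h x y = 0 ->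
  vec4 (s * a + t * a') (s * b + t * b') (s * c + t * c') (s * d + t * d') != 0 -> Q x -> Q y ->
  Q (vec4 (s * a + t * a') (s * b + t * b') (s * c + t * c') (s * d + t * d')).
Proof. by move=> x y xx yy xy nz Qx Qy; rewrite -vec4_lin in nz *; apply: Q_line. Qed.

Lemma vec4_eq0 a b c d : vec4 a b c d = 0 -> [/\ a = 0, b = 0, c = 0 & d = 0].
Proof.
move=> e0.
have E u v w x : a * sg v + b * sg u + (c * sg x + d * sg w) = 0.
  by rewrite -vec4_form e0 (form_0l hH).
by split; [have := E 0 1 0 0|have := E 1 0 0 0|have := E 0 0 0 1|have := E 0 0 1 0];
  rewrite !rmorph0 !rmorph1 !mulr0 !mulr1 ?addr0 ?add0r.
Qed.

Lemma vec4_0 : vec4 0 0 0 0 = 0.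
Proof. by rewrite /vec4 !scale0r !addr0. Qed.

(** These are the points on the four totally isotropic lines that join [e1] or [f1] to [e2] or
    [f2]. *)
Lemma Q_axis a b c d : (a == 0) || (b == 0) -> (c == 0) || (d == 0) -> vec4 a b c d != 0 ->
  Q (vec4 a b c d).
Proof.
have E1 : vec4 1 0 0 0 = e1 by rewrite /vec4 scale1r !scale0r !addr0.
have E2 : vec4 0 1 0 0 = f1 by rewrite /vec4 scale1r !scale0r !addr0 add0r.
have E3 : vec4 0 0 1 0 = e2 by rewrite /vec4 scale1r !scale0r !addr0 !add0r.
have E4 : vec4 0 0 0 1 = f2 by rewrite /vec4 scale1r !scale0r !add0r.
case/orP=> /eqP-> /orP[] /eqP-> nz.
- have := @Q_sum 0 1 0 0 0 0 0 1 b d.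
  by rewrite E2 E4 !mulr0 !mulr1 !addr0 !add0r; apply.
- have := @Q_sum 0 1 0 0 0 0 1 0 b c.
  by rewrite E2 E3 !mulr0 !mulr1 !addr0 !add0r; apply.
- have := @Q_sum 1 0 0 0 0 0 0 1 a d.
  by rewrite E1 E4 !mulr0 !mulr1 !addr0 !add0r; apply.
- have := @Q_sum 1 0 0 0 0 0 1 0 a c.
  by rewrite E1 E3 !mulr0 !mulr1 !addr0 !add0r; apply.
Qed.

(** The equation says that the components on the opposite lines <e1, e2> and <f1, f2> are
    orthogonal, so the point is on a totally isotropic line meeting both. *)
Lemma Q_ruled a b c d : a * sg b + c * sg d = 0 -> vec4 a b c d != 0 -> Q (vec4 a b c d).
Proof.
move=> abcd nz.
have [u0|u0] := eqVneq (vec4 a 0 c 0) 0.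
  by have [a0 _ c0 _] := vec4_eq0 u0; rewrite a0 c0 in nz *; apply: Q_axis; rewrite ?eqxx.
have [v0|v0] := eqVneq (vec4 0 b 0 d) 0.
  by have [_ b0 _ d0] := vec4_eq0 v0; rewrite b0 d0 in nz *; apply: Q_axis; rewrite ?eqxx ?orbT.
have := @Q_sum a 0 c 0 0 b 0 d 1 1; rewrite !mul1r !addr0 !add0r; apply=> //.
- by rewrite vec4_form !rmorph0; ring.
- by rewrite vec4_form !rmorph0; ring.
- by rewrite vec4_form !rmorph0 !mulr0 !addr0.
- by apply: Q_axis; rewrite ?eqxx ?orbT.
- by apply: Q_axis; rewrite ?eqxx ?orbT.
Qed.

Lemma norm1_neq1 : exists l, [/\ l * sg l = 1, l != 1 & l != 0].
Proof.
have [b nb] := sg_moved sg_neq.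
have b0 : b != 0 by apply: contraNneq nb => ->; rewrite rmorph0.
have sb0 : sg b != 0 by rewrite fmorph_eq0.
exists (sg b / b); rewrite rmorphM fmorphV /= sgK; split.
- by field; rewrite b0 sb0.
- by apply: contra nb => /eqP e; rewrite -[sg b](divfK b0) e mul1r.
- by rewrite mulf_neq0 ?invr_eq0.
Qed.

(* The points [u + l w], [l] of norm 1, on the line spanned by [u] and [w] satisfy [Q_ruled]. *)
Lemma Q_iso_planes a b c d : a * sg b + b * sg a = 0 -> c * sg d + d * sg c = 0 ->
  vec4 a b c d != 0 -> Q (vec4 a b c d).
Proof.
have [l [ll l1 l0]] := norm1_neq1; have l1' : 1 - l != 0 by rewrite subr_eq0 eq_sym.
have line a' b' c' d' s t : a' * sg b' + b' * sg a' = 0 -> a' * sg b' + c' * sg d' = 0 ->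
    vec4 (s * a') (s * b') (t * c') (t * d') != 0 ->
    vec4 a' b' c' d' != 0 -> vec4 a' b' (l * c') (l * d') != 0 ->
    Q (vec4 (s * a') (s * b') (t * c') (t * d')).
  move=> n1 n2 nz nz1 nz2.
  have n3 : c' * sg d' + d' * sg c' = 0.
    have e : c' * sg d' = b' * sg a'.
      by apply: (addrI (a' * sg b')); rewrite n2 n1.
    have e' : d' * sg c' = a' * sg b'.
      by rewrite -[d']sgK -rmorphM mulrC /= e rmorphM /= sgK mulrC.
    by rewrite e e' addrC n1.
  pose q := (t - s) / (1 - l); have q1 : t = (s + q) + (- q) * l.
    by rewrite /q; field; rewrite l1'.
  have := @Q_sum a' b' c' d' a' b' (l * c') (l * d') (s + q) (- q).
  have -> : (s + q) * a' + - q * a' = s * a' by ring.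
  have -> : (s + q) * b' + - q * b' = s * b' by ring.
  have -> : (s + q) * c' + - q * (l * c') = t * c' by rewrite q1; ring.
  have -> : (s + q) * d' + - q * (l * d') = t * d' by rewrite q1; ring.
  apply=> //; rewrite ?vec4_form ?n1 ?n3 ?addr0 //.
  - rewrite !rmorphM /= add0r.
    by transitivity (l * sg l * (c' * sg d' + d' * sg c')); [ring|rewrite n3 mulr0].
  - rewrite !rmorphM /= add0r.
    by transitivity (sg l * (c' * sg d' + d' * sg c')); [ring|rewrite n3 mulr0].
  - exact: Q_ruled.
  - apply: Q_ruled => //; rewrite rmorphM /= mulrACA ll mul1r //.
(* A point of one hyperbolic plane is reached from an auxiliary component in the other one, chosen
   to satisfy the equation of [Q_ruled] and then cancelled by [t = 0]. *)
have plane1 a' b' : a' * sg b' + b' * sg a' = 0 -> vec4 a' b' 0 0 != 0 -> Q (vec4 a' b' 0 0).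
  move=> n1 nz; have := line a' b' (- (a' * sg b')) 1 1 0.
  rewrite !mul1r !mul0r mulr1 rmorph1 mulr1 subrr; apply=> //.
    by apply/eqP => /vec4_eq0[_ _ _ /eqP]; rewrite oner_eq0.
  by apply/eqP => /vec4_eq0[_ _ _ /eqP]; rewrite (negbTE l0).
have plane2 c' d' : c' * sg d' + d' * sg c' = 0 -> vec4 0 0 c' d' != 0 -> Q (vec4 0 0 c' d').
  move=> n1 nz; have := line (- (c' * sg d')) 1 c' d' 0 1.
  rewrite !mul1r !mul0r rmorph1 mulr1 addNr; apply=> //.
  - rewrite rmorphN rmorphM /= sgK -opprD [_ * d']mulrC n1 oppr0 //.
  - by apply/eqP => /vec4_eq0[_ /eqP]; rewrite oner_eq0.
  - by apply/eqP => /vec4_eq0[_ /eqP]; rewrite oner_eq0.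
move=> n1 n2 nz.
have [u0|u0] := eqVneq (vec4 a b 0 0) 0.
  by have [a0 b0 _ _] := vec4_eq0 u0; rewrite a0 b0 in nz *; apply: plane2.
have [v0|v0] := eqVneq (vec4 0 0 c d) 0.
  by have [_ _ c0 d0] := vec4_eq0 v0; rewrite c0 d0 in nz *; apply: plane1.
have := @Q_sum a b 0 0 0 0 c d 1 1; rewrite !mul1r !addr0 !add0r; apply=> //.
- by rewrite vec4_form n1 !rmorph0; ring.
- by rewrite vec4_form n2 !rmorph0; ring.
- by rewrite vec4_form !rmorph0; ring.
- exact: plane1.
- exact: plane2.
Qed.

(** A suitable multiple of a point of <e1, f2>, with coordinates [r] and [q], is added. For every z,
    the choice [r * sg b = z], [c * sg q = - sg z] keeps it orthogonal to the given vector, and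
    [z - sg z] is then adjusted so that the sum satisfies the equation of [Q_ruled]. *)
Lemma Q_grid a b c d : h (vec4 a b c d) (vec4 a b c d) = 0 -> vec4 a b c d != 0 ->
  Q (vec4 a b c d).
Proof.
rewrite vec4_form => n0 nz.
have [n1|n1] := eqVneq (a * sg b + b * sg a) 0.
  by apply: Q_iso_planes => //; move: n0; rewrite n1 add0r.
have b0 : b != 0 by apply: contraNneq n1 => ->; rewrite rmorph0 mulr0 mul0r addr0.
have c0 : c != 0.
  by apply: contraNneq n1 => c0; rewrite -n0 c0 rmorph0 mulr0 mul0r !addr0.
have sk : - (a * sg b + c * sg d) + sg (- (a * sg b + c * sg d)) = 0.
  rewrite rmorphN rmorphD !rmorphM /= !sgK -opprD -[RHS]oppr0 -n0; ring.
have [z zE] := skew_diff sgK sg_neq sk.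
have sb0 : sg b != 0 by rewrite fmorph_eq0.
have sc0 : sg c != 0 by rewrite fmorph_eq0.
pose r := z / sg b; pose q := - (z / sg c).
have e1' : r * sg b = z by rewrite /r divfK.
have e2' : c * sg q = - sg z.
  by rewrite /q rmorphN rmorphM fmorphV /= sgK mulrN mulrCA divff // mulr1.
have br : b * sg r = sg z by rewrite -e1' rmorphM /= sgK mulrC.
have qc : q * sg c = - z by rewrite /q mulNr divfK.
clearbody r q.
have [z0|z0] := eqVneq z 0.
  apply: Q_ruled => //; move: zE; rewrite z0 rmorph0 subrr => /esym/eqP.
  by rewrite oppr_eq0 => /eqP.
have := @Q_sum (a + r) b c (d + q) r 0 0 q 1 (- 1).
rewrite !mul1r !mulr0 !addr0 !mulN1r !addrK; apply=> //.
- rewrite vec4_form !rmorphD /=.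
  transitivity (a * sg b + b * sg a + (c * sg d + d * sg c) + r * sg b + b * sg r
     + (c * sg q + q * sg c)); first by ring.
  by rewrite n0 e1' br e2' qc; ring.
- by rewrite vec4_form !rmorph0; ring.
- by rewrite vec4_form !rmorph0 br e2'; ring.
- apply: Q_ruled.
    rewrite rmorphD /= mulrDl mulrDr e1' e2'.
    transitivity (a * sg b + c * sg d + (z - sg z)); first by ring.
    by rewrite zE subrr.
  apply/eqP => /vec4_eq0[_ /eqP]; rewrite (negbTE b0); by [].
- apply: Q_axis; rewrite ?eqxx ?orbT //.
  by apply/eqP => /vec4_eq0[r0 _ _ _]; move: z0; rewrite -e1' r0 mul0r eqxx.
Qed.
End Grid.

(** * Generation by the lines of the Grassmannian *)

Section OrdinaryGeneration.
Variables (F : fieldType) (sg : {rmorphism F -> F}) (vT : vectType F) (h : vT -> vT -> F).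
Hypothesis hH : is_sigma_hermitian h sg.
Hypothesis sgK : forall a, sg (sg a) = a.
Hypothesis sg_neq : exists a, sg a <> a.
Implicit Types (x y z v : vT) (A X Y Z W M U : {vspace vT}).
Local Notation hE := (formE hH).
Local Notation perp := (perp h).
Local Notation ksubv := (ksubv h).
Local Notation closed_under := (closed_under h).

Lemma add1Z A x a : a != 0 -> (A + <[a *: x]> = A + <[x]>)%VS.
Proof.
move=> a0; apply/eqP; rewrite eqEsubv !sub_add1 !addvSl /= rpredZ ?mem_add1 //.
by have := mem_add1 A (a *: x); rewrite rpredZeq (negbTE a0).
Qed.

Lemma add1_shift A x y : y \in A -> (A + <[x + y]> = A + <[x]>)%VS.
Proof.
move=> yA; have yAx : forall u, y \in (A + <[u]>)%VS by move=> u; apply: (subvP (addvSl _ _)).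
have xm : x \in (A + <[x + y]>)%VS.
  by have := rpredB (mem_add1 A (x + y)) (yAx (x + y)); rewrite addrK.
by apply/eqP; rewrite eqEsubv !sub_add1 !addvSl xm /= andbT; apply: rpredD; [exact: mem_add1|exact: yAx].
Qed.

Lemma iso_comb x y a c : h x x = 0 -> h y y = 0 -> h x y = 0 ->
  h (a *: x + c *: y) (a *: x + c *: y) = 0.
Proof. by move=> xx yy xy; rewrite !hE xx yy xy (form_orth hH xy) !mulr0 !addr0. Qed.

(** This is [Q_grid] in the residue of A. The space spanned by the two pairs is non-degenerate and
    orthogonal to A, hence meets A in 0, so its nonzero isotropic vectors do give
    (k+1)-subspaces. *)
Lemma grid_residue W k P A p q c d a1 a2 a3 a4 : closed_under true W k.+1 P -> ksubv W k A ->
  [/\ p \in W, q \in W, c \in W & d \in W] ->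
  [/\ p \in perp A, q \in perp A, c \in perp A & d \in perp A] ->
  [/\ h p p = 0, h q q = 0 & h p q = 1] -> [/\ h c c = 0, h d d = 0 & h c d = 1] ->
  [/\ h p c = 0, h p d = 0, h q c = 0 & h q d = 0] ->
  P (A + <[p]>)%VS -> P (A + <[q]>)%VS -> P (A + <[c]>)%VS -> P (A + <[d]>)%VS ->
  let x := vec4 p q c d a1 a2 a3 a4 in h x x = 0 -> x != 0 -> P (A + <[x]>)%VS.
Proof.
move=> cP kA [pW qW cW dW] [pA qA cA dA] [pp qq pq] [cc dd cd] [pc pd qc qd] Pp Pq Pc Pd x.
have [_ _ /eqP dimA] := and3P kA.
have vW (u v w z : F) : vec4 p q c d u v w z \in W by rewrite !rpredD ?rpredZ.
have vA (u v w z : F) : vec4 p q c d u v w z \in perp A by rewrite !rpredD ?rpredZ.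
have vnA (u v w z : F) : vec4 p q c d u v w z != 0 -> vec4 p q c d u v w z \notin A.
  apply: contra => xA.
  have E (u' v' w' z' : F) : u * sg v' + v * sg u' + (w * sg z' + z * sg w') = 0.
    rewrite -(vec4_form hH pp qq pq cc dd cd pc pd qc qd).
    exact: (form_orth hH (mem_perp hH _ _ (vA _ _ _ _) _ xA)).
  have -> : u = 0 by have := E 0 1 0 0; rewrite !rmorph0 !rmorph1 !mulr0 !mulr1 ?addr0 ?add0r.
  have -> : v = 0 by have := E 1 0 0 0; rewrite !rmorph0 !rmorph1 !mulr0 !mulr1 ?addr0 ?add0r.
  have -> : w = 0 by have := E 0 0 0 1; rewrite !rmorph0 !rmorph1 !mulr0 !mulr1 ?addr0 ?add0r.
  have -> : z = 0 by have := E 0 0 1 0; rewrite !rmorph0 !rmorph1 !mulr0 !mulr1 ?addr0 ?add0r.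
  by rewrite vec4_0.
apply: (@Q_grid F sg vT h hH sgK sg_neq p q c d (fun z => P (A + <[z]>)%VS)) => //.
move=> u v w z u' v' w' z' s t y y' yy y'y' yy' nz Py Py'.
have [y0|y0] := eqVneq y 0.
  rewrite y0 scaler0 add0r in nz *; rewrite add1Z //.
  by apply: contraNneq nz => ->; rewrite scale0r.
have [y'0|y'0] := eqVneq y' 0.
  rewrite y'0 scaler0 addr0 in nz *; rewrite add1Z //.
  by apply: contraNneq nz => ->; rewrite scale0r.
apply: cP => //; rewrite ?dimA ?(ksubv_add1 hH) ?vW ?vA ?vnA ?yy ?y'y' ?yy' ?eqxx //.
rewrite (iso_comb _ _ yy y'y' yy') eqxx /=.
by rewrite /y /y' vec4_lin in nz *; rewrite vW vA vnA.
Qed.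

Lemma iso_off W v (C M : {vspace vT}) : nondegv h W -> v \in W -> v \notin C -> (C <= W)%VS -> tot_isov h C ->
  (M <= W)%VS -> tot_isov h M -> (\dim C < \dim M)%N ->
  exists z, [/\ z \in W, z \in perp C, h z z = 0 & h z v != 0].
Proof.
move=> ndW vW nvC CW tC MW tM lt.
have [b [bM bC nbC]] := tot_iso_extend hH tM tC lt; have bW := subvP MW _ bM.
have [c [cW cC bc]] := nondeg_ex hH ndW CW bW nbC.
have [g [gW gC vg]] := nondeg_ex hH ndW CW vW nvC.
have gv : h g v != 0 by apply: contra vg => /eqP/(form_orth hH)->.
have inE z : z \in W -> z \in perp C -> z \in (W :&: perp C)%VS by rewrite memv_cap => -> ->.
have [z [/memv_capP[zW zC] zz zv]] := iso_escape hH sgK sg_neq (inE _ bW bC) (inE _ cW cC)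
  (inE _ gW gC) (tot_isoP hH _ tM _ _ bM bM) bc gv.
by exists z.
Qed.

(** The residue of Y has Witt index at least 2, and the points of such a polar space off a
    hyperplane are connected by lines. Each of these lines meets the hyperplane, whose points are in
    P, so one point off it in P yields the next. *)
Lemma ordinary_residue W v k Y P M X0 : nondegv h W -> v \in W -> h v v != 0 ->
  (M <= W)%VS -> tot_isov h M -> (k.+1 < \dim M)%N ->
  ksubv (W :&: perp <[v]>) k Y -> closed_under true W k.+1 P ->
  (forall X, ksubv (W :&: perp <[v]>) k.+1 X -> P X) ->
  ksubv W k.+1 X0 -> (Y <= X0)%VS -> ~~ (X0 <= W :&: perp <[v]>)%VS -> P X0 ->
  forall X, ksubv W k.+1 X -> (Y <= X)%VS -> P X.
Proof.
set W' := (W :&: perp <[v]>)%VS => ndW vW vv MW tM kM kY cP PW' kX0 YX0 nX0 PX0 X kX YX.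
have [XW'|nX] := boolP (X <= W')%VS.
  by apply: PW'; case/and3P: kX => _ tX dX; rewrite /ksubv XW' tX dX.
have /and3P[YW' tY /eqP dY] := kY.
have W'W : (W' <= W)%VS := capvSl _ _.
have YW := subv_trans YW' W'W.
have kYW : ksubv W k Y by apply: ksubvS kY.
have memW' z : z \in W -> (z \in W') = (h z v == 0).
  by move=> zW; rewrite memv_cap zW (mem_perp1 hH).
have rep Z : ksubv W k.+1 Z -> (Y <= Z)%VS -> ~~ (Z <= W')%VS ->
    exists x, [/\ x \in W, x \in perp Y, h x x = 0, h x v != 0 & Z = (Y + <[x]>)%VS].
  move=> kZ YZ nZ; have /and3P[ZW tZ /eqP dZ] := kZ.
  have [x [xZ nxY ZE]] := split_add1 YZ (etrans dZ (congr1 S (esym dY))).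
  exists x; split=> //; first exact: (subvP ZW).
  - by apply: (subvP (subv_trans tZ (perpS hH YZ))).
  - exact: (tot_isoP hH _ tZ).
  - by apply: contra nZ => xv; rewrite ZE sub_add1 YW' memW' // (subvP ZW).
have [x0 [x0W x0Y x00 x0v X0E]] := rep _ kX0 YX0 nX0.
have [x [xW xY xx xv XE]] := rep _ kX YX nX.
have notY z : z \in W -> h z v != 0 -> z \notin Y.
  by move=> zW zv; apply: contra zv => /(subvP YW'); rewrite memW'.
have kz z : z \in W -> z \in perp Y -> h z z = 0 -> z \notin Y -> ksubv W k.+1 (Y + <[z]>).
  by move=> zW zY zz nz; rewrite (ksubv_add1 hH) // zW zY zz eqxx nz.
have kz' z : z \in W -> z \in perp Y -> h z z = 0 -> z \notin Y -> h z v = 0 -> P (Y + <[z]>)%VS.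
  by move=> zW zY zz nz zv; apply: PW'; rewrite (ksubv_add1 hH) // memW' // zv zY zz eqxx nz.
(* For collinear points off the hyperplane: [w] is where their line meets it. *)
have orth z z' : z \in W -> z' \in W -> z \in perp Y -> z' \in perp Y -> h z z = 0 ->
    h z' z' = 0 -> h z v != 0 -> h z' v != 0 -> h z z' = 0 ->
    P (Y + <[z]>)%VS -> P (Y + <[z']>)%VS.
  move=> zW z'W zY z'Y zz z'z' zv z'v zz' Pz.
  pose w := z' - (h z' v / h z v) *: z; have z'E : z' = w + (h z' v / h z v) *: z by rewrite subrK.
  have wW : w \in W by rewrite rpredB ?rpredZ.
  have wY : w \in perp Y by rewrite rpredB ?rpredZ.
  have wv : h w v = 0 by rewrite /w !hE divfK // subrr.
  have ww : h w w = 0 by rewrite /w !hE zz z'z' zz' (form_orth hH zz') !mulr0 subrr.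
  have wz : h w z = 0 by rewrite /w !hE zz (form_orth hH zz') mulr0 subrr.
  have q0 : h z' v / h z v != 0 by rewrite mulf_neq0 ?invr_eq0.
  have [wYm|nwY] := boolP (w \in Y).
    by rewrite z'E addrC add1_shift // add1Z.
  rewrite z'E -[w]scale1r; apply: cP; rewrite ?dY ?scale1r -?z'E //.
  - exact: kz.
  - by apply: kz => //; apply: notY.
  - by rewrite wz eqxx.
  - by apply: kz => //; apply: notY.
  - exact: kz'.
rewrite XE; rewrite X0E in PX0 kX0.
have [x0x|x0x] := eqVneq (h x0 x) 0; first exact: (orth x0).
have [_ tX0 /eqP dX0] := and3P kX0.
have [|b0 [b0M b0X nb0X]] := tot_iso_extend hH tM tX0; first by rewrite dX0.
move: b0X; rewrite (perpD hH) memv_cap (mem_perp1 hH) => /andP[b0Y /eqP b0x0].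
have b0W := subvP MW _ b0M; have b0b0 : h b0 b0 = 0 by apply: (tot_isoP hH _ tM).
(* Subtracting a multiple of [x0] makes [b] orthogonal to [x] as well, so [b] is a common neighbour
   of [x0] and [x]. *)
pose b := b0 - (h b0 x / h x0 x) *: x0.
have bW : b \in W by rewrite rpredB ?rpredZ.
have bY : b \in perp Y by rewrite rpredB ?rpredZ.
have bx0 : h b x0 = 0 by rewrite /b !hE b0x0 x00 mulr0 subrr.
have bx : h b x = 0 by rewrite /b !hE divfK // subrr.
have bb : h b b = 0.
  by rewrite /b -scaleNr -[b0 in b0 + _]scale1r; apply: iso_comb.
have nbX0 : b \notin (Y + <[x0]>)%VS.
  apply: contra nb0X => bX0; rewrite -[b0](subrK ((h b0 x / h x0 x) *: x0)).
  by rewrite rpredD ?rpredZ ?mem_add1.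
clearbody b; have nbY : b \notin Y by apply: contra nbX0; apply: (subvP (addvSl _ _)).
have [bv|bv] := eqVneq (h b v) 0; last first.
  have Pb : P (Y + <[b]>)%VS by apply: (orth x0) => //; apply: (form_orth hH).
  by apply: (orth b).
(* Here [b] lies in the hyperplane; replacing [x0] by [x0 + b] if necessary, [v] is outside
   of [Y + <x0, x>], and an isotropic vector off the hyperplane exists in its perp. *)
have [x1 [x1W x1Y x11 x1v [x1x bx1 Px1 nvT]]] : exists x1, [/\ x1 \in W, x1 \in perp Y, h x1 x1 = 0,
    h x1 v != 0 & [/\ h x1 x != 0, h b x1 = 0, P (Y + <[x1]>)%VS & v \notin (Y + <[x1]> + <[x]>)%VS]].
  have [vT0|] := boolP (v \in (Y + <[x0]> + <[x]>)%VS); last by exists x0.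
  exists (x0 + b); rewrite !rpredD // !hE x00 bb bx0 (form_orth hH bx0) bv bx !addr0; split=> //.
  split=> //.
    rewrite -[x0]scale1r -[b]scale1r; apply: cP; rewrite ?dY ?scale1r //.
    - by apply: kz.
    - by rewrite (form_orth hH bx0) eqxx.
    - apply: kz; [exact: rpredD|exact: rpredD| |].
        by rewrite !hE x00 bb bx0 (form_orth hH bx0) !addr0.
      by apply: notY; rewrite ?rpredD // hE bv addr0.
    - exact: kz'.
  have xx0 : h x x0 != 0 by apply: contra x0x => /eqP/(form_orth hH)->.
  (* If [v] were in both spans, products with [x0] and [x] would equate the coefficients. Then a
     nonzero multiple of [b] is in Y, or [v] is in Y + <x> and [h v v = 0]. *)
  apply/negP => vT1; case/mem_add1P: vT0 => _ /mem_add1P[y yY [a ->]] [c vE].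
  case/mem_add1P: vT1 => _ /mem_add1P[y' y'Y [a' ->]] [c' vE'].
  have yx0 : h y x0 = 0 by apply/(form_orth hH)/(mem_perp hH _ _ x0Y).
  have y'x0 : h y' x0 = 0 by apply/(form_orth hH)/(mem_perp hH _ _ x0Y).
  have yx : h y x = 0 by apply/(form_orth hH)/(mem_perp hH _ _ xY).
  have y'x : h y' x = 0 by apply/(form_orth hH)/(mem_perp hH _ _ xY).
  have v1 : h v x0 = c * h x x0 by rewrite vE !hE yx0 x00 !mulr0 !add0r.
  have v2 : h v x0 = c' * h x x0 by rewrite vE' !hE y'x0 x00 bx0 !addr0 !mulr0 !add0r.
  have v3 : h v x = a * h x0 x by rewrite vE !hE yx xx mulr0 !addr0 add0r.
  have v4 : h v x = a' * h x0 x by rewrite vE' !hE y'x xx bx mulr0 !addr0 add0r.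
  have cc' : c = c' by apply: (mulIf xx0); rewrite -v1 v2.
  have aa' : a = a' by apply: (mulIf x0x); rewrite -v3 v4.
  have [a0|a0] := eqVneq a 0.
    have vx : v = y + c *: x by rewrite vE a0 scale0r addr0.
    have vy : h v y = 0.
      have := subvP YW' _ yY; rewrite memv_cap (mem_perp1 hH) => /andP[_ /eqP].
      exact: (form_orth hH).
    have hvx : h v x = 0 by rewrite vx !hE yx xx mulr0 addr0.
    by move: vv; rewrite {2}vx !hE vy hvx mulr0 addr0 eqxx.
  case/negP: nbY; have : y - y' = a *: b.
    apply/eqP; rewrite subr_eq -(inj_eq (addIr (a *: x0 + c *: x))); apply/eqP.
    rewrite addrA -vE vE' -cc' -aa' scalerDr; rewrite [_ + y']addrC -!addrA; congr (_ + _).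
    by rewrite [RHS]addrCA !addrA.
  by move=> e; have := rpredB yY y'Y; rewrite e rpredZeq (negbTE a0).
have [z [zW zT zz zv]] : exists z, [/\ z \in W, z \in perp (Y + <[x1]> + <[x]>)%VS, h z z = 0 & h z v != 0].
  have xx1 : h x x1 != 0 by apply: contra x1x => /eqP/(form_orth hH)->.
  have TW : (Y + <[x1]> + <[x]> <= W)%VS by rewrite !sub_add1 YW x1W xW.
  have nbT : b \notin (Y + <[x1]> + <[x]>)%VS.
    apply: contra nbY => /mem_add1P[_ /mem_add1P[y yY [a ->]] [c bE]].
    have yx1 : h y x1 = 0 by apply/(form_orth hH)/(mem_perp hH _ _ x1Y).
    have yx : h y x = 0 by apply/(form_orth hH)/(mem_perp hH _ _ xY).
    have := bx; rewrite bE !hE yx xx mulr0 addr0 add0r => /eqP.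
    rewrite mulf_eq0 (negbTE x1x) orbF => /eqP a0.
    have := bx1; rewrite bE !hE yx1 x11 mulr0 !add0r => /eqP.
    rewrite mulf_eq0 (negbTE xx1) orbF => /eqP c0.
    by rewrite a0 c0 !scale0r !addr0.
  have bT : b \in perp (Y + <[x1]> + <[x]>)%VS.
    by rewrite !(perpD hH) !memv_cap bY !(mem_perp1 hH) bx1 bx eqxx.
  have [c [cW cT bc]] := nondeg_ex hH ndW TW bW nbT.
  have [g [gW gT vg]] := nondeg_ex hH ndW TW vW nvT.
  have gv : h g v != 0 by apply: contra vg => /eqP/(form_orth hH)->.
  have inE z : z \in W -> z \in perp (Y + <[x1]> + <[x]>)%VS ->
    z \in (W :&: perp (Y + <[x1]> + <[x]>))%VS by rewrite memv_cap => -> ->.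
  have [z [/memv_capP[zW zC] zz zv]] := iso_escape hH sgK sg_neq (inE _ bW bT) (inE _ cW cT)
    (inE _ gW gT) bb bc gv.
  by exists z.
move: zT; rewrite !(perpD hH) !memv_cap !(mem_perp1 hH) => /andP[/andP[zY /eqP zx1] /eqP zx].
have Pz : P (Y + <[z]>)%VS by apply: (orth x1) => //; apply: (form_orth hH).
by apply: (orth z).
Qed.

Lemma extend_off W v (C : {vspace vT}) k M : nondegv h W -> v \in W -> h v v != 0 ->
  (M <= W)%VS -> tot_isov h M -> (k < \dim M)%N -> ksubv (W :&: perp <[v]>) k C ->
  exists z, [/\ z \in W, z \in perp C, h z z = 0, h z v != 0 & ksubv W k.+1 (C + <[z]>)].
Proof.
move=> nd vW vv MW tM kM kC; have [CW' tC /eqP dC] := and3P kC.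
have nC x : h x v != 0 -> x \notin C.
  by apply: contra => /(subvP CW'); rewrite memv_cap (mem_perp1 hH) => /andP[_ ->].
have CW := subv_trans CW' (capvSl _ _).
have [|z [zW zC zz zv]] := iso_off nd vW (nC _ vv) CW tC MW tM; first by rewrite dC.
exists z; split=> //; rewrite (ksubv_add1 hH); first by rewrite zW zz eqxx zC nC.
exact: (ksubvS (capvSl _ _) kC).
Qed.

(** By [ordinary_residue] a single subspace through A + <y> off the hyperplane is enough, y = a y1 +
    c y2. With [b] isotropic, orthogonal to A, [y1] and [y2] and off the hyperplane, A + <b> + <y>
    is on the line of A + <b> + <y1> and A + <b> + <y2>. *)
Lemma ordinary_good W v k P M : nondegv h W -> v \in W -> h v v != 0 ->
  (M <= W)%VS -> tot_isov h M -> (k.+1 < \dim M)%N ->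
  closed_under true W k.+1 P -> (forall X, ksubv (W :&: perp <[v]>) k.+1 X -> P X) ->
  closed_under true (W :&: perp <[v]>) k
    (fun Y => forall X, ksubv W k.+1 X -> (Y <= X)%VS -> P X).
Proof.
set W' := (W :&: perp <[v]>)%VS => ndW vW vv MW tM kM cP PW'.
move=> A y1 y2 a c dA Y1 Y2 /eqP h12 Yk good1 good2.
have [_ _ /eqP d1] := and3P Y1; have [_ _ /eqP d2] := and3P Y2; have [YW' tY /eqP dY] := and3P Yk.
have W'W : (W' <= W)%VS := capvSl _ _.
have [y2m|ny2] := boolP (y2 \in (A + <[y1]>)%VS).
  suff -> : (A + <[a *: y1 + c *: y2]>)%VS = (A + <[y1]>)%VS by [].
  apply/eqP; rewrite eqEdim d1 dY leqnn andbT sub_add1 addvSl.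
  by rewrite rpredD ?rpredZ ?mem_add1.
have kA : ksubv W' k.-1 A by apply: (ksubv_sub hH) Y1; rewrite ?addvSl // -dA.
have kE : k = k.-1.+1 by rewrite -dA.
have := Y1; rewrite {1}kE (ksubv_add1 hH) // => /and4P[y1W /eqP y11 y1A ny1].
have := Y2; rewrite {1}kE (ksubv_add1 hH) // => /and4P[y2W /eqP y22 y2A _].
have kC : ksubv W' k.+1 (A + <[y1]> + <[y2]>).
  rewrite (ksubv_add1 hH) // y2W y22 eqxx (perpD hH) memv_cap y2A (mem_perp1 hH) ny2.
  by rewrite (form_orth hH h12) eqxx.
have [b [bW bC bb bv kCb]] := extend_off ndW vW vv MW tM kM kC.
move: bC; rewrite !(perpD hH) !memv_cap !(mem_perp1 hH) => /andP[/andP[bA /eqP by1] /eqP by2].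
have nW' X : b \in X -> ~~ (X <= W')%VS.
  by move=> bX; apply: contra bv => /subvP/(_ _ bX); rewrite memv_cap (mem_perp1 hH) => /andP[].
have nb X : (X <= W')%VS -> b \notin X by move=> XW; apply/negP => /nW'; rewrite XW.
have kb X : ksubv W' k X -> b \in perp X -> ksubv W k.+1 (X + <[b]>).
  move=> kX bX; have [XW' _ _] := and3P kX.
  by rewrite (ksubv_add1 hH b (ksubvS W'W kX)) bW bb eqxx bX nb.
have bY : b \in perp (A + <[a *: y1 + c *: y2]>).
  by rewrite (perpD hH) memv_cap bA (mem_perp1 hH) !hE by1 by2 !mulr0 addr0 eqxx.
have [_ AW' _] := and3P kA.
have swap y : (A + <[b]> + <[y]> = A + <[y]> + <[b]>)%VS by rewrite -addvA [(<[b]> + _)%VS]addvC addvA.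
apply: (@ordinary_residue W v k _ P M (A + <[b]> + <[a *: y1 + c *: y2]>)%VS) => //.
- by rewrite swap kb.
- by rewrite swap addvSl.
- by rewrite swap nW' ?mem_add1.
apply: cP => //.
- rewrite dim_add1 nb ?addn1 ?dA //; exact: (subv_trans (addvSl _ _) YW').
- by rewrite swap kb // (perpD hH) memv_cap bA (mem_perp1 hH) by1 eqxx.
- by rewrite swap kb // (perpD hH) memv_cap bA (mem_perp1 hH) by2 eqxx.
- by rewrite h12 eqxx.
- by rewrite swap kb.
- rewrite swap; apply: good1; rewrite ?addvSl //.
  by rewrite kb // (perpD hH) memv_cap bA (mem_perp1 hH) by1 eqxx.
- rewrite swap; apply: good2; rewrite ?addvSl //.
  by rewrite kb // (perpD hH) memv_cap bA (mem_perp1 hH) by2 eqxx.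
Qed.

(** The generation hypothesis concerns the k-subspaces Y that have some extension off the hyperplane
    in P. It is stated for all closed [Q], so that it can itself be proved by this lemma one
    dimension lower. *)
Lemma ordinary_hyperplane W v k P M : nondegv h W -> v \in W -> h v v != 0 ->
  (M <= W)%VS -> tot_isov h M -> (k.+1 < \dim M)%N ->
  closed_under true W k.+1 P -> (forall X, ksubv (W :&: perp <[v]>) k.+1 X -> P X) ->
  (forall Q, closed_under true (W :&: perp <[v]>) k Q ->
     (forall Y z, ksubv (W :&: perp <[v]>) k Y -> ksubv W k.+1 (Y + <[z]>) -> h z v != 0 ->
        P (Y + <[z]>)%VS -> Q Y) ->
     forall Y, ksubv (W :&: perp <[v]>) k Y -> Q Y) ->
  forall X, ksubv W k.+1 X -> P X.
Proof.
move=> ndW vW vv MW tM kM cP PW' gen X kX.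
have [XW tX /eqP dX] := and3P kX.
pose W' := (W :&: perp <[v]>)%VS; have dW : \dim W = (\dim W').+1 := dim_hyperplane hH ndW vW vv.
have [|Y [_ YZ dY]] := @dim_between _ _ k 0%VS (X :&: W')%VS (sub0v _).
  have := dimv_sum_cap X W'; have : (\dim (X + W') <= \dim W)%N by rewrite dimvS // subv_add XW capvSl.
  by rewrite dimv0 dW dX; clear; lia.
have [YX YW'] : (Y <= X)%VS /\ (Y <= W')%VS by move: YZ; rewrite subv_cap => /andP.
apply: (gen (fun Y => forall X, ksubv W k.+1 X -> (Y <= X)%VS -> P X) _ _ Y) => //.
- exact: (ordinary_good ndW vW vv MW tM kM).
- move=> {YX YW' dY YZ}Y z kY kYz zv Pz.
  apply: (ordinary_residue ndW vW vv MW tM kM kY cP PW' kYz _ _ Pz); rewrite ?addvSl //.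
  by rewrite sub_add1 negb_and memv_cap (mem_perp1 hH) (negbTE zv) andbF orbT.
- by rewrite /ksubv YW' (tot_isoS hH YX tX) dY eqxx.
Qed.

Lemma utype_split W n d : utype h W n.+1 d -> exists p q, [/\ p \in W, q \in W &
  [/\ h p p = 0, h q q = 0, h p q = 1 & utype h (W :&: perp (<[p]> + <[q]>)) n d]].
Proof.
move=> [ndW dW [M [MW tM maxM] dM]].
have M0 : M != 0%VS by rewrite -dimv_eq0 dM.
pose p := vpick M; have pM : p \in M := memv_pick M; have pW := subvP MW _ pM.
have p0 : p != 0 by rewrite vpick0.
have pp : h p p = 0 := tot_isoP hH _ tM _ _ pM pM.
have [|c [cW _ pc]] := nondeg_ex hH ndW (sub0v W) pW; first by rewrite memv0.
have [q [qW qq pq]] := iso_pair hH sgK sg_neq pW cW pp pc.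
clearbody p; exists p, q; split=> //; split=> //; set T := (<[p]> + <[q]>)%VS.
have TW : (T <= W)%VS by rewrite sub_add1 -memvE pW.
have nq : q \notin <[p]>%VS.
  by apply/negP => /vlineP[a qE]; move/eqP: pq; rewrite qE hE pp mulr0 eq_sym oner_eq0.
have dT : \dim T = 2%N by rewrite dim_add1 nq dim_vline p0.
have ndT : nondegv h T by apply: (nondeg2 hH).
have nqM : p \notin (M :&: perp <[q]>)%VS.
  by rewrite memv_cap (mem_perp1 hH) pq oner_eq0 andbF.
have dM' : \dim (M :&: perp <[q]>) = n.
  apply/eqP; rewrite eqn_leq; apply/andP; split.
    rewrite -ltnS -dM ltn_neqAle dimvS ?capvSl // andbT; apply: contra nqM => dMq.
    by have /eqP -> : (M :&: perp <[q]>)%VS == M by rewrite -(dimv_leqif_eq (capvSl M (perp <[q]>))).2.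
  have := dim_perp_ge h M <[q]>; rewrite dM dim_vline; case: (q != 0); clear; lia.
split; first exact: (nondeg_perp hH).
  by have := dim_perp hH ndW TW; rewrite dT dW; clear; lia.
exists (M :&: perp <[q]>)%VS => //; split.
- rewrite (perpD hH) !subv_cap (subv_trans (capvSl _ _) MW) capvSr andbT /=.
  by rewrite (subv_trans (capvSl _ _)) // (perp_sym hH) -memvE (subvP tM).
- exact: (tot_isoS hH (capvSl _ _) tM).
move=> x /memv_capP[xW]; rewrite (perpD hH) memv_cap => /andP[xp xq] xM' xx.
rewrite memv_cap xq andbT; apply: maxM => //.
have -> : M = (M :&: perp <[q]> + <[p]>)%VS by apply: eq_add1; rewrite ?capvSl ?dM'.
by rewrite (perpD hH) memv_cap xM'.
Qed.

Lemma bin_split n d k : ('C(2 * n.+1 + d, k.+1) =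
  2 * 'C(2 * n + d, k) + 'C(2 * n + d, k.+1) + (if k is k'.+1 then 'C(2 * n + d, k') else 0))%N.
Proof.
have -> : (2 * n.+1 + d = (2 * n + d).+2)%N by lia.
by rewrite binS (binS _ k); case: k => [|k]; rewrite ?binS ?bin0; lia.
Qed.

(** * From the orthogonal U of a hyperbolic plane to the whole space W *)

Section Step.
Variables (W : {vspace vT}) (p q : vT) (n d k : nat).
Hypotheses (pW : p \in W) (qW : q \in W) (pp : h p p = 0) (qq : h q q = 0) (pq : h p q = 1).
Let U := (W :&: perp (<[p]> + <[q]>))%VS.
Hypotheses (ndW : nondegv h W) (tU : utype h U n d) (kn : (k < n)%N).

Let qp : h q p = 1. Proof. by rewrite (form_sym hH) pq rmorph1. Qed.
Let UW : (U <= W)%VS. Proof. exact: capvSl. Qed.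

Let memU x : x \in U = [&& x \in W, h x p == 0 & h x q == 0].
Proof. by rewrite memv_cap (perpD hH) memv_cap !(mem_perp1 hH). Qed.

Let perp_pq A : (A <= U)%VS -> p \in perp A /\ q \in perp A.
Proof.
move=> AU; split; apply/(mem_perp hH) => y /(subvP AU); rewrite memU => /and3P[_ /eqP yp /eqP yq];
  exact: (form_orth hH).
Qed.

Let notin_U x y : h x y != 0 -> (y == p) || (y == q) -> x \notin U.
Proof. by move=> xy /orP[/eqP e|/eqP e]; rewrite memU -e (negbTE xy) ?andbF. Qed.

Lemma ksubv_p A (j : nat) : ksubv U j A -> ksubv W j.+1 (A + <[p]>).
Proof.
move=> kA; have [AU _ _] := and3P kA; have [pA _] := perp_pq AU.
rewrite (ksubv_add1 hH) ?(ksubvS UW kA) // pW pp eqxx pA; apply/negP => /(subvP AU).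
by apply/negP/(@notin_U _ q); rewrite ?pq ?oner_neq0 ?eqxx ?orbT.
Qed.

Lemma ksubv_q A (j : nat) : ksubv U j A -> ksubv W j.+1 (A + <[q]>).
Proof.
move=> kA; have [AU _ _] := and3P kA; have [_ qA] := perp_pq AU.
rewrite (ksubv_add1 hH) ?(ksubvS UW kA) // qW qq eqxx qA; apply/negP => /(subvP AU).
by apply/negP/(@notin_U _ p); rewrite ?qp ?oner_neq0 ?eqxx ?orbT.
Qed.

Let iso_in_perp A : ksubv U k A -> exists b, [/\ b \in U, b \in perp A, b \notin A & h b b = 0].
Proof.
move=> /and3P[AU tA /eqP dA]; have [_ _ [M [MU tM _] dM]] := tU.
have [|b [bM bA nb]] := tot_iso_extend hH tM tA; first by rewrite dA dM.
by exists b; split=> //; [exact: (subvP MU)|exact: (tot_isoP hH _ tM)].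
Qed.

(** Modulo A, every vector orthogonal to A lies in some hyperbolic plane: for [u] outside A, take an
    isotropic [z] not orthogonal to [u] and correct [u] along [z]. *)
Let hyp_cover A u : ksubv U k A -> u \in U -> u \in perp A -> exists c d a1 a2 w,
  [/\ [/\ c \in U, d \in U, c \in perp A & d \in perp A],
      [/\ h c c = 0, h d d = 0 & h c d = 1], w \in A & u = a1 *: c + a2 *: d + w].
Proof.
move=> kA uU uA; have [ndU _ _] := tU; have [AU _ _] := and3P kA.
have inE z : z \in U -> z \in perp A -> z \in (U :&: perp A)%VS by rewrite memv_cap => -> ->.
have [b [bU bA nbA bb]] := iso_in_perp kA.
have [c [cU cA bc]] := nondeg_ex hH ndU AU bU nbA.
have [uAm|nuA] := boolP (u \in A).
  have [f [/memv_capP[fU fA] ff bf]] := iso_pair hH sgK sg_neq (inE _ bU bA) (inE _ cU cA) bb bc.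
  by exists b, f, 0, 0, u; rewrite !scale0r !add0r.
have [g [gU gA ug]] := nondeg_ex hH ndU AU uU nuA.
have gu : h g u != 0 by apply: contra ug => /eqP/(form_orth hH)->.
have [z [zE zz zu]] := iso_escape hH sgK sg_neq (inE _ bU bA) (inE _ cU cA) (inE _ gU gA) bb bc gu.
have [l [fE ff]] := iso_correct hH sgK sg_neq zE (inE _ uU uA) zz zu.
have zf : h z (l *: z + u) = h z u by rewrite !hE zz mulr0 add0r.
set f := l *: z + u in fE ff zf; have uE : u = (- l) *: z + f by rewrite scaleNr addKr.
have szu : sg (h z u)^-1 != 0 by rewrite fmorph_eq0 invr_eq0.
have [zU zA] := memv_capP zE; have [fU fA] := memv_capP fE; clearbody f.
exists z, (sg (h z u)^-1 *: f), (- l), (sg (h z u)^-1)^-1, 0; split; rewrite ?mem0v //.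
- by split; rewrite ?rpredZ.
- by split; rewrite // !hE ?ff ?mulr0 // zf sgK mulVf.
- by rewrite addr0 scalerA mulVf // scale1r.
Qed.

Variable P : {vspace vT} -> Prop.
Hypothesis cP : closed_under true W k.+1 P.

Let addAC A x y : (A + <[x]> + <[y]> = A + <[y]> + <[x]>)%VS.
Proof. by rewrite -addvA [(<[x]> + _)%VS]addvC addvA. Qed.

Lemma closed_residue r : r \in W -> (forall A (j : nat), ksubv U j A -> ksubv W j.+1 (A + <[r]>)) ->
  r \notin U -> closed_under true U k (fun A => P (A + <[r]>)%VS).
Proof.
move=> rW kr nrU A x y a c dA Ax Ay hxy Az Px Py.
have nrA : r \notin A.
  apply: contra nrU; apply/subvP/(subv_trans (addvSl _ <[x]>)); by case/and3P: Ax.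
rewrite addAC; apply: cP => //.
- by rewrite dim_add1 nrA addn1 dA.
- by rewrite addAC kr.
- by rewrite addAC kr.
- by rewrite addAC kr.
- by rewrite addAC.
- by rewrite addAC.
Qed.

Hypotheses (Pp : forall A, ksubv U k A -> P (A + <[p]>)%VS)
  (Pq : forall A, ksubv U k A -> P (A + <[q]>)%VS).

(** After scaling, [(x, y)] is a hyperbolic pair orthogonal to [(p, q)]. All four points are in P in
    the residue of A, so the grid contains the whole hyperbolic line of [x] and [y]. *)
Lemma hyperbolic_closed : closed_under false U k.+1 P.
Proof.
move=> A x y a c dA Ax Ay hxy Az Px Py.
have dA' : \dim A = k by case: dA.
have kA : ksubv U k A by apply: (ksubv_sub hH _ dA' Ax); rewrite addvSl.
have [AU _ _] := and3P kA; have [pA qA] := perp_pq AU.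
have := Ax; rewrite (ksubv_add1 hH) // => /and4P[xU /eqP xx xA nx].
have := Ay; rewrite (ksubv_add1 hH) // => /and4P[yU /eqP yy yA ny].
have := Az; rewrite (ksubv_add1 hH) // => /and4P[zU /eqP zz zA nz].
have hxy0 : sg (h x y)^-1 != 0 by rewrite fmorph_eq0 invr_eq0 hxy.
have hxy1 : h x y != 0 by rewrite hxy.
move: (xU) (yU); rewrite !memU => /and3P[xW /eqP xp /eqP xq] /and3P[yW /eqP yp /eqP yq].
pose y' := sg (h x y)^-1 *: y.
have zE : a *: x + c *: y = vec4 p q x y' 0 0 a (c / sg (h x y)^-1).
  by rewrite /vec4 /y' scalerA divfK // !scale0r !add0r.
rewrite zE in zz nz *; apply: (@grid_residue W k P A) => //.
- exact: (ksubvS UW kA).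
- by split=> //; rewrite rpredZ.
- by split=> //; rewrite rpredZ.
- by split; rewrite /y' // !hE ?yy ?mulr0 // sgK mulVf.
- by split; rewrite /y' ?hE; rewrite ?(form_orth hH xp) ?(form_orth hH xq) ?(form_orth hH yp) ?(form_orth hH yq) ?mulr0.
- exact: Pp.
- exact: Pq.
- by rewrite /y' add1Z.
- by apply: contraNneq nz => ->; rewrite mem0v.
Qed.

Hypothesis PU : forall X, ksubv U k.+1 X -> P X.

(** X is A + <x>, and modulo A the vector [x] lies in the span of [(p, q)] and of a hyperbolic pair
    of U; the grid on these two pairs contains it. *)
Lemma large_meet A X : ksubv W k.+1 X -> ksubv U k A -> (A <= X)%VS -> P X.
Proof.
move=> kX kA AX; have [XW tX /eqP dX] := and3P kX; have [AU tA /eqP dA] := and3P kA.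
have [pA qA] := perp_pq AU.
have [x [xX nx XE]] := split_add1 AX (etrans dX (congr1 S (esym dA))).
have xW := subvP XW _ xX; have xA : x \in perp A by apply: (subvP (subv_trans tX (perpS hH AX))).
have xx : h x x = 0 := tot_isoP hH _ tX _ _ xX xX.
have [u uU [a [b xE]]] := plane_proj hH pp qq pq pW qW xW.
have uA : u \in perp A.
  have -> : u = x - (a *: p + b *: q) by rewrite xE addrK.
  by rewrite rpredB ?rpredD ?rpredZ.
have [c [d' [a1 [a2 [w [[cU dU cA dA'] [cc dd cd] wA uE]]]]]] := hyp_cover kA uU uA.
have xE' : x = vec4 p q c d' a b a1 a2 + w.
  by rewrite xE uE /vec4 [LHS]addrC !addrA.
have orthU z : z \in U -> h p z = 0 /\ h q z = 0.
  by rewrite memU => /and3P[_ /eqP zp /eqP zq]; split; apply: (form_orth hH).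
have [pc qc] := orthU _ cU; have [pd qd] := orthU _ dU.
rewrite XE xE' add1_shift //; apply: (@grid_residue W k P A) => //.
- exact: (ksubvS UW kA).
- by split=> //; apply: (subvP UW).
- exact: Pp.
- exact: Pq.
- apply: PU; rewrite (ksubv_add1 hH) // cU cc eqxx cA; apply/negP => cAm.
  by move/eqP: cd; rewrite (form_orth hH (mem_perp hH _ _ dA' _ cAm)) eq_sym oner_eq0.
- apply: PU; rewrite (ksubv_add1 hH) // dU dd eqxx dA'; apply/negP => dAm.
  by move/eqP: cd; rewrite (mem_perp hH _ _ cA _ dAm) eq_sym oner_eq0.
- have -> : vec4 p q c d' a b a1 a2 = x - w by rewrite xE' addrK.
  have xw : h x w = 0 := mem_perp hH _ _ xA _ wA.
  by rewrite -[x]scale1r -scaleN1r; apply: iso_comb => //; apply: (tot_isoP hH _ tA).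
- apply: contraNneq nx => e; by rewrite xE' e add0r.
Qed.

Variable x : F.
Hypothesis xE : x + sg x = 1.
(** With [plane_vec'] this is an orthogonal basis of <p, q> with norms 1 and -1, so that U is
    reached from W by two successive non-degenerate hyperplanes. *)
Definition plane_vec := x *: p + q.
Definition plane_vec' := - sg x *: p + q.

Lemma plane_vec_form : [/\ h plane_vec plane_vec = 1, h plane_vec' plane_vec = 0 &
  h plane_vec' plane_vec' = - 1].
Proof.
rewrite /plane_vec /plane_vec' !hE pp qq pq qp !rmorphN /= sgK !mulr0 !mulr1.
by split; [rewrite -xE|..|rewrite -xE]; ring.
Qed.

Lemma plane_vec_perp : (W :&: perp <[plane_vec]> :&: perp <[plane_vec']>)%VS = U.
Proof.
apply/vspaceP => y; rewrite memU !memv_cap !(mem_perp1 hH) /plane_vec /plane_vec' -andbA.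
case: (y \in W) => //=; rewrite !hE rmorphN /= sgK.
apply/andP/andP => -[/eqP e1 /eqP e2]; last by rewrite e1 e2 !mulr0 addr0.
have yp : h y p = 0.
  rewrite -[h y p]mul1r -xE.
  by transitivity (sg x * h y p + h y q - (- x * h y p + h y q)); [ring|rewrite e1 e2 subrr].
by move: e1; rewrite yp mulr0 add0r => ->.
Qed.

(** [ordinary_hyperplane] is used for W1 in W, and its generation hypothesis is proved by using it
    for U in W1. A k-subspace Y of U has the extension Y + <p>. What remains are (k-1)-subspaces A
    of U with a two-step extension A + <y> + <z> in P that leaves U and then W1. *)
Lemma step_all : (forall k', k = k'.+1 -> forall Q, closed_under true U k' Q ->
    (forall A y z, ksubv U k' A -> ksubv (W :&: perp <[plane_vec]>) k (A + <[y]>) ->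
       h y plane_vec' != 0 -> ksubv W k.+1 (A + <[y]> + <[z]>) -> h z plane_vec != 0 ->
       P (A + <[y]> + <[z]>)%VS -> Q A) ->
    forall A, ksubv U k' A -> Q A) ->
  forall X, ksubv W k.+1 X -> P X.
Proof.
have [vv wv ww] := plane_vec_form; have UE := plane_vec_perp; move=> Pext.
set v := plane_vec in vv wv UE Pext *; set w := plane_vec' in wv ww UE Pext *.
set W1 := (W :&: perp <[v]>)%VS in UE Pext *.
have vW : v \in W by rewrite rpredD ?rpredZ.
have wW : w \in W by rewrite rpredD ?rpredZ.
have vv0 : h v v != 0 by rewrite vv oner_neq0.
have ww0 : h w w != 0 by rewrite ww oppr_eq0 oner_neq0.
have wW1 : w \in W1 by rewrite memv_cap wW (mem_perp1 hH) wv eqxx.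
have ndW1 : nondegv h W1 by apply: (nondeg_perp hH) => //; apply: (nondeg1 hH).
have UW1 : (U <= W1)%VS by rewrite -UE capvSl.
have [_ _ [M [MU tM _] dM]] := tU.
have kM : ksubv U n M by rewrite /ksubv MU tM dM eqxx.
(* In W a totally isotropic subspace of dimension more than k + 1 is required. M has dimension n,
   which may equal k + 1; M + <p> is large enough. *)
have /and3P[MpW tMp /eqP dMp] := ksubv_p kM.
have PW1 X : ksubv W1 k.+1 X -> P X.
  move=> kX; have [XW1 tX /eqP dX] := and3P kX.
  have dW1 : \dim W1 = (\dim U).+1 by rewrite (dim_hyperplane hH ndW1 wW1 ww0) UE.
  have [|A [_ AX dA]] := @dim_between _ _ k 0%VS (X :&: U)%VS (sub0v _).
    have := dimv_sum_cap X U; have : (\dim (X + U) <= \dim W1)%N by rewrite dimvS // subv_add XW1.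
    by rewrite dimv0 dW1 dX; clear; lia.
  have [AX' AU] : (A <= X)%VS /\ (A <= U)%VS by move: AX; rewrite subv_cap => /andP.
  apply: (@large_meet A) => //; first exact: (ksubvS (capvSl _ _) kX).
  by rewrite /ksubv AU (tot_isoS hH AX' tX) dA eqxx.
apply: (ordinary_hyperplane ndW vW vv0 MpW tMp _ cP PW1); first by rewrite dMp.
move=> Q cQ HQ.
have QU Y : ksubv U k Y -> Q Y.
  move=> kY; apply: (HQ Y p); last exact: Pp.
  - exact: (ksubvS UW1 kY).
  - exact: ksubv_p.
  - by rewrite /v /plane_vec !hE pp pq mulr0 add0r oner_neq0.
case k0 : k => [|k'].
  by move=> Y; rewrite ksubv0 => /eqP->; apply: QU; rewrite k0 ksubv0.
rewrite -k0.
have := ordinary_hyperplane ndW1 wW1 ww0 (subv_trans MU UW1) tM; rewrite UE.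
move=> /(_ k' Q); rewrite -k0 dM; apply=> //.
move=> Q' cQ' HQ'; apply: (Pext k' k0 Q' cQ') => A y z kA kAy yw kAyz zv PA.
by apply: (HQ' A y) => //; apply: (HQ _ z).
Qed.
End Step.

Lemma seq_choice (S T : eqType) (R : S -> T -> Prop) (L : seq S) :
  {in L, forall a, exists b, R a b} ->
  exists L' : seq T, [/\ size L' = size L, {in L', forall b, exists a, R a b} &
    {in L, forall a, exists2 b, b \in L' & R a b}].
Proof.
elim: L => [|a L IH] H; first by exists [::].
have [|L' [sL' H1 H2]] := IH; first by move=> b bL; apply: H; rewrite inE bL orbT.
have [b ab] := H a (mem_head _ _); exists (b :: L'); split=> [|c|c].
- by rewrite /= sL'.
- by rewrite inE => /orP[/eqP->|/H1//]; exists a.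
rewrite inE => /orP[/eqP->|/H2[d dL' cd]]; first by exists b; rewrite ?mem_head.
by exists d; rewrite // inE dL' orbT.
Qed.

Hypothesis F0_elem : exists c, [/\ sg c = c, c != 0 & c != 1].

Lemma ordinary_generation W n d k : utype h W n d -> (k < n)%N ->
  exists L, [/\ all (ksubv W k) L, (size L <= 'C(2 * n + d, k))%N & generatesv h true W k L].
Proof.
elim: n W k => // n IH W [|k] tW kn.
  exists [:: 0%VS]; rewrite bin0 /= ksubv0 eqxx; split=> //; exact: generates0.
have [p [q [pW qW [pp qq pq tU]]]] := utype_split tW.
have [ndW _ _] := tW; set U := (W :&: perp (<[p]> + <[q]>))%VS in tU.
have [x xE] := trace_surj sgK sg_neq (rmorph1 sg).
have qp : h q p = 1 by rewrite (form_sym hH) pq rmorph1.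
have [L1 [kL1 sL1 gL1]] := IH _ k tU kn.
have [L2 [kL2 sL2 gL2]] := hyperbolic_generation hH sgK sg_neq F0_elem k.+1 tU.
set v := plane_vec p q x; set w := plane_vec' p q x.
have [vv wv ww] := plane_vec_form pp qq pq xE; rewrite -/v -/w in vv wv ww.
have UE := plane_vec_perp W p q xE; rewrite -/v -/w -/U in UE.
set W1 := (W :&: perp <[v]>)%VS in UE.
have vW : v \in W by rewrite rpredD ?rpredZ.
have wW1 : w \in W1 by rewrite memv_cap (mem_perp1 hH) wv eqxx rpredD ?rpredZ.
have vv0 : h v v != 0 by rewrite vv oner_neq0.
have ww0 : h w w != 0 by rewrite ww oppr_eq0 oner_neq0.
have ndW1 : nondegv h W1 by apply: (nondeg_perp hH) => //; apply: (nondeg1 hH).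
have [_ _ [M [MU tM _] dM]] := tU.
have UW : (U <= W)%VS by apply: capvSl.
have UW1 : (U <= W1)%VS by rewrite -UE capvSl.
(* One two-step extension for each generator of the (k-1)-subspaces of U, in the form of the premise
   of [step_all]; none for k = 0. *)
have [L3 [kL3 sL3 gL3]] : exists L3, [/\ all (ksubv W k.+1) L3,
    (size L3 <= (if k is k'.+1 then 'C(2 * n + d, k') else 0))%N &
    forall P : {vspace vT} -> Prop, {in L3, forall Z, P Z} -> forall k', k = k'.+1 ->
    forall Q, closed_under true U k' Q ->
    (forall A y z, ksubv U k' A -> ksubv W1 k (A + <[y]>) ->
       h y w != 0 -> ksubv W k.+1 (A + <[y]> + <[z]>) -> h z v != 0 ->
       P (A + <[y]> + <[z]>)%VS -> Q A) ->
    forall A, ksubv U k' A -> Q A].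
  case ek : k => [|k']; first by exists [::].
  have k'n : (k' < n)%N by rewrite ek in kn; apply: ltnW.
  have [L [kL sL gL]] := IH _ k' tU k'n.
  pose R A Z := exists y z, [/\ Z = (A + <[y]> + <[z]>)%VS, ksubv W1 k (A + <[y]>),
    h y w != 0, ksubv W k.+1 Z & h z v != 0].
  have [A AL|L' [sL' L'R LR]] := @seq_choice _ _ R L.
    have kA : ksubv (W1 :&: perp <[w]>) k' A by rewrite UE; apply: (allP kL).
    have [|y [_ _ _ yw ky]] := extend_off ndW1 wW1 ww0 (subv_trans MU UW1) tM _ kA.
      by rewrite dM.
    have kA1 : ksubv W1 k (A + <[y]>) by rewrite ek.
    have [|z [_ _ _ zv kz]] := extend_off ndW vW vv0 (subv_trans MU UW) tM _ kA1.
      by rewrite dM.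
    by exists (A + <[y]> + <[z]>)%VS, y, z; split.
  exists L'; split; first by apply/allP => Z /L'R[A [y [z [_ _ _ + _]]]]; rewrite ek.
    by rewrite sL'.
  move=> P PL' _ [<-] Q cQ HQ A kA; apply: (gL _ cQ _ _ kA) => B BL.
  have [Z ZL' [y [z [ZE k1 yw k2 zv]]]] := LR B BL; rewrite ZE in k2 ZL'.
  rewrite -ek in HQ; apply: (HQ B y z) => //; first exact: (allP kL).
  exact: PL'.
pose Lp r := [seq (A + <[r]>)%VS | A <- L1].
have kr r A : (r == p) || (r == q) -> ksubv U k A -> ksubv W k.+1 (A + <[r]>).
  by case/orP=> /eqP->; [apply: (@ksubv_p W p q)|apply: (@ksubv_q W p q)].
exists (Lp p ++ Lp q ++ L2 ++ L3); split.
- rewrite !all_cat kL3 andbT; apply/and3P; split.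
  + by apply/allP => Z /mapP[A /(allP kL1) kA ->]; apply: kr; rewrite ?eqxx.
  + by apply/allP => Z /mapP[A /(allP kL1) kA ->]; apply: kr; rewrite ?eqxx ?orbT.
  + by apply/allP => Z /(allP kL2); apply: ksubvS.
- rewrite bin_split !size_cat !size_map.
  by move: sL1 sL2 sL3; clear; case: k => [|k]; lia.
move=> P cP PL.
have Pr r : r \in W -> (r == p) || (r == q) -> {in Lp r, forall Z, P Z} ->
    forall A, ksubv U k A -> P (A + <[r]>)%VS.
  move=> rW rpq PLr; apply: (gL1 (fun A => P (A + <[r]>)%VS)) => [|A AL].
    apply: (closed_residue cP rW) => //.
      by move=> A j kA; case/orP: rpq => /eqP->;
        [apply: (@ksubv_p W p q)|apply: (@ksubv_q W p q)].
    rewrite memv_cap (perpD hH) memv_cap !(mem_perp1 hH).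
    by case/orP: rpq => /eqP->; rewrite ?pq ?qp oner_eq0 ?andbF.
  by apply: PLr; apply: map_f.
have Pp : forall A, ksubv U k A -> P (A + <[p]>)%VS.
  by apply: Pr; rewrite ?eqxx // => Z ZL; apply: PL; rewrite mem_cat ZL.
have Pq : forall A, ksubv U k A -> P (A + <[q]>)%VS.
  by apply: Pr; rewrite ?eqxx ?orbT // => Z ZL; apply: PL; rewrite !mem_cat ZL orbT.
have PU : forall X, ksubv U k.+1 X -> P X.
  apply: gL2; first exact: (hyperbolic_closed pW qW pp qq pq cP Pp Pq).
  by move=> Z ZL; apply: PL; rewrite !mem_cat ZL !orbT.
apply: (step_all pW qW pp qq pq ndW tU kn cP Pp Pq PU xE).
by apply: gL3 => Z ZL; apply: PL; rewrite !mem_cat ZL !orbT.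
Qed.

End OrdinaryGeneration.

(** * Cardinal arithmetic *)

Section Cardinal.

(** By Zorn's lemma there is a maximal partial injection, taken as a relation; it is total or onto,
    otherwise a pair could be added. *)
Lemma injection_total (X Y : Type) :
  (exists f : X -> Y, injective f) \/ (exists f : Y -> X, injective f).
Proof.
pose P (R : X * Y -> Prop) := (forall x y y', R (x, y) -> R (x, y') -> y = y') /\
  (forall x x' y, R (x, y) -> R (x', y) -> x = x').
have [|R [[R1 R2] maxR]] := @classical_sets.Zorn_bigcup (X * Y)%type P.
  move=> C CP totC.
  have join u v : (exists2 A, C A & A u) -> (exists2 A, C A & A v) -> exists A, [/\ C A, A u & A v].
    move=> [A CA Au] [A' CA' Av].
    by have [s|s] := totC _ _ CA CA'; [exists A'|exists A]; split=> //; apply: s.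
  split=> [x y y' Rxy Rxy'|x x' y Rxy Rxy'].
    by have [A [CA Au Av]] := join _ _ Rxy Rxy'; have [H _] := CP _ CA; apply: (H x).
  by have [A [CA Au Av]] := join _ _ Rxy Rxy'; have [_ H] := CP _ CA; apply: (H _ _ y).
have [Rtot|nRtot] := boolp.pselect (forall x, exists y, R (x, y)).
  by left; have [f fR] := boolp.choice Rtot; exists f => x x' e; apply: (R2 _ _ (f x)); rewrite // e.
have [Rsur|nRsur] := boolp.pselect (forall y, exists x, R (x, y)).
  by right; have [f fR] := boolp.choice Rsur; exists f => y y' e; apply: (R1 (f y)); rewrite // e.
move/boolp.existsNP: nRtot => [x nx]; move/boolp.existsNP: nRsur => [y ny].
have nx' z : ~ R (x, z) by move=> Rxz; apply: nx; exists z.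
have ny' z : ~ R (z, y) by move=> Rzy; apply: ny; exists z.
case: (maxR (fun u => R u \/ u = (x, y))).
  split; first by move=> u Ru; left.
  by move=> H; case: (nx' y); apply: H; right.
split=> [a b b' [Rab|[ea eb]] [Rab'|[ea' eb']]|a a' b [Rab|[ea eb]] [Rab'|[ea' eb']]].
- exact: (R1 a).
- by rewrite ea' in Rab; case: (nx' b).
- by rewrite ea in Rab'; case: (nx' b').
- by rewrite eb eb'.
- exact: (R2 _ _ b).
- by rewrite eb' in Rab; case: (ny' a).
- by rewrite eb in Rab'; case: (ny' a').
- by rewrite ea ea'.
Qed.

Lemma cantor_bernstein (X Y : Type) (f : X -> Y) (g : Y -> X) : injective f -> injective g ->
  exists k : X -> Y, injective k /\ forall y, exists x, k x = y.
Proof.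
(* [C] holds the points whose backward chain ends in X outside the image of [g]; there the bijection
   is [f], elsewhere the inverse of [g]. *)
move=> fI gI; pose C x := exists n y, (forall z, g z <> y) /\ iter n (g \o f) y = x.
have nC x : ~ C x -> exists y, g y = x.
  move=> nCx; apply: boolp.contrapT => ng; apply: nCx; exists 0, x; split=> // z e.
  by apply: ng; exists z.
have CS x : C x -> C (g (f x)) by move=> [n [y [ny <-]]]; exists n.+1, y.
have CSinv x : C (g (f x)) -> C x.
  move=> [[|n] [y [ny /= e]]]; first by case: (ny (f x)).
  by exists n, y; split=> //; apply/fI/gI.
have [k kP] : exists k : X -> Y, forall x, (C x /\ k x = f x) \/ (~ C x /\ g (k x) = x).
  have [|k kP] := @boolp.choice X Y (fun x y => (C x /\ y = f x) \/ (~ C x /\ g y = x)).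
    move=> x; have [Cx|nCx] := boolp.pselect (C x); first by exists (f x); left.
    by have [y gy] := nC _ nCx; exists y; right.
  by exists k.
exists k; split=> [x x' e|y].
  have [[Cx kx]|[nx kx]] := kP x; have [[Cx' kx']|[nx' kx']] := kP x'.
  - by apply: fI; rewrite -kx -kx'.
  - by case: nx'; rewrite -kx' -e kx; apply: CS.
  - by case: nx; rewrite -kx e kx'; apply: CS.
  - by rewrite -kx -kx' e.
have [Cgy|nCgy] := boolp.pselect (C (g y)).
  have [[|n] [x [nx /= e]]] := Cgy; first by case: (nx y).
  set x' := iter n (g \o f) x in e; exists x'; have Cx' : C x' by exists n, x.
  have [[_ ->]|[]//] := kP x'; exact: gI.
by exists (g y); have [[]//|[_]] := kP (g y); apply: gI.
Qed.

Variable B : Type.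
Hypothesis infB : infinite_type B.

Lemma infinite_sequence : exists f : nat -> B, injective f.
Proof.
elim/boolp.Peq : B infB => T infT.
have fresh (s : seq T) : exists x, x \notin s.
  apply: boolp.contrapT => all_s; apply: infT; exists (size s), (fun i => tnth (in_tuple s) i) => x.
  have xs : x \in s by apply/negPn/negP => nx; apply: all_s; exists x.
  have lt : (index x s < size s)%N by rewrite index_mem.
  by exists (Ordinal lt); rewrite (tnth_nth x) /= nth_index.
have [c cP] := boolp.choice fresh.
pose s := fix s n := if n is n'.+1 then c (s n') :: s n' else [::].
have mem_s m n : (m < n)%N -> c (s m) \in s n.
  elim: n => // n IH; rewrite ltnS leq_eqVlt => /orP[/eqP->|/IH H]; rewrite inE ?eqxx //.
  by rewrite H orbT.
exists (fun n => c (s n)) => m n e; have [|lt|//] := ltngtP m n.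
  by move/mem_s; rewrite e (negbTE (cP _)).
by have := mem_s _ _ lt; rewrite -e (negbTE (cP _)).
Qed.

(** * Coding pairs of tagged elements *)

Section Pairing.
Variables (D : B -> Prop) (phi : B -> B -> B) (iota : nat -> B).
Hypotheses (phiD : forall x y, D x -> D y -> D (phi x y))
  (phiI : forall x y x' y', D x -> D y -> D x' -> D y' -> phi x y = phi x' y' -> x = x' /\ y = y')
  (iotaD : forall n, D (iota n)) (iotaI : injective iota).

(** The number records which of the four combinations of tags occurs. *)
Definition encode (c d : bool * B) := phi (phi c.2 d.2) (iota (2 * c.1 + d.1)).

Lemma encodeD c d : D c.2 -> D d.2 -> D (encode c d).
Proof. by move=> Dc Dd; rewrite /encode; auto. Qed.

Lemma encode_inj c d c' d' : D c.2 -> D d.2 -> D c'.2 -> D d'.2 -> encode c d = encode c' d' ->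
  c = c' /\ d = d'.
Proof.
case: c d c' d' => [c1 c2] [d1 d2] [c1' c2'] [d1' d2'] /= Dc Dd Dc' Dd'; rewrite /encode /=.
move=> /phiI [||||/phiI[]// -> -> /iotaI]; auto.
by case: c1 c1' d1 d1' => -[] [] [].
Qed.
End Pairing.

(** Zorn's lemma on injective pairings of subsets D containing a fixed sequence. If the complement
    of a maximal D embeds into D, then B embeds into bool * D and [encode] pairs it. Otherwise D
    embeds into its complement, and [encode] extends the pairing to D and a disjoint copy, against
    maximality. *)
Lemma square_inj : exists phi : B -> B -> B,
  forall x y x' y', phi x y = phi x' y' -> x = x' /\ y = y'.
Proof.
have [iota iotaI] := infinite_sequence.
pose good (p : (B -> Prop) * (B -> B -> B)) := [/\ forall x y, p.1 x -> p.1 y -> p.1 (p.2 x y),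
  forall x y x' y', p.1 x -> p.1 y -> p.1 x' -> p.1 y' -> p.2 x y = p.2 x' y' -> x = x' /\ y = y' &
  forall n, p.1 (iota n)].
pose le (p q : (B -> Prop) * (B -> B -> B)) :=
  (forall x, p.1 x -> q.1 x) /\ (forall x y, p.1 x -> p.1 y -> p.2 x y = q.2 x y).
have [phi0 phi0P] : exists phi : B -> B -> B, forall m n, phi (iota m) (iota n) = iota (pickle (m, n)).
  have [|phi phiP] := @boolp.choice (B * B) B (fun u z => forall m n, u = (iota m, iota n) -> z = iota (pickle (m, n))).
    move=> u; have [[m [n ->]]|nu] := boolp.pselect (exists m n, u = (iota m, iota n)).
      by exists (iota (pickle (m, n))) => m' n' [/iotaI <- /iotaI <-].
    by exists u.1 => m n e; case: nu; exists m, n.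
  by exists (fun x y => phi (x, y)) => m n; apply: phiP.
pose D0 x := exists n, iota n = x.
have good0 : good (D0, phi0).
  split=> /= [_ _ [m <-] [n <-]|_ _ _ _ [m <-] [n <-] [m' <-] [n' <-]|n]; last by exists n.
    by exists (pickle (m, n)).
  by rewrite !phi0P => /iotaI/(pcan_inj pickleK)[-> ->].
pose T := {p | good p}; pose t0 : T := exist _ _ good0.
have [|||[[D phi] /= gp] maxp] := @classical_sets.ZL_preorder T t0 (fun p q => boolp.asbool (le (sval p) (sval q))).
- by move=> t; apply/boolp.asboolP; split.
- move=> r s t /boolp.asboolP[d1 e1] /boolp.asboolP[d2 e2]; apply/boolp.asboolP; split.
    by move=> x /d1/d2.
  by move=> x y rx ry; rewrite e1 // e2 //; apply: d1.
- move=> C totC; have [[p0 Cp0]|nC] := boolp.pselect (exists p, C p); last first.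
    by exists t0 => s Cs; case: nC; exists s.
  pose D x := exists2 p, C p & (sval p).1 x.
  have join p q : C p -> C q -> exists r, [/\ C r, le (sval p) (sval r) & le (sval q) (sval r)].
    move=> Cp Cq; have [/boolp.asboolP l|/boolp.asboolP l] := totC _ _ Cp Cq.
      by exists q; split=> //; split.
    by exists p; split=> //; split.
  have join2 x y : D x -> D y -> exists r, [/\ C r, (sval r).1 x & (sval r).1 y].
    by move=> [p Cp px] [q Cq qy]; have [r [Cr [pr _] [qr _]]] := join _ _ Cp Cq; exists r; split; auto.
  have [phi phiP] : exists phi : B -> B -> B, forall p x y, C p -> (sval p).1 x -> (sval p).1 y ->
      phi x y = (sval p).2 x y.
    have [|phi phiP] := @boolp.choice (B * B) B (fun u z => forall p, C p -> (sval p).1 u.1 -> (sval p).1 u.2 ->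
      z = (sval p).2 u.1 u.2).
      move=> [x y] /=; have [[p [Cp px py]]|nu] := boolp.pselect (exists p, [/\ C p, (sval p).1 x & (sval p).1 y]).
        exists ((sval p).2 x y) => q Cq qx qy; have [r [Cr [_ pr] [_ qr]]] := join _ _ Cp Cq.
        by rewrite pr // qr.
      by exists x => q Cq qx qy; case: nu; exists q.
    by exists (fun x y => phi (x, y)) => p x y; apply: (phiP (x, y)).
  have gD : good (D, phi).
    split=> /= [x y Dx Dy|x y x' y' Dx Dy Dx' Dy'|n].
    - have [r [Cr rx ry]] := join2 _ _ Dx Dy; exists r => //.
      by rewrite (phiP r) //; have [H _ _] := svalP r; apply: H.
    - have [r [Cr rx ry]] := join2 _ _ Dx Dy; have [q [Cq qx qy]] := join2 _ _ Dx' Dy'.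
      have [s [Cs [rs _] [qs _]]] := join _ _ Cr Cq.
      by rewrite !(phiP s); auto; have [_ H _] := svalP s; apply: H; auto.
    - by exists p0 => //; have [_ _ H] := svalP p0; apply: H.
  exists (exist _ _ gD) => s Cs; apply/boolp.asboolP; split=> /= [x sx|x y sx sy]; first by exists s.
  by rewrite (phiP s).
have [phiD phiI iotaD] := gp; rewrite /= in phiD phiI iotaD.
have lift (X : B -> Prop) (f : {x | X x} -> B) : exists f' : B -> B, forall x (Xx : X x), f' x = f (exist _ x Xx).
  have [|f' fP] := @boolp.choice B B (fun x y => forall Xx : X x, y = f (exist _ x Xx)).
    move=> x; have [Xx|nXx] := boolp.pselect (X x); last by exists x => Xx; case: nXx.
    by exists (f (exist _ x Xx)) => Xx'; rewrite (boolp.Prop_irrelevance Xx Xx').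
  by exists f'.
have svalI (X : B -> Prop) (u v : {x | X x}) : sval u = sval v -> u = v.
  by case: u v => [u Xu] [v Xv] /= e; subst v; rewrite (boolp.Prop_irrelevance Xu Xv).
have [[psi psiI]|[chi chiI]] := injection_total {x | D x} {x | ~ D x}; last first.
  have [f fP] := lift (fun x => ~ D x) (fun u => sval (chi u)).
  pose code x := if boolp.pselect (D x) is left _ then (false, x) else (true, f x).
  have codeD x : D (code x).2.
    by rewrite /code; case: (boolp.pselect (D x)) => //= nDx; rewrite (fP _ nDx); apply: svalP.
  have codeI x y : code x = code y -> x = y.
    rewrite /code; case: (boolp.pselect (D x)) => Dx; case: (boolp.pselect (D y)) => Dy //=; first by case.
    by case; rewrite (fP _ Dx) (fP _ Dy) => /svalI/chiI [].
  exists (fun x y => encode phi iota (code x) (code y)) => x y x' y'.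
  move=> e; have [e1 e2] := encode_inj phiD phiI iotaD iotaI (codeD x) (codeD y) (codeD x') (codeD y') e.
  by split; apply: codeI.
have [f fP] := lift D (fun u => sval (psi u)).
have fD x : D x -> ~ D (f x) by move=> Dx; rewrite (fP _ Dx); exact: (svalP (psi (exist _ x Dx))).
have fI x y : D x -> D y -> f x = f y -> x = y.
  by move=> Dx Dy; rewrite (fP _ Dx) (fP _ Dy) => /svalI/psiI [].
pose D' x := D x \/ exists2 y, D y & f y = x.
have [code codeP] : exists code : B -> bool * B, forall x, D' x -> D (code x).2 /\
    x = if (code x).1 then f (code x).2 else (code x).2.
  have [|code cP] := @boolp.choice B (bool * B) (fun x c => D' x -> D c.2 /\ x = if c.1 then f c.2 else c.2).
    move=> x; have [[Dx|[y Dy <-]]|nD] := boolp.pselect (D' x); last by exists (true, x).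
      by exists (false, x).
    by exists (true, y).
  by exists code.
pose phi' x y := if boolp.pselect (D x /\ D y) is left _ then phi x y
  else f (encode phi iota (code x) (code y)).
have codeI x y : D' x -> D' y -> code x = code y -> x = y.
  by move=> /codeP[_ ex] /codeP[_ ey] e; rewrite ex ey e.
have encD x y : D' x -> D' y -> D (encode phi iota (code x) (code y)).
  by move=> /codeP[Dx _] /codeP[Dy _]; apply: encodeD.
have g' : good (D', phi').
  split=> /= [x y Dx Dy|x y x' y' Dx Dy Dx' Dy'|n]; last by left.
    rewrite /phi'; case: (boolp.pselect _) => [[]|_]; first by left; auto.
    by right; exists (encode phi iota (code x) (code y)); auto.
  rewrite /phi'; case: (boolp.pselect _) => [[dx dy]|n1]; case: (boolp.pselect _) => [[dx' dy']|n2].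
  - exact: phiI.
  - by move=> e; case: (fD _ (encD _ _ Dx' Dy')); rewrite -e; auto.
  - by move=> e; case: (fD _ (encD _ _ Dx Dy)); rewrite e; auto.
  - move=> /(fI _ _ (encD _ _ Dx Dy) (encD _ _ Dx' Dy')).
    have [d1 _] := codeP _ Dx; have [d2 _] := codeP _ Dy.
    have [d3 _] := codeP _ Dx'; have [d4 _] := codeP _ Dy'.
    move=> e; have [e1 e2] := encode_inj phiD phiI iotaD iotaI d1 d2 d3 d4 e.
    by split; apply: codeI.
have : le (D', phi') (D, phi).
  apply/boolp.asboolP; apply: (maxp (exist _ _ g')); apply/boolp.asboolP; split=> /= [x Dx|x y Dx Dy].
    by left.
  by rewrite /phi'; case: (boolp.pselect _) => // n; case: n.
case=> /= sub _; case: (fD _ (iotaD 0)); apply: sub; right.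
by exists (iota 0%N).
Qed.

(** A list is folded with the pairing; its size is stored too, as the fold alone does not tell where
    the list ends. *)
Lemma seq_nat_inj : exists f : seq B * nat -> B, injective f.
Proof.
have [iota iotaI] := infinite_sequence; have [phi phiI] := square_inj.
pose enc s := phi (iota (size s)) (foldr phi (iota 0%N) s).
have encI : injective enc.
  move=> s s' /phiI[/iotaI]; elim: s s' => [|x s IH] [|x' s'] //= [sz] /phiI[-> e].
  by rewrite (IH _ sz e).
exists (fun u => phi (enc u.1) (iota u.2)) => -[s i] [s' i'] /= /phiI[/encI -> /iotaI ->].
by [].
Qed.
End Cardinal.

(** * Exchange in infinite dimension *)

Section Exchange.
Variables (F : fieldType) (K : lmodType F).

Definition submodule (M : K -> Prop) := M 0 /\ forall a u v, M u -> M v -> M (a *: u + v).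
Definition spanned (S : K -> Prop) v := forall M, submodule M -> (forall u, S u -> M u) -> M v.
Definition independent (B : Type) (b : B -> K) := forall m (t : 'I_m -> B) (c : 'I_m -> F),
  injective t -> \sum_(i < m) c i *: b (t i) = 0 -> forall i, c i = 0.

Lemma submodule_spanned S : submodule (spanned S).
Proof.
split=> [M [M0 _] _ //|a u v Su Sv M mM SM].
by apply: mM.2; [apply: Su|apply: Sv].
Qed.

Lemma spanned_mem (S : K -> Prop) v : S v -> spanned S v.
Proof. by move=> Sv M _; apply. Qed.

Lemma submoduleZ M a u : submodule M -> M u -> M (a *: u).
Proof. by move=> [M0 MD] Mu; rewrite -[_ *: _]addr0; apply: MD. Qed.

Lemma submoduleD M u v : submodule M -> M u -> M v -> M (u + v).
Proof. by move=> [M0 MD] Mu Mv; rewrite -[u]scale1r; apply: MD. Qed.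

Lemma submodule_sum M I (r : seq I) (Q : pred I) (x : I -> K) : submodule M ->
  (forall i, Q i -> M (x i)) -> M (\sum_(i <- r | Q i) x i).
Proof.
by move=> mM Mx; apply: big_ind => //; [case: mM|move=> u v; apply: submoduleD].
Qed.

Lemma independent_exchange (B : Type) (v v' : B -> K) x0 : independent v ->
  ~ spanned (fun u => exists2 x, x <> x0 & u = v x) (v' x0) ->
  (forall x, x <> x0 -> v' x = v x) -> independent v'.
Proof.
move=> iv nsp vv' m t c tI sum0.
have [[i0 ti0]|nt] := boolp.pselect (exists i, t i = x0); last first.
  apply: (iv m t c tI); rewrite -[RHS]sum0; apply: eq_bigr => i _; rewrite vv' // => ti.
  by apply: nt; exists i.
have other i : i != i0 -> v' (t i) = v (t i).
  by move=> ii0; apply: vv'; rewrite -ti0 => e; move/eqP: ii0; apply; apply: tI.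
have c0 : c i0 = 0.
  apply/eqP/negPn/negP => ci0; apply: nsp.
  set S := (fun u => _); have mS := submodule_spanned S.
  have -> : v' x0 = - (c i0)^-1 *: \sum_(i < m | i != i0) c i *: v (t i).
    move: sum0; rewrite (bigD1 i0) //= ti0 => /eqP; rewrite addr_eq0 => /eqP e.
    rewrite -[LHS](scalerK ci0) e scalerN scaleNr; congr (- (_ *: _)).
    by apply: eq_bigr => i ii0; rewrite other.
  apply: (submoduleZ _ mS); apply: (@submodule_sum (spanned S)) => //.
  move=> i ii0; apply: (submoduleZ _ mS).
  by apply: spanned_mem; exists (t i) => //; rewrite -ti0 => e; move/eqP: ii0; apply; apply: tI.
apply: (iv m t c tI); rewrite -[RHS]sum0; apply: eq_bigr => i _.
by have [->|ii0] := eqVneq i i0; [rewrite c0 !scale0r|rewrite other].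
Qed.

Lemma independent_notin (B : Type) (v : B -> K) x0 : independent v ->
  ~ spanned (fun u => exists2 x, x <> x0 & u = v x) (v x0).
Proof.
elim/boolp.Peq : B v x0 => B v x0 iv sp.
(* [spanned] quantifies over all submodules, so membership is used through this submodule of
   explicit combinations. Repetition-free lists yield the injective indexing that [independent] asks
   for. *)
pose M u := exists (l : seq B) (c : B -> F), [/\ uniq l, x0 \notin l & u = \sum_(x <- l) c x *: v x].
have restrict (l l' : seq B) (c : B -> F) : uniq l -> uniq l' -> {subset l <= l'} ->
    \sum_(x <- l') (if x \in l then c x else 0) *: v x = \sum_(x <- l) c x *: v x.
  move=> ul ul' sub; rewrite (bigID (mem l)) /= [X in _ + X]big1 => [|x /negbTE->]; last by rewrite scale0r.
  rewrite addr0 -big_filter (perm_big l) /=.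
    by rewrite big_seq [RHS]big_seq; apply: eq_bigr => x ->.
  by apply: uniq_perm; rewrite ?filter_uniq // => x; rewrite mem_filter; case: (boolP (x \in l)) => // /sub->.
have mM : submodule M.
  split=> [|a u1 u2 [l1 [c1 [ul1 nl1 ->]]] [l2 [c2 [ul2 nl2 ->]]]].
    by exists [::], (fun => 0); rewrite big_nil.
  exists (undup (l1 ++ l2)), (fun x => a * (if x \in l1 then c1 x else 0) + (if x \in l2 then c2 x else 0)).
  rewrite undup_uniq mem_undup mem_cat negb_or nl1 nl2; split=> //.
  rewrite -(restrict l1 (undup (l1 ++ l2))) ?undup_uniq //; last first.
    by move=> x xl; rewrite mem_undup mem_cat xl.
  rewrite -(restrict l2 (undup (l1 ++ l2))) ?undup_uniq //; last first.
    by move=> x xl; rewrite mem_undup mem_cat xl orbT.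
  by rewrite scaler_sumr -big_split /=; apply: eq_bigr => x _; rewrite scalerDl scalerA.
have [u [x xx0 ->]|l [c [ul nl e]]] := sp M mM.
  exists [:: x], (fun => 1); rewrite big_seq1 scale1r; split=> //.
  by rewrite inE eq_sym; apply/eqP.
have := iv (size l).+1 (fun i => nth x0 (x0 :: l) i) (fun i => if i == 0%N :> nat then 1 else - c (nth x0 (x0 :: l) i)).
rewrite big_ord_recl /= scale1r => H.
have /eqP : (1 : F) = 0; last by rewrite oner_eq0.
apply: (H _ _ ord0) => [i j /eqP|].
  by rewrite nth_uniq ?ltn_ord //= ?nl // => /eqP/val_inj.
rewrite {1}e (big_nth x0) big_mkord -big_split big1 // => i _ /=.
by rewrite scaleNr subrr.
Qed.

(* A maximal partial map along which the family [b] is exchanged for members of the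
   spanning family is everywhere defined. *)
Lemma exchange_injection (B I : Type) (b : B -> K) (s : I -> K) : independent b ->
  (forall x, spanned (fun u => exists i, u = s i) (b x)) -> exists g : B -> I, injective g.
Proof.
move=> ib sp; pose fam (R : B * I -> Prop) (v : B -> K) :=
  forall x, (exists2 i, R (x, i) & v x = s i) \/ ((forall i, ~ R (x, i)) /\ v x = b x).
have famP R : exists v, fam R v.
  have [|v vP] := @boolp.choice B K (fun x y => (exists2 i, R (x, i) & y = s i) \/ ((forall i, ~ R (x, i)) /\ y = b x)).
    move=> x; have [[i Ri]|nR] := boolp.pselect (exists i, R (x, i)).
      by exists (s i); left; exists i.
    by exists (b x); right; split=> // i Ri; apply: nR; exists i.
  by exists v.
pose P (R : B * I -> Prop) := (forall x i i', R (x, i) -> R (x, i') -> i = i') /\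
  (forall v, fam R v -> independent v).
have [|R [[R1 R2] maxR]] := @classical_sets.Zorn_bigcup (B * I)%type P.
  move=> C CP totC; split=> [x i i' [A CA Ai] [A' CA' A'i']|v fv m t c tI sum0].
    have [sub|sub] := totC _ _ CA CA'; [have [H _] := CP _ CA'|have [H _] := CP _ CA].
      by apply: (H x) => //; apply: sub.
    by apply: (H x) => //; apply: sub.
  have [[A0 CA0]|nC] := boolp.pselect (exists A, C A); last first.
    apply: (ib m t c tI); rewrite -[RHS]sum0; apply: eq_bigr => i _; congr (_ *: _).
    by have [[j [A CA _] _]|[_ ->]//] := fv (t i); case: nC; exists A.
  (* A linear relation involves finitely many indices, so a single member of the chain already
     contains all pairs of the union that matter. *)
  have [A [CA AP]] : exists A, C A /\ forall i j, (exists2 A', C A' & A' (t i, j)) -> A (t i, j).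
    have stage (l : seq 'I_m) : exists A, C A /\ forall i j, i \in l ->
        (exists2 A', C A' & A' (t i, j)) -> A (t i, j).
      elim: l => [|k l [A [CA AP]]]; first by exists A0.
      have [[j [A' CA' A'j]]|nj] := boolp.pselect (exists j, exists2 A', C A' & A' (t k, j)); last first.
        exists A; split=> // i j; rewrite inE => /orP[/eqP->|il] H; last exact: AP.
        by case: nj; exists j.
      have [B0 [CB AB A'B]] : exists B0, [/\ C B0, classical_sets.subset A B0 & classical_sets.subset A' B0].
        by have [sub|sub] := totC _ _ CA CA'; [exists A'|exists A]; split.
      exists B0; split=> // i j'; rewrite inE => /orP[/eqP->|il] H; last by apply/AB/AP.
      have [A'' CA'' A''j] := H; have [sub|sub] := totC _ _ CB CA''; last exact: sub.
      have [F1 _] := CP _ CA''; have e : j = j'.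
        by apply: (F1 (t k)) => //; apply/sub/A'B.
      by rewrite -e; apply: A'B.
    have [A [CA AP]] := stage (enum 'I_m); exists A; split=> // i j; apply: AP.
    by rewrite mem_enum.
  have [w fw] := famP A; have [_ iA] := CP _ CA; apply: (iA w fw m t c tI).
  rewrite -[RHS]sum0; apply: eq_bigr => i _; congr (_ *: _).
  have [F1 _] := CP _ CA.
  have [[j Aj ->]|[nA ->]] := fw (t i); have [[j' A'j ->]|[nA' ->]] := fv (t i) => //.
  - by congr s; apply: (F1 (t i)) => //; apply: AP.
  - by case: (nA' j); exists A.
  - by case: (nA j'); apply: AP.
have [v fv] := famP R; have iv := R2 v fv.
have [Rtot|nRtot] := boolp.pselect (forall x, exists i, R (x, i)).
  have [g gP] := boolp.choice Rtot; exists g => x y e.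
  apply: boolp.contrapT => xy.
  have vE z : v z = s (g z).
    have [[j Rj ->]|[nR _]] := fv z; first by congr s; apply: (R1 z).
    by case: (nR (g z)).
  have := iv 2%N (fun i : 'I_2 => if i == 0 then x else y) (fun i => if i == 0 then 1 else -1).
  rewrite !big_ord_recl big_ord0 /= !vE e scale1r scaleN1r addr0 subrr => /(_ _ erefl 0).
  rewrite /= => H; have /eqP : (1 : F) = 0; last by rewrite oner_eq0.
  apply: H => i j; case: (eqVneq i 0) => i0; case: (eqVneq j 0) => j0 //; try by [rewrite i0 j0|move=> /esym].
  by move=> _; apply/val_inj; case: i j i0 j0 => [[|[|]]//] ? [[|[|]]//].
move/boolp.existsNP: nRtot => [x0 nx]; exfalso.
have nx' i : ~ R (x0, i) by move=> Ri; apply: nx; exists i.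
pose W := spanned (fun u => exists2 x, x <> x0 & u = v x).
have vx0 : v x0 = b x0 by have [[i /nx']|[_ ->]] := fv x0.
have nW : ~ W (b x0) by rewrite -vx0; apply: independent_notin.
(* [b x0] is in the span of [s] but not in [W], so some [s i] is not in [W]; it can replace [v x0],
   which enlarges [R]. *)
have [i ni] : exists i, ~ W (s i).
  apply: boolp.contrapT => H; apply: nW; apply: sp; first exact: submodule_spanned.
  by move=> u [i ->]; apply: boolp.contrapT => ni; apply: H; exists i.
apply: (maxR (fun u => R u \/ u = (x0, i))).
  split; first by move=> u Ru; left.
  by move=> H; case: (nx' i); apply: H; right.
split=> [a j j' [Ra|[ea ej]] [Ra'|[ea' ej']]|w fw].
- exact: (R1 a).
- by rewrite ea' in Ra; case: (nx' j).
- by rewrite ea in Ra'; case: (nx' j').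
- by rewrite ej ej'.
apply: (@independent_exchange _ v w x0) => //.
  have -> // : w x0 = s i.
  by have [[j [/nx'//|[->]] ->]|[H _]] := fw x0; last by case: (H i); right.
move=> x xx0; have [[j [Rj|[]//] ->]|[H ->]] := fw x; have [[j' Rj' ->]|[H' ->]] := fv x => //.
- by congr s; apply: (R1 x).
- by case: (H' j).
- by case: (H j'); left.
Qed.
End Exchange.

(** * Exterior products of totally isotropic tuples *)

Section WedgeSpan.
Variables (F : fieldType) (sg : {rmorphism F -> F}) (vT : vectType F) (h : vT -> vT -> F).
Hypothesis hH : is_sigma_hermitian h sg.
Hypothesis sgK : forall a, sg (sg a) = a.
Hypothesis sg_neq : exists a, sg a <> a.
Variable K : lmodType F.
Implicit Types (x y z v : vT) (W M : {vspace vT}) (s : seq vT) (o : seq vT -> K).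

Definition multilinear o := forall s1 s2 a x y,
  o (s1 ++ (a *: x + y) :: s2) = a *: o (s1 ++ x :: s2) + o (s1 ++ y :: s2).
Definition alternating o := forall s1 s2 x, o (s1 ++ x :: x :: s2) = 0.

Lemma multilinear0 o s1 s2 : multilinear o -> o (s1 ++ 0 :: s2) = 0.
Proof.
move=> ml; have := ml s1 s2 (-1) 0 0.
by rewrite scaler0 addr0 scaleN1r addNr.
Qed.

Lemma alternating_front o s0 s1 s2 x : multilinear o -> alternating o ->
  o (s0 ++ s1 ++ x :: s2) = (-1) ^+ (size s1) *: o (s0 ++ x :: s1 ++ s2).
Proof.
move=> ml al; have addE s t y z : o (s ++ (y + z) :: t) = o (s ++ y :: t) + o (s ++ z :: t).
  by rewrite -[y]scale1r ml !scale1r.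
have swap s t y z : o (s ++ y :: z :: t) = - o (s ++ z :: y :: t).
  apply/eqP; rewrite -addr_eq0; apply/eqP; have := al s t (y + z).
  rewrite addE -[s ++ y :: _]cat_rcons -[s ++ z :: _]cat_rcons !addE !cat_rcons !al.
  by rewrite add0r addr0.
elim: s1 s0 => [|y s1 IH] s0 /=; first by rewrite expr0 scale1r.
by rewrite -cat_rcons IH cat_rcons swap exprS mulN1r scalerN scaleNr.
Qed.

Lemma alternating_far o s1 s2 x : multilinear o -> alternating o -> o (x :: s1 ++ x :: s2) = 0.
Proof.
move=> ml al; have := alternating_front [:: x] s1 s2 x ml al => /= ->.
by rewrite (al [::]) scaler0.
Qed.

(** Induction on dim W, with [V0] kept apart as the space in which isotropic tuples are taken. For
    [v] anisotropic in W, tuples split into those in W' = W :&: v^perp and those [v :: s] with s in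
    W'. The latter are treated by [o (v :: _)] on the orthogonal of [v]: when y is a totally
    isotropic tuple there, [v] is a sum of two isotropic vectors orthogonal to y. *)
Lemma wedge_span k o (Mod : K -> Prop) (V0 M W : {vspace vT}) : multilinear o -> alternating o -> submodule Mod ->
  nondegv h V0 -> (M <= V0)%VS -> tot_isov h M -> (k <= \dim M)%N ->
  (forall s, size s = k -> {subset s <= V0} -> {in s &, forall x y, h x y = 0} -> Mod (o s)) ->
  nondegv h W -> (W <= V0)%VS ->
  forall s, size s = k -> {subset s <= W} -> Mod (o s).
Proof.
have [m] := ubnP (\dim W); elim: m k o V0 M W => // m IH k o V0 M W dW ml al mM ndV0 MV0 tM kM iso_Mod ndW WV0.
have [W0|W0] := eqVneq W 0%VS.
  move=> [|x s] ks sW; first exact: iso_Mod.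
  have /eqP -> : x == 0 by have := sW x (mem_head _ _); rewrite W0 memv0.
  by rewrite (multilinear0 [::]) //; case: mM.
have [v vW vv] := nonisotropic_ex hH sgK sg_neq ndW W0.
have vV0 := subvP WV0 _ vW.
have ndv := nondeg1 hH vv.
have ndW' : nondegv h (W :&: perp h <[v]>) by apply: (nondeg_perp hH).
have ndV' : nondegv h (V0 :&: perp h <[v]>) by apply: (nondeg_perp hH).
have dW' : (\dim (W :&: perp h <[v]>) < m)%N.
  by rewrite -ltnS -(dim_hyperplane hH ndW vW vv).
have inW' s : size s = k -> {subset s <= (W :&: perp h <[v]>)%VS} -> Mod (o s).
  by apply: (IH k o V0 M) => //; rewrite (subv_trans (capvSl _ _)).
have vW' s : (size s).+1 = k -> {subset s <= (W :&: perp h <[v]>)%VS} -> Mod (o (v :: s)).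
  case: k kM iso_Mod {inW'} => // k kM iso_Mod [sk].
  apply: (IH k (fun s => o (v :: s)) (V0 :&: perp h <[v]>)%VS (M :&: perp h <[v]>)%VS) => //.
  - by move=> s1 s2 a x y; apply: (ml (v :: s1)).
  - by move=> s1 s2 x; apply: (al (v :: s1)).
  - by rewrite capvS.
  - exact: (tot_isoS hH (capvSl _ _) tM).
  - have := dim_perp_ge h M <[v]>; rewrite dim_vline; move: kM; clear; case: (v != 0); lia.
  - move=> y yk yV' yiso.
    have yV0 : (<<y>> <= V0)%VS by apply/span_subvP => x /yV'/memv_capP[].
    have tC : tot_isov h <<y>>%VS.
      apply/span_subvP => x xy; rewrite memvE (perp_sym hH); apply/span_subvP => u uy.
      by rewrite (mem_perp1 hH) yiso.
    have dC : (\dim <<y>> < \dim M)%N by rewrite (leq_ltn_trans (dim_span y)) // yk.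
    have nvC : v \notin <<y>>%VS by apply: contra vv => vC; apply/eqP/(tot_isoP hH _ tC).
    have [z [zV0 zC zz zv]] := iso_off hH sgK sg_neq ndV0 vV0 nvC yV0 tC MV0 tM dC.
    have vC : v \in perp h <<y>>%VS.
      rewrite memvE (perp_sym hH); apply/span_subvP => u /yV'/memv_capP[_].
      by rewrite memvE.
    have inE u : u \in V0 -> u \in perp h <<y>>%VS -> u \in (V0 :&: perp h <<y>>)%VS.
      by rewrite memv_cap => -> ->.
    have [l [fE ff]] := iso_correct hH sgK sg_neq (inE _ zV0 zC) (inE _ vV0 vC) zz zv.
    have iso u : u \in V0 -> u \in perp h <<y>>%VS -> h u u = 0 -> Mod (o (u :: y)).
      move=> uV0 uC uu; have uy w : w \in y -> h u w = 0.
        by move=> wy; apply: (mem_perp hH _ _ uC); apply: memv_span.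
      apply: iso_Mod => [|w|w w']; rewrite ?inE /= ?yk //.
        by case/orP=> [/eqP->//|/yV'/memv_capP[]].
      case/orP=> [/eqP->|wy] /orP[/eqP->|w'y] //; first exact: uy.
        by apply: (form_orth hH); apply: uy.
      exact: yiso.
    have [fV0 fC] := memv_capP fE.
    have -> : v = (- l) *: z + (l *: z + v) by rewrite scaleNr addKr.
    by rewrite (ml [::]); apply: mM.2; apply: iso.
  - by rewrite capvS.
have split x : x \in W -> exists2 x', x' \in (W :&: perp h <[v]>)%VS & exists a, x = a *: v + x'.
  by move=> xW; have [x' x'W [a ->]] := hyperplane_proj hH vW vv xW; exists x' => //; exists a; rewrite addrC.
have vW'W s1 s2 : (size (s1 ++ s2)).+1 = k -> {subset s1 <= (W :&: perp h <[v]>)%VS} ->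
    {subset s2 <= W} -> Mod (o (v :: s1 ++ s2)).
  elim: s2 s1 => [|x s2 IHs] s1 sz s1W' s2W; first by rewrite cats0 in sz *; apply: vW'.
  have [x' x'W [a ->]] := split x (s2W x (mem_head _ _)).
  rewrite (ml (v :: s1)) alternating_far // scaler0 add0r /= -cat_rcons; apply: IHs.
  - by rewrite cat_rcons -sz !size_cat.
  - by move=> u; rewrite mem_rcons inE => /orP[/eqP->|/s1W'].
  - by move=> u us; apply: s2W; rewrite inE us orbT.
move=> s sk sW; suff W'W s1 s2 : size (s1 ++ s2) = k -> {subset s1 <= (W :&: perp h <[v]>)%VS} ->
    {subset s2 <= W} -> Mod (o (s1 ++ s2)) by apply: (W'W [::]).
elim: s2 s1 => [|x s2 IHs] s1 sz s1W' s2W; first by rewrite cats0 in sz *; apply: inW'.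
have [x' x'W [a ->]] := split x (s2W x (mem_head _ _)).
have s2W' : {subset s2 <= W} by move=> u us; apply: s2W; rewrite inE us orbT.
rewrite ml; apply: mM.2.
  rewrite (alternating_front [::]) //; apply: submoduleZ => //; apply: vW'W => //.
  by rewrite -sz !size_cat addnS.
rewrite -cat_rcons; apply: IHs => //; first by rewrite cat_rcons -sz !size_cat.
by move=> u; rewrite mem_rcons inE => /orP[/eqP->|/s1W'].
Qed.
End WedgeSpan.

(** * Coordinates *)

Section Transport.
Variables (F : fieldType) (sg : {rmorphism F -> F}) (V : lmodType F) (h : V -> V -> F).
Hypothesis hH : is_sigma_hermitian h sg.
Variables (vT : vectType F) (phi : vT -> V).
Hypothesis phi_lin : forall a x y, phi (a *: x + y) = a *: phi x + phi y.
Hypothesis phi_inj : forall x, phi x = 0 -> x = 0.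
Implicit Types (Z : {vspace vT}).

Definition pullback x y := h (phi x) (phi y).

Lemma pullback_hermitian : is_sigma_hermitian pullback sg.
Proof.
split=> [a u w v|u v]; last exact: (form_sym hH).
by rewrite /pullback phi_lin hH.1.
Qed.

Definition image Z : V -> Prop := fun v => exists2 x, x \in Z & phi x = v.

Lemma phi0 : phi 0 = 0.
Proof.
by have := phi_lin (-1) 0 0; rewrite scaler0 addr0 scaleN1r addNr.
Qed.

Lemma phiD x y : phi (x + y) = phi x + phi y.
Proof. by rewrite -[x]scale1r phi_lin !scale1r. Qed.

Lemma phiZ a x : phi (a *: x) = a *: phi x.
Proof. by rewrite -[_ *: x]addr0 phi_lin phi0 addr0. Qed.

Lemma phi_sum I (r : seq I) (P : pred I) (x : I -> vT) :
  phi (\sum_(i <- r | P i) x i) = \sum_(i <- r | P i) phi (x i).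
Proof. by apply: (big_morph phi); [exact: phiD|exact: phi0]. Qed.

Lemma phi_eq x y : phi x = phi y -> x = y.
Proof.
move=> e; apply/eqP; rewrite -subr_eq0; apply/eqP/phi_inj.
by rewrite -scaleN1r addrC phi_lin e scaleN1r addNr.
Qed.

Lemma image_sub Z1 Z2 : vsubset (image Z1) (image Z2) <-> (Z1 <= Z2)%VS.
Proof.
split=> [s|/subvP s v [x xZ <-]]; last by exists x => //; apply: s.
apply/subvP => x xZ; have [|y yZ /phi_eq <- //] := s (phi x).
by exists x.
Qed.

Lemma vsubset_anti (X Y : V -> Prop) : vsubset X Y -> vsubset Y X -> X = Y.
Proof.
by move=> s1 s2; apply: boolp.functional_extensionality_dep => v;
  apply: boolp.propositional_extensionality; split; auto.
Qed.

Lemma image_inj Z1 Z2 : image Z1 = image Z2 -> Z1 = Z2.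
Proof.
move=> e; apply/eqP; rewrite eqEsubv.
by apply/andP; split; apply/image_sub; rewrite e => v.
Qed.

Lemma has_dim_image Z : has_dim (image Z) (\dim Z).
Proof.
exists (fun i => phi (vbasis Z)`_i); split=> [c sum0 i|v].
  have /freeP : free (vbasis Z) by apply: basis_free (vbasisP Z).
  apply; apply: phi_inj; rewrite phi_sum -[RHS]sum0.
  by apply: eq_bigr => j _; rewrite phiZ.
split=> [[x xZ <-]|[c ->]].
  exists (fun i => coord (vbasis Z) i x); rewrite {1}(coord_vbasis xZ) phi_sum.
  by apply: eq_bigr => i _; rewrite phiZ.
exists (\sum_i c i *: (vbasis Z)`_i).
  by apply: rpred_sum => i _; rewrite rpredZ // vbasis_mem // mem_nth ?size_tuple.
by rewrite phi_sum; apply: eq_bigr => i _; rewrite phiZ.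
Qed.

Lemma has_dim_preimage X k : has_dim X k -> vsubset X (image fullv) ->
  exists Z, \dim Z = k /\ X = image Z.
Proof.
move=> [u [iu Xu]] sX.
have uX i : X (u i).
  apply/Xu; exists (fun j => (j == i)%:R); rewrite (bigD1 i) //= eqxx scale1r.
  by rewrite big1 ?addr0 // => j /negbTE->; rewrite scale0r.
have [x xP] : exists x : 'I_k -> vT, forall i, phi (x i) = u i.
  have [|x xP] := @boolp.choice 'I_k vT (fun i y => phi y = u i); last by exists x.
  by move=> i; have [y _ e] := sX _ (uX i); exists y.
pose s := [tuple x i | i < k].
have fs : free s.
  apply/freeP => c sum0 i; apply: (iu c).
  transitivity (phi (\sum_(j < k) c j *: s`_j)); last by rewrite sum0 phi0.
  by rewrite phi_sum; apply: eq_bigr => j _; rewrite phiZ -tnth_nth tnth_mktuple xP.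
exists <<s>>%VS; split; first by have := fs; rewrite /free size_tuple => /eqP.
apply: vsubset_anti => v.
  move=> /Xu[c ->]; exists (\sum_i c i *: x i).
    apply: rpred_sum => i _; rewrite rpredZ // memv_span //.
    by apply/tnthP; exists i; rewrite tnth_mktuple.
  by rewrite phi_sum; apply: eq_bigr => i _; rewrite phiZ xP.
move=> [y ys <-]; apply/Xu; exists (fun i => coord s i y).
rewrite {1}(coord_span ys) phi_sum; apply: eq_bigr => i _.
by rewrite phiZ -tnth_nth tnth_mktuple xP.
Qed.

Lemma tot_iso_image Z : tot_iso h (image Z) <-> tot_isov pullback Z.
Proof.
have hH' := pullback_hermitian; split=> [t|/(tot_isoP hH') t _ _ [x xZ <-] [y yZ <-]]; last exact: t.
by apply/(tot_isoP hH') => x y xZ yZ; apply: t; [exists x|exists y].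
Qed.

Lemma ksub_image k Z : ksubv pullback fullv k Z -> ksub h k (image Z).
Proof. by move=> /and3P[_ tZ /eqP <-]; split; [exact: has_dim_image|apply/tot_iso_image]. Qed.

Lemma ksub_preimage k X : ksub h k X -> vsubset X (image fullv) ->
  exists2 Z, ksubv pullback fullv k Z & X = image Z.
Proof.
move=> [hd tX] sX; have [Z [dZ XE]] := has_dim_preimage hd sX.
exists Z => //; rewrite XE in tX.
by rewrite /ksubv subvf dZ eqxx andbT; apply/tot_iso_image.
Qed.

Lemma geom_subspace_closed k P : geom_subspace h k P ->
  closed_under pullback true fullv k (fun Z => P (image Z)).
Proof.
have hH' := pullback_hermitian.
move=> [Pk PL] A x y a c dA Ax Ay /eqP hxy Az Px Py.
have [/eqP e|ne] := boolP ((A + <[x]>)%VS == (A + <[y]>)%VS).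
  have -> : (A + <[a *: x + c *: y]>)%VS = (A + <[x]>)%VS => //.
  have [_ _ /eqP d1] := and3P Ax; have [_ _ /eqP d2] := and3P Az.
  apply/eqP; rewrite eqEdim d1 d2 leqnn andbT sub_add1 addvSl rpredD ?rpredZ ?mem_add1 //.
  by rewrite e mem_add1.
have [_ tAx /eqP dAx] := and3P Ax; have [_ tAy /eqP dAy] := and3P Ay.
move: (tAx) (tAy); rewrite !(tot_iso_add1 hH') => /and3P[tA xx xA] /and3P[_ yy yA].
have ny : y \notin (A + <[x]>)%VS.
  apply: contra ne => yAx; rewrite eq_sym eqEdim dAx dAy leqnn andbT sub_add1 addvSl.
  exact: yAx.
have line Z : ksubv pullback fullv k Z -> (A <= Z)%VS -> (Z <= A + <[x]> + <[y]>)%VS ->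
    on_line h k (image A) (image (A + <[x]> + <[y]>)%VS) (image Z).
  by move=> kZ AZ ZY; split; [apply/ksub_image|split; apply/image_sub].
have xm : x \in (A + <[x]> + <[y]>)%VS by apply: (subvP (addvSl _ _)); apply: mem_add1.
apply: (PL (image A) (image (A + <[x]> + <[y]>)%VS) _ _ _ (image (A + <[x]>)%VS) (image (A + <[y]>)%VS)) => //.
- by apply/ksub_image; rewrite /ksubv subvf tA -dA /=.
- apply/ksub_image; rewrite /ksubv subvf !(tot_iso_add1 hH') tA xx yy xA /=.
  by rewrite (perpD hH') memv_cap yA (mem_perp1 hH') (form_orth hH' hxy) eqxx dim_add1 ny dAx addn1 /=.
- by apply/image_sub; apply: (subv_trans (addvSl _ _) (addvSl _ _)).
- by apply: line => //; rewrite addvSl.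
- apply: line; rewrite ?addvSl // sub_add1 mem_add1 andbT.
  exact: (subv_trans (addvSl _ _) (addvSl _ _)).
- by move/image_inj => e; rewrite e eqxx in ne.
- apply: line; rewrite ?addvSl // sub_add1 (subv_trans (addvSl _ _) (addvSl _ _)) /=.
  by rewrite rpredD ?rpredZ ?mem_add1.
Qed.
End Transport.

(** * Coordinates from the hyperbolic pairs and finitely many vectors of V_0 *)

Section Frame.
Variables (F : fieldType) (sg : {rmorphism F -> F}) (V : lmodType F) (h : V -> V -> F).
Variables (n : nat) (e f : 'I_n -> V).
Hypothesis sgK : forall a, sg (sg a) = a.
Hypothesis sg_neq : exists a, sg a <> a.
Hypothesis F4 : ~ exists t : 'I_4 -> F, bijective t.
Hypothesis hH : is_sigma_hermitian h sg.
Hypotheses (ee : forall i j, h (e i) (e j) = 0) (ff : forall i j, h (f i) (f j) = 0)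
  (ef : forall i j, h (e i) (f j) = (i == j)%:R).
Definition aniso_part v := forall i, h v (e i) = 0 /\ h v (f i) = 0.
Hypothesis aniso : forall v, aniso_part v -> h v v = 0 -> v = 0.
Local Notation hE := (formE hH).

Lemma frame_fe i j : h (f i) (e j) = (i == j)%:R.
Proof. by rewrite (form_sym hH) ef rmorph_nat eq_sym. Qed.

Lemma sum_delta (c : 'I_n -> F) j : \sum_i c i * (i == j)%:R = c j.
Proof.
rewrite (bigD1 j) //= eqxx mulr1 big1 ?addr0 // => i /negbTE->.
by rewrite mulr0.
Qed.

Lemma aniso_decomp v : exists2 w, aniso_part w &
  v = \sum_i h v (f i) *: e i + \sum_i h v (e i) *: f i + w.
Proof.
exists (v - (\sum_i h v (f i) *: e i + \sum_i h v (e i) *: f i)); last by rewrite addrC subrK.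
move=> j; rewrite !hE !(form_suml hH); split.
  rewrite [X in _ - (X + _)]big1 => [|i _]; last by rewrite hE ee mulr0.
  rewrite (eq_bigr (fun i => h v (e i) * (i == j)%:R)) => [|i _]; last by rewrite hE frame_fe.
  by rewrite sum_delta add0r subrr.
rewrite [X in _ - (_ + X)]big1 => [|i _]; last by rewrite hE ff mulr0.
rewrite (eq_bigr (fun i => h v (f i) * (i == j)%:R)) => [|i _]; last by rewrite hE ef.
by rewrite sum_delta addr0 subrr.
Qed.

Variables (d : nat) (b : 'I_d -> V).
Hypotheses (ib : lin_indep b) (bV0 : forall i, aniso_part (b i)).

Definition coords := ('rV[F]_n * 'rV[F]_n * 'rV[F]_d)%type.
Definition frame_map (x : coords) : V :=
  \sum_i x.1.1 0 i *: e i + \sum_i x.1.2 0 i *: f i + \sum_i x.2 0 i *: b i.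

Lemma frame_map_lin a x y : frame_map (a *: x + y) = a *: frame_map x + frame_map y.
Proof.
rewrite /frame_map !scalerDr !scaler_sumr addrACA [X in _ = X + _]addrACA.
by congr (_ + _ + _); rewrite -big_split /=; apply: eq_bigr => i _; rewrite !mxE scalerDl scalerA.
Qed.

Lemma frame_map_f x j : h (frame_map x) (f j) = x.1.1 0 j.
Proof.
rewrite /frame_map !hE !(form_suml hH) [X in _ + X + _]big1 => [|i _]; last by rewrite hE ff mulr0.
rewrite [X in _ + X]big1 => [|i _]; last by rewrite hE (bV0 i j).2 mulr0.
rewrite (eq_bigr (fun i => x.1.1 0 i * (i == j)%:R)) => [|i _]; last by rewrite hE ef.
by rewrite sum_delta !addr0.
Qed.

Lemma frame_map_e x j : h (frame_map x) (e j) = x.1.2 0 j.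
Proof.
rewrite /frame_map !hE !(form_suml hH) big1 => [|i _]; last by rewrite hE ee mulr0.
rewrite [X in _ + X]big1 => [|i _]; last by rewrite hE (bV0 i j).1 mulr0.
rewrite (eq_bigr (fun i => x.1.2 0 i * (i == j)%:R)) => [|i _]; last by rewrite hE frame_fe.
by rewrite sum_delta add0r addr0.
Qed.

Lemma aniso_b (x : 'rV[F]_d) : aniso_part (\sum_i x 0 i *: b i).
Proof.
by move=> j; rewrite !(form_suml hH) !big1 // => i _; rewrite hE ?(bV0 i j).1 ?(bV0 i j).2 mulr0.
Qed.

Lemma frame_map_inj x : frame_map x = 0 -> x = 0.
Proof.
move=> x0; have x1 j : x.1.1 0 j = 0 by rewrite -frame_map_f x0 hE.
have x2 j : x.1.2 0 j = 0 by rewrite -frame_map_e x0 hE.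
have x3 : forall j, x.2 0 j = 0.
  apply: ib; rewrite -[RHS]x0 /frame_map [X in _ = X + _ + _]big1 => [|i _]; last by rewrite x1 scale0r.
  by rewrite [X in _ = _ + X + _]big1 => [|i _]; rewrite ?addr0 ?add0r // x2 scale0r.
case: x {x0} x1 x2 x3 => [[x y] z] /= x1 x2 x3.
by congr ((_, _), _); apply/rowP => i; rewrite ?x1 ?x2 ?x3 mxE.
Qed.

Local Notation im := (image frame_map).
Local Notation g := (pullback h frame_map).

Lemma image_full_comb a u v : im fullv u -> im fullv v -> im fullv (a *: u + v).
Proof.
by move=> [x _ <-] [y _ <-]; exists (a *: x + y); rewrite ?memvf ?frame_map_lin.
Qed.

Lemma image_full0 : im fullv 0.
Proof. by exists 0; rewrite ?memvf // (phi0 frame_map_lin). Qed.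

Lemma image_full_sum I (r : seq I) (P : pred I) (c : I -> F) (u : I -> V) :
  (forall i, im fullv (u i)) -> im fullv (\sum_(i <- r | P i) c i *: u i).
Proof.
move=> H; apply: big_ind => [|x y Hx Hy|i _]; first exact: image_full0.
  by rewrite -[x]scale1r; apply: image_full_comb.
by rewrite -[_ *: _]addr0; apply: image_full_comb => //; apply: image_full0.
Qed.

Lemma sum_delta_vec (m : nat) (u : 'I_m -> V) j : \sum_i (delta_mx 0 j : 'rV[F]_m) 0 i *: u i = u j.
Proof.
rewrite (bigD1 j) //= mxE !eqxx scale1r big1 ?addr0 // => i /negbTE ij.
by rewrite mxE ij andbF scale0r.
Qed.

Lemma sum_zero_vec (m : nat) (u : 'I_m -> V) : \sum_i (0 : 'rV[F]_m) 0 i *: u i = 0.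
Proof. by rewrite big1 // => i _; rewrite mxE scale0r. Qed.

Lemma image_full_e j : im fullv (e j).
Proof.
exists ((delta_mx 0 j, 0), 0); rewrite ?memvf // /frame_map /=.
by rewrite sum_delta_vec !sum_zero_vec !addr0.
Qed.

Lemma image_full_f j : im fullv (f j).
Proof.
exists ((0, delta_mx 0 j), 0); rewrite ?memvf // /frame_map /=.
by rewrite sum_delta_vec !sum_zero_vec addr0 add0r.
Qed.

Lemma image_full_b j : im fullv (b j).
Proof.
exists ((0, 0), delta_mx 0 j); rewrite ?memvf // /frame_map /=.
by rewrite sum_delta_vec !sum_zero_vec !add0r.
Qed.

Lemma image_full_frame (c c' : 'I_n -> F) w : im fullv w ->
  im fullv (\sum_i c i *: e i + \sum_i c' i *: f i + w).
Proof.
move=> imw; rewrite -[X in X + w]scale1r; apply: image_full_comb => //.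
rewrite -[X in X + _]scale1r; apply: image_full_comb; apply: image_full_sum.
  exact: image_full_e.
exact: image_full_f.
Qed.

Lemma dim_coords : \dim (fullv : {vspace coords}) = (2 * n + d)%N.
Proof. rewrite dimvf (_ : dim coords = (1 * n + 1 * n + 1 * d)%N) //; clear; lia. Qed.

(** The span of the [e i] is maximal: a vector orthogonal to it is u + w with u in it and w in V_0,
    of norm [h w w], so if isotropic it has w = 0. *)
Lemma frame_utype : utype g fullv n d.
Proof.
have gH := pullback_hermitian hH frame_map_lin.
have ie : lin_indep e.
  move=> c sum0 i; rewrite -(sum_delta c) -[RHS](form_0l hH (f i)) -sum0 (form_suml hH).
  by apply: eq_bigr => j _; rewrite hE ef.
split; [|exact: dim_coords|].
  rewrite /nondegv capfv -subv0; apply/subvP => x /(mem_perp gH) xp; rewrite memv0.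
  have x1 y : im fullv y -> h (frame_map x) y = 0.
    by move=> [z _ <-]; apply: xp; apply: memvf.
  apply/eqP/frame_map_inj/aniso; last by apply: x1; exists x; rewrite ?memvf.
  by move=> i; split; apply: x1; [apply: image_full_e|apply: image_full_f].
have [||M [dM ME]] := has_dim_preimage frame_map_lin (X := fspan e) (k := n).
- by exists e.
- by move=> v [c ->]; apply: image_full_sum; exact: image_full_e.
exists M => //; split; first exact: subvf.
  apply/(tot_iso_image hH frame_map_lin) => u v; rewrite -ME => -[c ->] [c' ->].
  rewrite (form_suml hH) big1 // => i _; rewrite hE (form_sym hH) (form_suml hH) big1 ?rmorph0 ?mulr0 // => j _.
  by rewrite hE ee mulr0.
move=> x _ /(mem_perp gH) xM xx.
have xe i : x.1.2 0 i = 0.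
  rewrite -frame_map_e; have [y yM <-] : im M (e i); last exact: xM.
  by rewrite -ME; exists (fun j => (j == i)%:R); rewrite (bigD1 i) //= eqxx scale1r big1 ?addr0 // => j /negbTE->; rewrite scale0r.
pose w := \sum_i x.2 0 i *: b i; pose u := \sum_i x.1.1 0 i *: e i.
have xE : frame_map x = u + w.
  by rewrite /frame_map [X in _ + X + _]big1 => [|i _]; rewrite ?addr0 // xe scale0r.
have wV0 : aniso_part w := aniso_b x.2.
have we : h w u = 0.
  by rewrite (form_sym hH) (form_suml hH) big1 ?rmorph0 // => i _; rewrite hE (form_orth hH (wV0 i).1) mulr0.
have uu : h u u = 0.
  rewrite {1}/u (form_suml hH) big1 // => i _; rewrite hE (form_sym hH) (form_suml hH) big1 ?rmorph0 ?mulr0 // => j _.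
  by rewrite hE ee mulr0.
have w0 : w = 0.
  apply: aniso => //; move: xx; rewrite /pullback xE !(form_Dl hH) !(form_Dr hH) uu we.
  by rewrite (form_orth hH we) !add0r.
have [y yM] : im M (frame_map x) by rewrite -ME xE w0 addr0; exists (fun i => x.1.1 0 i).
by move=> /(phi_eq frame_map_lin frame_map_inj) <-.
Qed.

(** [b] is any finite independent family in V_0, not necessarily a basis, so this also supplies the
    finite pieces for infinite d. *)
Lemma frame_generation k : (1 <= k < n)%N -> exists m (t : 'I_m -> (V -> Prop)),
  [/\ (m <= 'C(2 * n + d, k))%N, forall i, ksub h k (t i) &
    forall P, geom_subspace h k P -> (forall i, P (t i)) ->
    forall X, ksub h k X -> vsubset X (im fullv) -> P X].
Proof.
move=> /andP[k1 kn]; have gH := pullback_hermitian hH frame_map_lin.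
have [L [kL sL gL]] := ordinary_generation gH sgK sg_neq (fixed_elem sgK sg_neq F4) frame_utype kn.
exists (size L), (fun i => im (tnth (in_tuple L) i)); split=> //.
  by move=> i; apply: (ksub_image hH frame_map_lin frame_map_inj); apply: (allP kL); apply: mem_tnth.
move=> P gP Pt X kX sX; have [Z kZ ->] := ksub_preimage hH frame_map_lin kX sX.
apply: (gL _ (geom_subspace_closed hH frame_map_lin frame_map_inj gP)) => // Y YL.
have lt : (index Y L < size L)%N by rewrite index_mem.
by have := Pt (Ordinal lt); rewrite (tnth_nth Y) /= nth_index.
Qed.
End Frame.

(** * The Grassmann embedding and the lower bound *)

Section Plucker.
Import mathcomp.classical.functions.
Variables (F : fieldType) (sg : {rmorphism F -> F}) (V : lmodType F) (h : V -> V -> F).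
Hypothesis hH : is_sigma_hermitian h sg.
Local Notation hE := (formE hH).

Definition fcons (T : Type) k (z : T) (u : 'I_k -> T) : 'I_k.+1 -> T :=
  fun i => if unlift ord0 i is Some j then u j else z.

Lemma fcons0 (T : Type) k (z : T) (u : 'I_k -> T) : fcons z u ord0 = z.
Proof. by rewrite /fcons unlift_none. Qed.

Lemma fconsS (T : Type) k (z : T) (u : 'I_k -> T) j : fcons z u (lift ord0 j) = u j.
Proof. by rewrite /fcons liftK. Qed.

(* The Grassmann coordinates of a k-tuple [u]: its exterior product, seen as the function of
   [w] obtained by pairing it with the exterior product of [w]. *)
Definition grassmann k (u : 'I_k -> V) : ('I_k -> V) -> F^o :=
  fun w => \det (\matrix_(i, j) h (u i) (w j)).

Lemma grassmann_comb k (B : 'M_k) (u u' : 'I_k -> V) :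
  (forall i, u' i = \sum_l B i l *: u l) -> grassmann u' = \det B *: grassmann u.
Proof.
move=> uE; apply: boolp.functional_extensionality_dep => w.
rewrite /grassmann; transitivity (\det (B *m \matrix_(i, j) h (u i) (w j))); last by rewrite det_mulmx.
congr (\det _); apply/matrixP => i j; rewrite !mxE uE (form_suml hH).
by apply: eq_bigr => l _; rewrite mxE hE.
Qed.

Lemma grassmann_update k (i0 : 'I_k) a c (u u1 u2 : 'I_k -> V) :
  u i0 = a *: u1 i0 + c *: u2 i0 -> (forall i, i != i0 -> u1 i = u i /\ u2 i = u i) ->
  grassmann u = a *: grassmann u1 + c *: grassmann u2.
Proof.
move=> ui0 ui; apply: boolp.functional_extensionality_dep => w; rewrite /grassmann.
apply: (determinant_multilinear (i0 := i0)).
- by apply/rowP => j; rewrite !mxE ui0 !hE.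
- by apply/matrixP => i j; rewrite !mxE (ui _ _).1 // eq_sym neq_lift.
- by apply/matrixP => i j; rewrite !mxE (ui _ _).2 // eq_sym neq_lift.
Qed.

Lemma grassmann_cons k a c x y (u : 'I_k -> V) :
  grassmann (fcons (a *: x + c *: y) u) = a *: grassmann (fcons x u) + c *: grassmann (fcons y u).
Proof.
apply: (grassmann_update (i0 := ord0)) => [|i]; first by rewrite !fcons0.
by case: (unliftP ord0 i) => [j ->|->]; rewrite ?eqxx // !fconsS.
Qed.

Lemma grassmann_alternate k (i1 i2 : 'I_k) (u : 'I_k -> V) : i1 != i2 -> u i1 = u i2 ->
  grassmann u = 0.
Proof.
move=> i12 e; apply: boolp.functional_extensionality_dep => w.
by apply: (determinant_alternate i12) => j; rewrite !mxE e.
Qed.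

Lemma basis_tuple (T : vectType F) (A : {vspace T}) k : \dim A = k ->
  exists u : 'I_k -> T, (forall i, u i \in A) /\
    forall x, x \in A -> exists c : 'I_k -> F, x = \sum_i c i *: u i.
Proof.
move=> <-; exists (fun i => (vbasis A)`_i); split=> [i|x xA].
  by rewrite vbasis_mem // mem_nth ?size_tuple.
by exists (fun i => coord (vbasis A) i x); apply: coord_vbasis.
Qed.

Section Generated.
Variables (k : nat) (S : (V -> Prop) -> Prop).
Hypothesis genS : generates h k.+1 S.
Variable uS : {Z | S Z} -> 'I_k.+1 -> V.
Hypothesis uSP : forall Z v, sval Z v -> fspan (uS Z) v.

Definition wedges (v : ('I_k.+1 -> V) -> F^o) := exists Z, v = grassmann (uS Z).

Definition good_subspace (Z : V -> Prop) := ksub h k.+1 Z /\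
  forall u, (forall i, Z (u i)) -> spanned wedges (grassmann u).

(** If Z1 = A + <z1> and Z2 = A + <z2>, a third point of the line is A + <a z1 + c z2> modulo A, and
    its wedge is the same combination of theirs. Any other tuple in it changes the wedge by a
    determinant. *)
Lemma good_geom_subspace : geom_subspace h k.+1 good_subspace.
Proof.
split=> [Z []//|X Y [dX _] [dY _] XY Z1 Z2 [[dZ1 _] [XZ1 Z1Y]] [[dZ2 _] [XZ2 Z2Y]] nZ [_ g1] [_ g2] Z [kZ [XZ ZY]]].
split=> // u uZ; have [dZ _] := kZ; have [y [iy yY]] := dY.
(* Y is replaced by its coordinate space, where dimensions of subspaces can be compared. *)
pose vT := 'rV[F]_k.+2; pose phi (x : vT) := \sum_i x 0 i *: y i.
have phi_lin a x x' : phi (a *: x + x') = a *: phi x + phi x'.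
  rewrite /phi scaler_sumr -big_split /=; apply: eq_bigr => i _.
  by rewrite !mxE scalerDl scalerA.
have phi_inj x : phi x = 0 -> x = 0.
  by move=> x0; apply/rowP => i; rewrite mxE; apply: (iy (fun i => x 0 i)).
have inY (T : V -> Prop) : vsubset T Y -> vsubset T (image phi fullv).
  move=> TY v /TY/yY[c ->]; exists (\row_i c i); rewrite ?memvf //.
  by apply: eq_bigr => i _; rewrite mxE.
have [A [dA XA]] := has_dim_preimage phi_lin dX (inY _ XY).
have [C1 [dC1 ZC1]] := has_dim_preimage phi_lin dZ1 (inY _ Z1Y).
have [C2 [dC2 ZC2]] := has_dim_preimage phi_lin dZ2 (inY _ Z2Y).
have [C [dC ZC]] := has_dim_preimage phi_lin dZ (inY _ ZY).
have subA D T : X = image phi A -> T = image phi D -> vsubset X T -> (A <= D)%VS.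
  by move=> -> -> /(image_sub phi_lin phi_inj).
have AC1 := subA _ _ XA ZC1 XZ1; have AC2 := subA _ _ XA ZC2 XZ2; have AC := subA _ _ XA ZC XZ.
rewrite /= in dA.
have [z1 [z1C nz1 C1E]] := split_add1 AC1 (etrans dC1 (congr1 succn (esym dA))).
have [z2 [z2C nz2 C2E]] := split_add1 AC2 (etrans dC2 (congr1 succn (esym dA))).
have [z [zC nz CE]] := split_add1 AC (etrans dC (congr1 succn (esym dA))).
have nz2' : z2 \notin (A + <[z1]>)%VS.
  apply/negP => z2A; apply: nZ; rewrite ZC1 ZC2; congr (image phi _); apply/esym/eqP.
  by rewrite eqEdim dC1 dC2 leqnn andbT C2E sub_add1 C1E addvSl.
have full : (A + <[z1]> + <[z2]>)%VS = fullv.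
  by apply/eqP; rewrite eqEdim subvf dimvf (_ : dim vT = (1 * k.+2)%N) // mul1n !dim_add1 nz2' nz1 dA /= !addn1 leqnn.
have : z \in (A + <[z1]> + <[z2]>)%VS by rewrite full memvf.
case/mem_add1P => _ /mem_add1P[a0 a0A [a ->]] [c zE].
have [s [sA sP]] := basis_tuple dA.
have spanP x : x \in C -> exists (d : F) (g : 'I_k -> F), x = d *: (a *: z1 + c *: z2) + \sum_j g j *: s j.
  rewrite CE => /mem_add1P[x' x'A [d ->]].
  have /sP[g gE] : x' + d *: a0 \in A by rewrite rpredD ?rpredZ.
  exists d, g; rewrite -gE zE -[a0 + _ + _]addrA scalerDr.
  by rewrite [RHS]addrC -addrA.
have wedge1 (D : {vspace vT}) (T : V -> Prop) x : T = image phi D -> (forall u, (forall i, T (u i)) -> spanned wedges (grassmann u)) ->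
    (A <= D)%VS -> x \in D -> spanned wedges (grassmann (fcons (phi x) (phi \o s))).
  move=> TE gT AD xD; apply: gT => i; rewrite TE /fcons.
  case: unliftP => [j _|_]; last by exists x.
  by exists (s j) => //; apply: (subvP AD).
have base : spanned wedges (grassmann (fcons (phi (a *: z1 + c *: z2)) (phi \o s))).
  rewrite (phi_lin a z1) (phiZ phi_lin) grassmann_cons; have mS := submodule_spanned wedges.
  apply: mS.2; first exact: (wedge1 _ _ _ ZC1 g1 AC1 z1C).
  by apply: (submoduleZ c mS); apply: (wedge1 _ _ _ ZC2 g2 AC2 z2C).
have [B BP] : exists B : 'M[F]_k.+1, forall i, u i = \sum_l B i l *: fcons (phi (a *: z1 + c *: z2)) (phi \o s) l.
  have [|Bf BfP] := @boolp.choice 'I_k.+1 ('I_k.+1 -> F) (fun i r => u i = \sum_l r l *: fcons (phi (a *: z1 + c *: z2)) (phi \o s) l).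
    move=> i; have := uZ i; rewrite ZC => -[x xC <-]; have [d [g ->]] := spanP x xC.
    exists (fcons d g); rewrite big_ord_recl !fcons0 (phiD phi_lin) (phiZ phi_lin) (phi_sum phi_lin).
    by congr (_ + _); apply: eq_bigr => j _; rewrite !fconsS (phiZ phi_lin).
  by exists (\matrix_(i, j) Bf i j) => i; rewrite BfP; apply: eq_bigr => l _; rewrite mxE.
by rewrite (grassmann_comb BP); apply: (submoduleZ _ (submodule_spanned wedges)).
Qed.

Lemma grassmann_generated Z u : ksub h k.+1 Z -> (forall i, Z (u i)) -> spanned wedges (grassmann u).
Proof.
move=> kZ uZ; have [_ gS] := genS; have [kS _] := genS.
have [|_] := gS Z kZ _ good_geom_subspace; last by apply.
move=> T ST; split=> [|v vT]; first exact: kS.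
pose ZT : {Z | S Z} := exist _ T ST.
have [B BP] : exists B : 'M[F]_k.+1, forall i, v i = \sum_l B i l *: uS ZT l.
  have [|Bf BfP] := @boolp.choice 'I_k.+1 ('I_k.+1 -> F) (fun i r => v i = \sum_l r l *: uS ZT l).
    by move=> i; have [|c ->] := @uSP ZT (v i); [exact: vT|exists c].
  by exists (\matrix_(i, j) Bf i j) => i; rewrite BfP; apply: eq_bigr => l _; rewrite mxE.
rewrite (grassmann_comb BP); apply: (submoduleZ _ (submodule_spanned wedges)).
by apply: spanned_mem; exists ZT.
Qed.
End Generated.

(** The wedges of the members of S span all wedges of totally isotropic subspaces, hence the
    independent family [w]; [exchange_injection] then sends its index set into S. *)
Lemma generates_lower_bound k S (B : Type) (w : B -> ('I_k.+1 -> V) -> F^o) : generates h k.+1 S ->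
  independent w ->
  (forall M : (('I_k.+1 -> V) -> F^o) -> Prop, submodule M ->
     (forall Z u, ksub h k.+1 Z -> (forall i, Z (u i)) -> M (grassmann u)) -> forall x, M (w x)) ->
  exists t : B -> V -> Prop, injective t /\ forall x, S (t x).
Proof.
move=> gS iw wM.
have [uS uSP] : exists uS : {Z | S Z} -> 'I_k.+1 -> V, forall Z v, sval Z v -> fspan (uS Z) v.
  have [|uS uSP] := @boolp.choice {Z | S Z} ('I_k.+1 -> V) (fun Z u => forall v, sval Z v -> fspan u v).
    by move=> [Z SZ]; have [[u [_ uZ]] _] := gS.1 Z SZ; exists u => v /uZ.
  by exists uS.
have [x|t tI] := exchange_injection iw (s := fun Z => grassmann (uS Z)).
  apply: wM => [|Z u kZ uZ]; first exact: submodule_spanned.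
  exact: (grassmann_generated gS uSP kZ uZ).
exists (fun x => sval (t x)); split=> [x y e|x]; last exact: svalP.
apply: tI; case: (t x) (t y) e => [Z SZ] [Z' SZ'] /= e; subst Z'.
by rewrite (boolp.Prop_irrelevance SZ SZ').
Qed.
End Plucker.

(** * Independent families of wedges *)

Section LowerBounds.
Import mathcomp.classical.functions.
Variables (F : fieldType) (sg : {rmorphism F -> F}) (V : lmodType F) (h : V -> V -> F).
Variables (n : nat) (e f : 'I_n -> V).
Hypothesis sgK : forall a, sg (sg a) = a.
Hypothesis sg_neq : exists a, sg a <> a.
Hypothesis hH : is_sigma_hermitian h sg.
Hypothesis ndh : nondeg_form h.
Hypotheses (ee : forall i j, h (e i) (e j) = 0) (ff : forall i j, h (f i) (f j) = 0)
  (ef : forall i j, h (e i) (f j) = (i == j)%:R).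
Hypothesis aniso : forall v, aniso_part h e f v -> h v v = 0 -> v = 0.
Local Notation hE := (formE hH).
Variable k : nat.
Hypothesis kn : (k.+1 < n)%N.

Let wd (j : 'I_k) : 'I_n := widen_ord (ltnW (ltnW kn)) j.

(** The matrix is triangular, with diagonal [h v y], 1, ..., 1. *)
Lemma grassmann_flag v y : (forall j, h v (f (wd j)) = 0) ->
  grassmann h (fcons v (e \o wd)) (fcons y (f \o wd)) = h v y.
Proof.
move=> vf; rewrite /grassmann det_trig.
  rewrite big_ord_recl mxE !fcons0 big1 ?mulr1 // => j _.
  by rewrite mxE !fconsS /= ef eqxx.
apply/is_trig_mxP => i j ij; rewrite mxE.
have [j' jE|j0] := unliftP ord0 j; last by rewrite j0 in ij.
rewrite jE fconsS /=; have [i' iE|i0] := unliftP ord0 i; last by rewrite i0 fcons0.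
rewrite iE fconsS /= ef; case: eqVneq => // /(congr1 val) /= ij'.
by move: ij; rewrite iE jE /= !/bump /= !add1n ltnS ij' ltnn.
Qed.

Lemma ksub_flag v : v <> 0 -> h v v = 0 -> (forall j, h v (e (wd j)) = 0) ->
  (forall j, h v (f (wd j)) = 0) -> ksub h k.+1 (fspan (fcons v (e \o wd))).
Proof.
move=> v0 vv ve vf.
have orth i j : h (fcons v (e \o wd) i) (fcons v (e \o wd) j) = 0.
  have [i' ->|->] := unliftP ord0 i; have [j' ->|->] := unliftP ord0 j; rewrite ?fconsS ?fcons0 //=.
  exact: (form_orth hH).
split; last first.
  move=> _ _ [c ->] [c' ->]; rewrite (form_suml hH) big1 // => i _.
  rewrite hE (form_sym hH) (form_suml hH) big1 ?rmorph0 ?mulr0 // => j _.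
  by rewrite hE orth mulr0.
exists (fcons v (e \o wd)); split=> // c sum0.
have cS j : c (lift ord0 j) = 0.
  have := form_0l hH (f (wd j)); rewrite -sum0 (form_suml hH) big_ord_recl hE fcons0 vf mulr0 add0r.
  rewrite (bigD1 j) //= big1 => [|l lj]; rewrite hE fconsS /= ef.
    by rewrite eqxx mulr1 addr0.
  by rewrite (_ : wd l == wd j = false) ?mulr0 //; apply: contra_neqF lj => /eqP/(congr1 val)/= /val_inj.
have c0 : c ord0 = 0.
  move: sum0; rewrite big_ord_recl big1 ?addr0 => [|j _]; last by rewrite cS scale0r.
  rewrite fcons0 => cv; apply/eqP/negPn/negP => c0; apply: v0.
  by rewrite -[v](scalerK c0) cv scaler0.
by move=> i; have [j ->|->] := unliftP ord0 i.
Qed.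

Lemma infinite_lower_bound S (B : Type) (b : B -> V) : generates h k.+1 S ->
  (forall x, aniso_part h e f (b x)) -> independent b ->
  exists g : B -> V -> Prop, injective g /\ forall x, S (g x).
Proof.
move=> gS bV0 ib; apply: (generates_lower_bound hH (w := fun x => grassmann h (fcons (b x) (e \o wd))) gS).
  move=> m t c tI sum0; apply: (ib m t c tI); apply: ndh => y.
  have := congr1 (fun w => w (fcons y (f \o wd))) sum0 => /= {}sum0.
  rewrite (form_suml hH) -[RHS]sum0 fct_sumE; apply: eq_bigr => i _; rewrite hE.
  by rewrite -(grassmann_flag y (v := b (t i))) // => j; rewrite (bV0 (t i) (wd j)).2.
move=> M mM Mk x; pose i0 : 'I_n := Ordinal (ltnW kn).
have i0wd j : (wd j == i0) = false by apply/eqP => /(congr1 val) /= jk; have := ltn_ord j; rewrite jk ltnn.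
have iE j : (i0 == wd j) = false by rewrite eq_sym i0wd.
have fe i j : h (f i) (e j) = (i == j)%:R by rewrite (form_sym hH) ef rmorph_nat eq_sym.
have Mv v : v <> 0 -> h v v = 0 -> (forall j, h v (e (wd j)) = 0) ->
    (forall j, h v (f (wd j)) = 0) -> M (grassmann h (fcons v (e \o wd))).
  move=> v0 vv ve vf; apply: (Mk _ _ (ksub_flag v0 vv ve vf)) => i.
  exists (fun j => (j == i)%:R); rewrite (bigD1 i) //= eqxx scale1r big1 ?addr0 // => j /negbTE->.
  by rewrite scale0r.
have sN : sg (- h (b x) (b x)) = - h (b x) (b x) by rewrite rmorphN /= (form_fixed hH).
have [a aE] := trace_surj sgK sg_neq sN.
have e0 : e i0 <> 0 by move=> e0; have /eqP := ef i0 i0; rewrite e0 hE eqxx eq_sym oner_eq0.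
have f0 : f i0 <> 0 by move=> f0; have /eqP := ef i0 i0; rewrite f0 hE eqxx eq_sym oner_eq0.
pose v := a *: e i0 + f i0 + b x.
have be j : h (b x) (e j) = 0 := (bV0 x j).1.
have bf j : h (b x) (f j) = 0 := (bV0 x j).2.
have vE : b x = 1 *: v + (-1) *: (a *: e i0 + 1 *: f i0).
  by rewrite /v scale1r scaleN1r scale1r [_ + b x]addrC addrK.
have ve j : h v (e j) = (i0 == j)%:R by rewrite /v !hE ee fe be mulr0 add0r addr0.
have vf j : h v (f j) = a * (i0 == j)%:R by rewrite /v !hE ff ef bf !addr0.
have vb : h v (b x) = h (b x) (b x).
  by rewrite /v !hE (form_orth hH (be _)) (form_orth hH (bf _)) mulr0 !add0r.
have vv : h v v = 0.
  have vdef : v = a *: e i0 + f i0 + b x by []; clearbody v.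
  by rewrite {2}vdef !hE ve vf vb eqxx !mulr1 [sg a + a]addrC aE addNr.
clearbody v; rewrite vE !(grassmann_cons hH); have MZ c u : M u -> M (c *: u) by apply: submoduleZ.
have MD u v' : M u -> M v' -> M (u + v') by apply: submoduleD.
apply: (MD); apply: (MZ).
  apply: Mv => [v0||j|j] //; last by rewrite vf iE mulr0.
    by have /eqP := ve i0; rewrite v0 hE eqxx eq_sym oner_eq0.
  by rewrite ve iE.
apply: (MD); apply: (MZ); apply: (Mv) => // j; by rewrite ?ef ?fe ?iE.
Qed.

Section Finite.
Variables (d : nat) (b : 'I_d -> V).
Hypotheses (ib : lin_indep b) (bV0 : forall i, aniso_part h e f (b i)).
Let phi := frame_map e f b.
Hypothesis phi_onto : forall v, exists x, phi x = v.
Let N := (2 * n + d)%N.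
Let phi_lin : forall a x y, phi (a *: x + y) = a *: phi x + phi y.
Proof. exact: frame_map_lin. Qed.
Let phi_inj : forall x, phi x = 0 -> x = 0.
Proof. exact: (frame_map_inj hH ee ff ef ib bV0). Qed.

Lemma wedge_in_span (M : (('I_k.+1 -> V) -> F^o) -> Prop) (u : 'I_k.+1 -> V) : submodule M ->
  (forall Z u, ksub h k.+1 Z -> (forall i, Z (u i)) -> M (grassmann h u)) -> M (grassmann h u).
Proof.
move=> mM Mk; pose vT := coords F n d; pose g := pullback h phi.
have gH : is_sigma_hermitian g sg := pullback_hermitian hH phi_lin.
have [ndf _ [L [_ tL _] dL]] := frame_utype hH ee ff ef aniso ib bV0.
(* The value 0 at other lengths makes [o] multilinear and alternating on all lists, as [wedge_span]
   demands. *)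
pose o (s : seq vT) := if size s == k.+1 then grassmann h (fun i : 'I_k.+1 => phi (nth 0 s i)) else 0.
have nth_mid s1 s2 x (y : vT) i : i != size s1 -> nth 0 (s1 ++ x :: s2) i = nth 0 (s1 ++ y :: s2) i.
  rewrite !nth_cat; case: ltngtP => // lt _.
  by case e1 : (i - size s1)%N => //; move: lt; rewrite -subn_gt0 e1.
have ml : multilinear o.
  move=> s1 s2 a x y; rewrite /o !size_cat /=; case: eqP => sz; last by rewrite scaler0 addr0.
  have lt : (size s1 < k.+1)%N by rewrite -sz -addSnnS leq_addr.
  rewrite -[X in _ = _ + X]scale1r; apply: (grassmann_update hH (i0 := Ordinal lt)) => [|i ni] /=.
    by rewrite !nth_cat ltnn subnn /= phi_lin scale1r.
  by split; congr phi; apply: nth_mid; apply: contra ni => /eqP e1; apply/eqP/val_inj.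
have al : alternating o.
  move=> s1 s2 x; rewrite /o size_cat /=; case: eqP => // sz.
  have lt2 : ((size s1).+1 < k.+1)%N by rewrite -sz !addnS ltnS ltnS leq_addr.
  apply: (@grassmann_alternate _ _ h _ (Ordinal (ltnW lt2)) (Ordinal lt2)).
    by rewrite -val_eqE /= neq_ltn ltnSn.
  by rewrite /= !nth_cat ltnn subnn ltnNge leqnSn /= subSnn.
(* A totally isotropic tuple may be dependent; its span is enlarged to a (k+1)-subspace so that [Mk]
   applies. *)
have extend Z : tot_isov g Z -> (\dim Z <= k.+1)%N ->
    exists Z', (Z <= Z')%VS /\ ksubv g fullv k.+1 Z'.
  have [m] := ubnP (k.+1 - \dim Z); elim: m Z => // m IH Z lm tZ dZ.
  have [eq|lt] := eqVneq (\dim Z) k.+1.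
    by exists Z; rewrite /ksubv subvf tZ eq eqxx.
  have ltZ : (\dim Z < k.+1)%N by rewrite ltn_neqAle lt.
  have [|x [xL xZ nx]] := tot_iso_extend gH tL tZ; first by rewrite dL (ltn_trans ltZ kn).
  have dZx : \dim (Z + <[x]>) = (\dim Z).+1 by rewrite dim_add1 nx addn1.
  have [|||Z' [ZZ' kZ']] := IH (Z + <[x]>)%VS.
  - by rewrite dZx; move: lm ltZ; clear; lia.
  - by rewrite (tot_iso_add1 gH) tZ xZ andbT /=; apply/eqP/(tot_isoP gH _ tL).
  - by rewrite dZx.
  by exists Z'; split=> //; apply: subv_trans ZZ'; apply: addvSl.
have [x xP] : exists x : 'I_k.+1 -> vT, forall i, phi (x i) = u i.
  have [|x xP] := @boolp.choice 'I_k.+1 vT (fun i y => phi y = u i); last by exists x.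
  by move=> i; have [y e1] := phi_onto (u i); exists y.
have <- : o (codom x) = grassmann h u.
  rewrite /o size_codom card_ord eqxx; congr (grassmann h _).
  by apply: boolp.functional_extensionality_dep => i; rewrite codomE (nth_map i) ?size_enum_ord // nth_ord_enum xP.
apply: (wedge_span (k := k.+1) gH sgK sg_neq ml al mM ndf (subvf L) tL _ _ ndf (subvf _)).
- by rewrite dL ltnW.
- move=> s ks _ siso; have ts : tot_isov g <<s>>%VS.
    apply/span_subvP => y ys; rewrite memvE (perp_sym gH); apply/span_subvP => z zs.
    by rewrite (mem_perp1 gH) siso.
  have [|Z [sZ kZ]] := extend _ ts; first by rewrite (leq_trans (dim_span _)) ?ks.
  rewrite /o ks eqxx; apply: (Mk _ _ (ksub_image hH phi_lin phi_inj kZ)) => i.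
  by exists (nth 0 s i) => //; apply: (subvP sZ); apply: memv_span; apply: mem_nth; rewrite ks.
- by rewrite size_codom card_ord.
- by move=> y _; apply: memvf.
Qed.

(** Non-degeneracy makes the Gram matrix of a basis invertible. The dual vectors use the conjugates
    of the entries of its inverse, because [h] is semilinear on the right. *)
Lemma dual_family : exists a w : 'I_N -> V, forall i j, h (a i) (w j) = (i == j)%:R.
Proof.
have dimN : \dim (fullv : {vspace coords F n d}) = N := dim_coords F n d.
have [a0 [_ aP]] := basis_tuple dimN; pose a i := phi (a0 i).
have [s [_ sP]] := basis_tuple dimN.
pose G : 'M[F]_N := \matrix_(i, j) h (a i) (a j).
have fa : forall c : 'I_N -> F, \sum_i c i *: a i = 0 -> forall i, c i = 0.
  move=> c sum0; have free_a : free [tuple a0 i | i < N].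
    rewrite /free size_tuple eqn_leq; apply/andP; split.
      by rewrite (leq_trans (dim_span _)) ?size_tuple.
    apply: (@leq_trans (\dim (fullv : {vspace coords F n d}))); first by rewrite dimN.
    apply: dimvS; apply/subvP => x /aP[c' ->]; apply: rpred_sum => i _.
    by rewrite rpredZ // memv_span //; apply/tnthP; exists i; rewrite tnth_mktuple.
  move/freeP: free_a; apply; apply: phi_inj; rewrite -[RHS]sum0 (phi_sum phi_lin).
  by apply: eq_bigr => i _; rewrite (phiZ phi_lin) -tnth_nth tnth_mktuple.
have uG : G \in unitmx.
  rewrite unitmxE unitfE; apply/negP => /eqP/eqP/det0P[v v0 vG].
  have va : \sum_i v 0 i *: a i = 0.
    apply: ndh => y; have [z zy] := phi_onto y; have [c zE] := aP z (memvf _).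
    rewrite -zy zE (phi_sum phi_lin) (form_sym hH) (form_suml hH) big1 ?rmorph0 // => j _.
    rewrite (phiZ phi_lin) hE (form_sym hH) (form_suml hH).
    have := congr1 (fun r : 'rV_N => r 0 j) vG; rewrite !mxE => e0.
    suff -> : \sum_i h (v 0 i *: a i) (phi (a0 j)) = 0 by rewrite rmorph0 mulr0.
    by rewrite -[RHS]e0; apply: eq_bigr => i _; rewrite (form_Zl hH) /G mxE.
  case/eqP: v0; apply/rowP => i; rewrite mxE; exact: (fa (fun i => v 0 i)).
exists a, (fun j => \sum_l sg (invmx G l j) *: a l) => i j.
rewrite (form_sym hH) (form_suml hH) rmorph_sum /=.
have := congr1 (fun M : 'M_N => M i j) (mulmxV uG); rewrite !mxE => <-.
by apply: eq_bigr => l _; rewrite (form_Zl hH) rmorphM /= sgK -(form_sym hH) /G mxE mulrC.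
Qed.

(** The wedges of the (k+1)-subsets of the basis are independent: evaluated at the dual tuple of
    another subset, the matrix has a zero row. *)
Lemma finite_lower_bound S : generates h k.+1 S ->
  exists g : 'I_('C(N, k.+1)) -> V -> Prop, injective g /\ forall x, S (g x).
Proof.
move=> gS; have [a [w aw]] := dual_family.
pose B := {A : {set 'I_N} | #|A| == k.+1}.
pose elt (A : B) (i : 'I_k.+1) := enum_val (cast_ord (esym (eqP (valP A))) i) : 'I_N.
have eltI A : injective (elt A) by move=> i j /enum_val_inj/cast_ord_inj.
have eltP A i : elt A i \in val A by apply: enum_valP.
have elt_onto (A : B) x : x \in val A -> exists i, elt A i = x.
  move=> xA; exists (cast_ord (eqP (valP A)) (enum_rank_in xA x)).
  by rewrite /elt cast_ordK enum_rankK_in.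
pose wA (A : B) := grassmann h (a \o elt A).
have wAA A A' : wA A (w \o elt A') = (A == A')%:R.
  rewrite /wA /grassmann; have [<-|AA'] := eqVneq A A'.
    rewrite -[RHS](det1 F k.+1); congr (\det _); apply/matrixP => i j; rewrite !mxE /= aw.
    by rewrite (inj_eq (@eltI A)).
  have /subsetPn[x xA xA'] : ~~ (val A \subset val A').
    apply: contra AA' => sub; apply/eqP/val_inj/eqP.
    by rewrite eqEcard sub (eqP (valP A)) (eqP (valP A')) leqnn.
  have [p px] := elt_onto A x xA.
  rewrite (expand_det_row _ p) big1 // => j _; rewrite mxE /= aw px.
  by rewrite (_ : x == elt A' j = false) ?mul0r //; apply: contraNF xA' => /eqP->; apply: eltP.
have [||t [tI tS]] := @generates_lower_bound _ _ _ _ hH k S B wA gS.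
- move=> m t c tI sum0 i.
  have := congr1 (fun q => q (w \o elt (t i))) sum0; rewrite fct_sumE (bigD1 i) //= big1 => [|j ji].
    rewrite addr0 => c0; rewrite -[c i]mulr1.
    by have -> : 1 = wA (t i) (w \o elt (t i)) by rewrite wAA eqxx.
  by rewrite -[RHS](mulr0 (c j)); congr (_ * _); rewrite wAA (inj_eq tI) (negbTE ji).
- by move=> M mM Mk A; apply: wedge_in_span.
have cardB : #|{: B}| = 'C(N, k.+1).
  have := card_draws 'I_N k.+1; rewrite card_ord => <-.
  by rewrite card_sig; apply: eq_card => A; rewrite !inE.
exists (fun i => t (enum_val (cast_ord (esym cardB) i))); split=> // i j.
by move=> /tI/enum_val_inj/cast_ord_inj.
Qed.
End Finite.
End LowerBounds.

(** * Generating ranks *)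

Section Rank.
Variables (F : fieldType) (sg : {rmorphism F -> F}) (V : lmodType F) (h : V -> V -> F).
Variables (n : nat) (e f : 'I_n -> V).
Hypothesis sgK : forall a, sg (sg a) = a.
Hypothesis sg_neq : exists a, sg a <> a.
Hypothesis F4 : ~ exists t : 'I_4 -> F, bijective t.
Hypothesis hH : is_sigma_hermitian h sg.
Hypothesis ndh : nondeg_form h.
Hypotheses (ee : forall i j, h (e i) (e j) = 0) (ff : forall i j, h (f i) (f j) = 0)
  (ef : forall i j, h (e i) (f j) = (i == j)%:R).
Hypothesis aniso : forall v, aniso_part h e f v -> h v v = 0 -> v = 0.
Variable k : nat.
Hypothesis kn : (k.+1 < n)%N.

Lemma rank_finite d (b : 'I_d -> V) : basis_fam (aniso_part h e f) b ->
  gr_is_nat h k.+1 'C(2 * n + d, k.+1).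
Proof.
move=> [bV0 [ib spb]].
have lib : lin_indep b by move=> c; apply: ib.
have onto v : image (frame_map e f b) fullv v.
  have [w wV0 ->] := aniso_decomp hH ee ff ef v; apply: image_full_frame.
  by have [m [t [c ->]]] := spb w wV0; apply: image_full_sum => i; apply: image_full_b.
have lower S : generates h k.+1 S ->
    exists g : 'I_('C(2 * n + d, k.+1)) -> V -> Prop, injective g /\ forall x, S (g x).
  apply: (finite_lower_bound sgK sg_neq hH ndh ee ff ef aniso kn lib bV0).
  by move=> v; have [x _ <-] := onto v; exists x.
split=> //; have [m [t [mC kt gt]]] := frame_generation sgK sg_neq F4 hH ee ff ef aniso lib bV0
  (kn : 1 <= k.+1 < n)%N.
have gS : generates h k.+1 (fun Z => exists i, Z = t i).
  split=> [_ [i ->] //|Z kZ P gP Pt]; apply: (gt P gP) => // i.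
  by apply: Pt; exists i.
(* The lower bound, applied to the range of [t], gives C(N, k+1) distinct members, while [t] has at
   most that many indices: [g] therefore exhausts the range and generates. *)
have [g [gI gS']] := lower _ gS; exists g; split=> //.
have [s sP] := boolp.choice gS'.
have sI : injective s by move=> x y exy; apply: gI; rewrite !sP exy.
have s_onto i : exists x, s x = i.
  have ms : (#|'I_m| <= #|'I_('C(2 * n + d, k.+1))|)%N by rewrite !card_ord.
  by have [s' _ s'K] := inj_card_bij sI ms; exists (s' i).
split=> [Z [x ->]|Z kZ P gP Pg]; first by rewrite sP.
apply: (gS.2 Z kZ P gP) => _ [i ->]; have [x <-] := s_onto i.
by rewrite -sP; apply: Pg; exists x.
Qed.

Lemma rank_infinite (B : Type) (b : B -> V) : basis_fam (aniso_part h e f) b ->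
  infinite_type B -> gr_is_card h k.+1 B.
Proof.
move=> [bV0 [ib spb]] infB.
have lower S : generates h k.+1 S -> exists g : B -> V -> Prop, injective g /\ forall x, S (g x).
  by move=> gS; apply: (infinite_lower_bound sgK sg_neq hH ndh ee ff ef kn gS bV0 ib).
split=> //; have [G [gG [c cI]]] : exists G, generates h k.+1 G /\ exists c : {Z | G Z} -> B, injective c.
  elim/boolp.Peq : B b bV0 ib spb infB lower => B b bV0 ib spb infB _.
  pose bs (s : seq B) (i : 'I_(size s)) := b (tnth (in_tuple s) i).
  have [T TP] : exists T : seq B -> nat * (nat -> V -> Prop), forall s, uniq s ->
      (forall i, (i < (T s).1)%N -> ksub h k.+1 ((T s).2 i)) /\
      forall P, geom_subspace h k.+1 P -> (forall i, (i < (T s).1)%N -> P ((T s).2 i)) ->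
      forall X, ksub h k.+1 X -> vsubset X (image (frame_map e f (bs s)) fullv) -> P X.
    have [|T TP] := @boolp.choice (seq B) (nat * (nat -> V -> Prop)) (fun s T => uniq s ->
      (forall i, (i < T.1)%N -> ksub h k.+1 (T.2 i)) /\
      forall P, geom_subspace h k.+1 P -> (forall i, (i < T.1)%N -> P (T.2 i)) ->
      forall X, ksub h k.+1 X -> vsubset X (image (frame_map e f (bs s)) fullv) -> P X); last by exists T.
    move=> s; have [us|nu] := boolP (uniq s); last by exists (0%N, fun _ _ => True).
    have lib : lin_indep (bs s).
      by move=> c; apply: ib; apply/(tuple_uniqP (in_tuple s)).
    have [m [t [_ kt gt]]] := frame_generation sgK sg_neq F4 hH ee ff ef aniso lib
      (fun i => bV0 (tnth (in_tuple s) i)) (kn : 1 <= k.+1 < n)%N.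
    exists (m, fun i v => exists2 j : 'I_m, i = j :> nat & t j v) => _ /=.
    have tE (j : 'I_m) : (fun v => exists2 j' : 'I_m, j = j' :> nat & t j' v) = t j.
      apply: vsubset_anti => v; last by exists j.
      by move=> [j' /val_inj <-].
    split=> [i im|P gP Pt]; first by rewrite (tE (Ordinal im)).
    by apply: gt => // i; have := Pt i (ltn_ord i); rewrite tE.
  exists (fun Z => exists s i, [/\ uniq s, (i < (T s).1)%N & Z = (T s).2 i]); split; last first.
    have [enc encI] := seq_nat_inj infB.
    have [|code codeP] := @boolp.choice {Z | exists s i, [/\ uniq s, (i < (T s).1)%N & Z = (T s).2 i]} (seq B * nat)
      (fun Z u => sval Z = (T u.1).2 u.2).
      by move=> [Z [s [i [us im ZE]]]]; exists (s, i).
    exists (enc \o code) => -[Z GZ] [Z' GZ'] /encI e1.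
    have /= := codeP (exist _ Z GZ); rewrite e1 => e2.
    have /= := codeP (exist _ Z' GZ'); rewrite -e2 => e3; subst Z'.
    by rewrite (boolp.Prop_irrelevance GZ GZ').
  split=> [_ [s [i [us im ->]]]|Z kZ P gP PG]; first exact: (TP s us).1.
  (* The property persists for larger lists, so one list serves all spanning vectors of Z. *)
  have cover v : exists s : seq B, forall s' : seq B, {subset s <= s'} -> image (frame_map e f (bs s')) fullv v.
    have [w wV0 ->] := aniso_decomp hH ee ff ef v; have [m [t [c ->]]] := spb w wV0.
    exists (codom t) => s' sub; apply: image_full_frame; apply: image_full_sum => i.
    have ts : t i \in s' by apply: sub; apply: codom_f.
    have lt : (index (t i) s' < size s')%N by rewrite index_mem.
    have -> : b (t i) = bs s' (Ordinal lt) by rewrite /bs (tnth_nth (t i)) /= nth_index.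
    exact: image_full_b.
  have [[u [_ uZ]] _] := kZ; have [s sP] := boolp.choice (fun i => cover (u i)).
  pose s0 := undup (flatten (codom s)).
  have [_ gT] := TP s0 (undup_uniq _); apply: gT => //.
    by move=> i im; apply: PG; exists s0, i; rewrite undup_uniq.
  move=> v /uZ[a ->]; apply: image_full_sum => i; apply: sP => x xs.
  by rewrite mem_undup; apply/flattenP; exists (s i) => //; apply: codom_f.
have [g [gI gS]] := lower _ gG.
pose g' x : {Z | G Z} := exist _ (g x) (gS x).
have g'I : injective g' by move=> x y /(congr1 sval)/gI.
have [t [tI t_onto]] := cantor_bernstein g'I cI.
exists (fun x => sval (t x)); split=> [x y exy|].
  apply: tI; case: (t x) (t y) exy => [Z GZ] [Z' GZ'] /= exy; subst Z'.
  by rewrite (boolp.Prop_irrelevance GZ GZ').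
split=> [_ [x ->]|Z kZ P gP Pt]; first by apply: gG.1; apply: svalP.
apply: (gG.2 Z kZ P gP) => W GW; have [x tx] := t_onto (exist _ W GW).
by apply: Pt; exists x; rewrite tx.
Qed.
End Rank.

Unset Implicit Arguments.

Theorem theorem1 (F : fieldType) (sigma : {rmorphism F -> F})
  (V : lmodType F) (h : V -> V -> F) (n : nat)
  (e f : 'I_n -> V) :
  (forall x, sigma (sigma x) = x) ->
  (exists x, sigma x <> x) ->
  (~ exists t : 'I_4 -> F, bijective t) ->
  is_sigma_hermitian h sigma ->
  nondeg_form h ->
  (2 <= n)%N ->
  (* hyperbolic pairs spanning V_1, ..., V_n *)
  (forall i j, h (e i) (e j) = 0) ->
  (forall i j, h (f i) (f j) = 0) ->
  (forall i j, h (e i) (f j) = (i == j)%:R) ->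
  (* V_0 = orthogonal complement of V_1 + ... + V_n is anisotropic *)
  (forall v, (forall i, h v (e i) = 0 /\ h v (f i) = 0) -> h v v = 0 -> v = 0) ->
  forall k : nat, (1 <= k)%N -> (k < n)%N ->
    (forall (d : nat) (b : 'I_d -> V),
       basis_fam (fun v => forall i, h v (e i) = 0 /\ h v (f i) = 0) b ->
       gr_is_nat h k 'C(2 * n + d, k)) /\
    (forall (B : Type) (b : B -> V),
       basis_fam (fun v => forall i, h v (e i) = 0 /\ h v (f i) = 0) b ->
       infinite_type B ->
       gr_is_card h k B).
Proof.
move=> sgK sg_neq F4 hH ndh n2 ee ff ef aniso [//|k] _ kn; split=> [d b|B b].
  exact: (rank_finite sgK sg_neq F4 hH ndh ee ff ef aniso kn).
exact: (rank_infinite sgK sg_neq F4 hH ndh ee ff ef aniso kn).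
Qed.
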